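(* If $-y\ge r/(4c)$, then for every $x\in[0,D]$ one has $V(x)=U(x)$, where $V$ is the value of the original game and $U$ is the value of the hitting time game described in the context.
   Context: Fixed data: constants $D>0$, $r>0$, $c_1>0$, $c_2>0$, $y\in\mathbb{R}$; $c:=(c_1^{-1}+c_2^{-1})^{-1}$; and a continuous, strictly increasing function $h:[0,D]\to[0,\infty)$ with $h(0)=0$. Let $\mathcal{P}$ be the set of continuous functions $[0,\infty)\to\mathbb{R}$ starting at $0$, and $\mathcal{E}$ the set of nondecreasing right-continuous functions with left limits $[0,\infty)\to[0,\infty)$ (a positive value at time $0$ is allowed and is regarded as a jump at time $0$). Both are endowed with the topology of uniform convergence on compacts. For $T\ge0$ and $\psi=(\psi^1,\psi^2)\in\mathcal{P}^2$ let $\mathbb{I}(T,\psi)=\int_0^T\big[c_1(\dot\psi^1(s))^2+c_2(\dot\psi^2(s))^2\big]ds$ if $\psi^1,\psi^2$ are absolutely continuous on $[0,T]$, and $\mathbb{I}(T,\psi)=+\infty$ otherwise. Original game. Given $x\in[0,D]$, $\psi\in\mathcal{P}^2$, $(\zeta,\varrho)\in\mathcal{E}^2$, the dynamics are $\varphi(t)=x+yt+\psi^1(t)-\psi^2(t)+\zeta(t)-\varrho(t)$, $t\ge0$. A strategy is a measurable map $\alpha:\mathcal{P}^2\to\mathcal{E}^2$ that is causal: for every $t\ge 0$, if $\psi=\tilde\psi$ on $[0,t]$ then $\alpha[\psi]=\alpha[\tilde\psi]$ on $[0,t]$. Let $\mathcal{A}_x$ be the set of strategies such that for every $\psi\in\mathcal{P}^2$,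 with $(\zeta,\varrho)=\alpha[\psi]$, one has $\varphi(t)\in[0,D]$ for all $t\ge0$. Set $$c(x,T,\psi,\zeta,\varrho)=\int_0^Th(\varphi(t))\,dt+r\varrho(T)-\mathbb{I}(T,\psi),\qquad V(x)=\inf_{\alpha\in\mathcal{A}_x}\ \sup_{\psi\in\mathcal{P}^2,\,T\in[0,\infty)}c(x,T,\psi,\alpha[\psi]).$$ Hitting time game. Given $x\in[0,D]$, $\psi\in\mathcal{P}^2$, $\varrho\in\mathcal{E}$, the dynamics are $\varphi_{x,\psi,\varrho}(t)=x+yt+\psi^1(t)-\psi^2(t)-\varrho(t)$, $t\ge0$, and $\tau(x,\psi,\varrho)=\inf\{t\ge0:\varphi_{x,\psi,\varrho}(t)=0\}$ ($\inf\emptyset=\infty$). A strategy is a map $\bar\alpha:\mathcal{P}^2\to\mathcal{E}$ that is causal: for every $t\ge0$, if $\psi=\tilde\psi$ on $[0,t]$ then $\bar\alpha[\psi]=\bar\alpha[\tilde\psi]$ on $[0,t]$. Let $\bar{\mathcal{A}}_x$ be the set of strategies such that for every $\psi\in\mathcal{P}^2$, with $\varrho=\bar\alpha[\psi]$, one has $\varphi_{x,\psi,\varrho}(t)\in[0,D]$ for all finite $t\in[0,\tau(x,\psi,\varrho)]$. Let $\mathcal{Q}[x,\bar\alpha]=\{\psi\in\mathcal{P}^2:\tau(x,\psi,\bar\alpha[\psi])<\infty\}$. For $\psi\in\mathcal{Q}[x,\bar\alpha]$ set, with $\tau=\tau(x,\psi,\bar\alpha[\psi])$ and $\varphi=\varphi_{x,\psi,\bar\alpha[\psi]}$,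 $$\bar c(x,\psi,\bar\alpha[\psi])=\int_0^\tau h(\varphi(t))\,dt+r\,\bar\alpha[\psi](\tau)-\mathbb{I}(\tau,\psi),\qquad U(x)=\inf_{\bar\alpha\in\bar{\mathcal{A}}_x}\ \sup_{\psi\in\mathcal{Q}[x,\bar\alpha]}\bar c(x,\psi,\bar\alpha[\psi]).$$ *)

(* Defs.v *)
From HB Require Import structures.
From mathcomp Require Import all_boot all_order all_algebra.
From mathcomp Require Import all_classical all_reals all_analysis.
Set Implicit Arguments.
Unset Strict Implicit.
Unset Printing Implicit Defensive.
Import Order.TTheory GRing.Theory Num.Theory.
Import numFieldNormedType.Exports.
Local Open Scope classical_set_scope.
Local Open Scope ring_scope.

(* A function on [0, oo[ is encoded by its extension by 0 to all of R.  This is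
   a bijective encoding, under which uniform convergence on the compact subsets
   of [0, oo[ is uniform convergence on the compact subsets of R. *)

Definition path_set (R : realType) : set {family compact, R -> R} :=
  [set f : R -> R | [/\ forall t, t < 0 -> f t = 0,
                        {within `[0, +oo[, continuous f} & f 0 = 0]].

Definition control_set (R : realType) : set {family compact, R -> R} :=
  [set f : R -> R |
    [/\ forall t, t < 0 -> f t = 0,
        forall t, 0 <= t -> 0 <= f t,
        forall s t, 0 <= s -> s <= t -> f s <= f t,
        forall t, 0 <= t -> f s @[s --> t^'+] --> f t &
        forall t, 0 < t -> cvg (f s @[s --> t^'-])]].

(* The spaces P and E, each with the topology induced by uniform convergence on
   compacts. *)
Definition cpath (R : realType) : Type := set_type (@path_set R).
HB.instance Definition _ (R : realType) :=
  Topological.copy (cpath R) (set_type (@path_set R)).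

Definition control (R : realType) : Type := set_type (@control_set R).
HB.instance Definition _ (R : realType) :=
  Topological.copy (control R) (set_type (@control_set R)).

Definition cpath_fun (R : realType) (f : cpath R) : R -> R := set_val f.
Coercion cpath_fun : cpath >-> Funclass.

Definition control_fun (R : realType) (f : control R) : R -> R := set_val f.
Coercion control_fun : control >-> Funclass.

Definition borel_measurable (X Y : topologicalType) (f : X -> Y) : Prop :=
  forall B : set Y, <<s @open Y >> B -> <<s @open X >> (f @^-1` B).

Definition eq_upto (R : realType) (t : R) (f g : R -> R) : Prop :=
  forall s, 0 <= s <= t -> f s = g s.

Definition eq_upto2 (R : realType) (t : R) (psi psi' : cpath R * cpath R) : Prop :=
  eq_upto t psi.1 psi'.1 /\ eq_upto t psi.2 psi'.2.

Definition abs_continuous (R : realType) (a b : R) (f : R -> R) : Prop :=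
  forall e : R, 0 < e -> exists2 d : R, 0 < d &
    forall s : seq (R * R),
      all (fun I => [&& a <= I.1, I.1 <= I.2 & I.2 <= b]) s ->
      pairwise (fun I J => (I.2 <= J.1) || (J.2 <= I.1)) s ->
      \sum_(I <- s) (I.2 - I.1) < d ->
      \sum_(I <- s) `|f I.2 - f I.1| < e.

Section games.
Context {R : realType}.
(* [h] is only meaningful on [0, D]: admissibility keeps its argument there. *)
Variables (D r c1 c2 y : R) (h : R -> R).

Local Notation mu := (@lebesgue_measure R).

(* [derive1 f] has a junk value where [f] is not differentiable, that is, on a null
   set when [f] is absolutely continuous. *)
Definition energy (T : R) (psi : cpath R * cpath R) : \bar R :=
  if `[< abs_continuous 0 T psi.1 /\ abs_continuous 0 T psi.2 >]
  then (\int[mu]_(s in `[0%R, T])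
          (c1 * (derive1 psi.1 s) ^+ 2
           + c2 * (derive1 psi.2 s) ^+ 2)%:E)%E
  else +oo%E.

Definition dynamics (x : R) (psi : cpath R * cpath R) (zeta rho : control R)
    (t : R) : R :=
  x + y * t + psi.1 t - psi.2 t + zeta t - rho t.

Definition strategy (alpha : cpath R * cpath R -> control R * control R) : Prop :=
  borel_measurable alpha /\
  forall (t : R) (psi psi' : cpath R * cpath R), 0 <= t -> eq_upto2 t psi psi' ->
    eq_upto t (alpha psi).1 (alpha psi').1 /\
    eq_upto t (alpha psi).2 (alpha psi').2.

Definition admissible (x : R)
    (alpha : cpath R * cpath R -> control R * control R) : Prop :=
  strategy alpha /\
  forall (psi : cpath R * cpath R) (t : R), 0 <= t ->
    0 <= dynamics x psi (alpha psi).1 (alpha psi).2 t <= D.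

Definition cost (x T : R) (psi : cpath R * cpath R) (zeta rho : control R) : \bar R :=
  (\int[mu]_(t in `[0%R, T]) (h (dynamics x psi zeta rho t))%:E
   + (r * rho T)%:E - energy T psi)%E.

Definition game_value (x : R) : \bar R :=
  ereal_inf [set ereal_sup
      [set cost x p.2 p.1 (alpha p.1).1 (alpha p.1).2 |
         p in [set p : (cpath R * cpath R) * R | 0 <= p.2]]
    | alpha in admissible x].

Definition hit_dynamics (x : R) (psi : cpath R * cpath R) (rho : control R)
    (t : R) : R :=
  x + y * t + psi.1 t - psi.2 t - rho t.

Definition hit_time (x : R) (psi : cpath R * cpath R) (rho : control R) : \bar R :=
  ereal_inf [set t%:E | t in [set t : R | 0 <= t /\ hit_dynamics x psi rho t = 0]].

Definition hit_strategy (alpha : cpath R * cpath R -> control R) : Prop :=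
  forall (t : R) (psi psi' : cpath R * cpath R), 0 <= t -> eq_upto2 t psi psi' ->
    eq_upto t (alpha psi) (alpha psi').

Definition hit_admissible (x : R) (alpha : cpath R * cpath R -> control R) : Prop :=
  hit_strategy alpha /\
  forall (psi : cpath R * cpath R) (t : R),
    0 <= t -> (t%:E <= hit_time x psi (alpha psi))%E ->
    0 <= hit_dynamics x psi (alpha psi) t <= D.

Definition hit_paths (x : R) (alpha : cpath R * cpath R -> control R) :
    set (cpath R * cpath R) :=
  [set psi | (hit_time x psi (alpha psi) < +oo)%E].

Definition hit_cost (x : R) (psi : cpath R * cpath R) (rho : control R) : \bar R :=
  let tau := fine (hit_time x psi rho) in
  (\int[mu]_(t in `[0%R, tau]) (h (hit_dynamics x psi rho t))%:E
   + (r * rho tau)%:E - energy tau psi)%E.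

Definition hit_value (x : R) : \bar R :=
  ereal_inf [set ereal_sup
      [set hit_cost x psi (alpha psi) | psi in hit_paths x alpha]
    | alpha in hit_admissible x].

End games.

(* Main.v *)
(* Both values equal an explicit function [Wf].  Write [G] for the conjugate of the energy
   rate, so that [G p = p * y + p ^+ 2 / (4 * c)]; the hypothesis on [y] says exactly that
   [- G r >= 0].  Let [slope z] be the smaller root [p] of [G p = - min (h z) (- G r)],
   [W] its primitive, the barrier the level where [h] reaches [- G r], and [Wf] the function
   equal to [W] below the barrier and of slope [r] above it.

   hit_value <= game_value: given a strategy of the original game, drop [zeta], use [rho]
   until it first reaches [x + w], [w] being the uncontrolled displacement, and let the
   state hit [0] then; this only makes the state smaller, and [h] is increasing.

   game_value <= Wf: reflect at [0] and at a level that decreases slowly to the barrier.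
   On a fine grid, convexity of the potential and the inequality [energy >= p * dw - G p * dt]
   on each step make the cost telescope.  The energy inequality is the fundamental theorem
   of calculus for absolutely continuous functions.  The level is kept positive, so that
   on bounded time intervals the two one-sided reflections alternate finitely often; hence
   the strategy is continuous in the path, in particular Borel.

   Wf <= hit_value: the maximizer plays with velocity [y + r / (2 * c)] while the state is
   above the barrier, for a bounded time, and with a velocity slightly below
   [y + slope / (2 * c)] otherwise, updated on a grid from the observed reply.  The latter velocity is bounded away from [0],
   so [0] is hit in bounded time, and the gains telescope again. *)
Require Import Defs.
From HB Require Import structures.
From mathcomp Require Import all_boot all_order all_algebra.
From mathcomp Require Import all_classical all_reals all_analysis.
From mathcomp Require Import measurable_realfun lra ring.
Set Implicit Arguments.
Unset Strict Implicit.
Unset Printing Implicit Defensive.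
Import Order.TTheory GRing.Theory Num.Theory.
Import numFieldNormedType.Exports.
Local Open Scope classical_set_scope.
Local Open Scope ring_scope.

(** * Absolutely continuous functions *)

(** [G p] is the maximum over velocities [u] of [p * u - c * (u - y) ^+ 2], attained at
    [u = y + p / (2 * c)], and [h + G (W') = 0] is the Hamilton-Jacobi equation below the barrier.
    The smaller root is taken because its velocity never points up, away from the place where the
    hitting game ends. At the threshold [- G r] the price [r] may be either root; if it is the
    larger one, [Wf] has a convex kink at the barrier.

    Three degenerate cases shape the estimates. If [r = - 2 * c * y], the optimal velocity vanishes
    where [h] reaches [- G r], so the maximizer shrinks the slope by a factor [l < 1] to be sure to
    hit [0]. If [- G r = 0], the barrier is [0] and leaves no room between the two reflections, so
    the level is lifted; the error must stay bounded over every horizon, which the maximizer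
    chooses, hence an allowance integrable in time. If [h D <= - G r], the barrier is [D] and the
    level cannot exceed it, so the potential is bent strictly below the level, to give states near
    the level the slope [r] exactly. *)

Section partition_intervals.
Context {R : realType}.
Implicit Types (a b : R) (s : seq R) (F : R -> R).

Definition intervals a s : seq (R * R) := zip (a :: s) s.

Lemma intervals_variation a b F s : itv_partition a b s ->
  variation a b F s = \sum_(I <- intervals a s) `|F I.2 - F I.1|.
Proof.
move=> abs; rewrite variation_zip// /intervals.
elim: s a {abs} (a :: s) => [|h t ih] a l /=; first by case: l => [|? ?]; rewrite !big_nil.
by case: l => [|c l]/=; rewrite ?big_nil// !big_cons ih.
Qed.

Lemma intervals_all a b s : itv_partition a b s ->
  all (fun I => [&& a <= I.1, I.1 <= I.2 & I.2 <= b]) (intervals a s).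
Proof.
elim: s a => //= h t ih a [/= /andP[ah ht] lb].
have hb : itv_partition h b t by [].
rewrite lexx (ltW ah) (itv_partition_le hb)/=.
apply: sub_all (ih _ hb) => -[u v]/= /and3P[hu -> ->].
by rewrite (le_trans (ltW ah) hu).
Qed.

Lemma intervals_pairwise a b s : itv_partition a b s ->
  pairwise (fun I J => (I.2 <= J.1) || (J.2 <= I.1)) (intervals a s).
Proof.
elim: s a => //= h t ih a [/= /andP[ah ht] lb].
have hb : itv_partition h b t by [].
apply/andP; split; last exact: ih hb.
by apply: sub_all (intervals_all hb) => -[u v]/= /and3P[->].
Qed.

Lemma intervals_telescope a b F s : itv_partition a b s ->
  \sum_(I <- intervals a s) (F I.2 - F I.1) = F b - F a.
Proof.
elim: s a => [|h t ih] a; first by move=> /itv_partition_nil ->; rewrite big_nil subrr.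
move=> [/= /andP[ah ht] lb]; rewrite /intervals /= big_cons/= ih//.
by rewrite addrC addrA subrK.
Qed.

End partition_intervals.

Section absolutely_continuous.
Context {R : realType}.
Variables (T : R) (F : R -> R).
Hypotheses (T_ge0 : 0 <= T) (ACF : abs_continuous 0 T F).

Notation TV := total_variation.

Lemma abs_continuous_variation (e : R) : 0 < e -> exists2 d : R, 0 < d &
  forall a b s, 0 <= a -> b <= T -> itv_partition a b s -> b - a < d ->
    variation a b F s < e.
Proof.
move=> e0; have [d d0 H] := ACF e0; exists d => // a b s a0 bT abs abd.
rewrite intervals_variation//; apply: H; last 2 first.
- exact: intervals_pairwise abs.
- by rewrite (intervals_telescope id abs).
- apply: sub_all (intervals_all abs) => -[u v]/= /and3P[au -> vb].
  by rewrite (le_trans a0 au) (le_trans vb bT).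
Qed.

(** Pieces shorter than the [d] belonging to [1] have variation at most [1], and finitely many
    pieces of length [d / 2] cover [[0, T]]. *)
Lemma abs_continuous_bounded_variation : bounded_variation 0 T F.
Proof.
have [d d0 H] := abs_continuous_variation ltr01.
suff main n t : 0 <= t -> t <= T -> t <= n%:R * (d / 2) -> TV 0 t F \is a fin_num.
  apply/bounded_variationP => //; apply: (main (Num.bound (T / (d / 2)))) => //.
  rewrite -ler_pdivrMr ?divr_gt0//; apply/ltW.
  by apply: le_lt_trans (archi_boundP _) => //; rewrite divr_ge0// divr_ge0// ltW.
elim: n t => [|n ih] t t0 tT.
  rewrite mul0r => t0'; have -> : t = 0 by apply/eqP; rewrite eq_le t0 t0'.
  by rewrite total_variationxx.
rewrite mulrSr mulrDl mul1r => tn.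
have [tn'|/ltW tn'] := leP t (n%:R * (d / 2)); first exact: ih.
have u0 : 0 <= n%:R * (d / 2) by rewrite mulr_ge0// divr_ge0// ltW.
rewrite (total_variationD _ u0 tn') fin_numD ih//= ?(le_trans tn')//.
apply/bounded_variationP => //; exists 1 => _ [s us <-].
apply/ltW/H => //; apply: (@le_lt_trans _ _ (d / 2)); first by rewrite lerBlDl.
by rewrite ltr_pdivrMr// ltr_pMr// ltr1n.
Qed.

(** The left-hand side is twice the sum of the positive increments of [F t - K * t]. These sit on
    intervals where [F] rises faster than [K]; with [K = V1 / d] and [V1] above the variation of
    [F], their total length is below [d], so [F] varies by less than [e / 2] on them. *)
Lemma abs_continuous_positive_variation (e : R) : 0 < e ->
  exists2 K : R, 0 <= K & forall s, itv_partition 0 T s ->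
    variation 0 T (fun t => F t - K * t) s + (F T - K * T - F 0) <= e.
Proof.
move=> e0.
have [d d0 H] := ACF (divr_gt0 e0 (ltr0n _ 2)).
have [V HV] := abs_continuous_bounded_variation.
have [V1 V1gt0 {}HV] : exists2 V1 : R, 0 < V1 &
    forall s, itv_partition 0 T s -> variation 0 T F s < V1.
  exists (Num.max V 0 + 1); first by rewrite ltr_wpDl// le_max lexx orbT.
  move=> s Ts; rewrite (@le_lt_trans _ _ (Num.max V 0))// ?ltrDl//.
  by rewrite le_max; apply/orP; left; apply: HV; exists s.
have K0 : 0 < V1 / d by rewrite divr_gt0.
exists (V1 / d); first exact: ltW.
move=> s Ts; set K := V1 / d in K0 *; set G := fun t => _.
have -> : F T - K * T - F 0 = G T - G 0 by rewrite /G mulr0 subr0.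
rewrite intervals_variation// -(intervals_telescope G Ts) -big_split/=.
pose sel := [seq I <- intervals 0 s | 0 < G I.2 - G I.1].
have all_s := intervals_all Ts.
have lenF I : I \in sel -> K * (I.2 - I.1) <= F I.2 - F I.1 /\ G I.2 - G I.1 <= F I.2 - F I.1.
  rewrite mem_filter => /andP[GI /(allP all_s) /and3P[_ I12 _]].
  move: GI; rewrite /G => GI; split; first by apply/ltW; lra.
  have : 0 <= K * (I.2 - I.1) by rewrite mulr_ge0 ?subr_ge0// ltW.
  lra.
have all_sel : all (fun I => [&& 0 <= I.1, I.1 <= I.2 & I.2 <= T]) sel.
  by apply/allP => I; rewrite mem_filter => /andP[_ /(allP all_s)].
have sel_lt : \sum_(I <- sel) `|F I.2 - F I.1| < e / 2.
  apply: H => //; first exact: (pairwise_filter _ (intervals_pairwise Ts)).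
  suff : K * \sum_(I <- sel) (I.2 - I.1) < V1.
    by rewrite /K mulrAC ltr_pdivrMr// ltr_pM2l.
  apply: le_lt_trans (HV _ Ts); rewrite intervals_variation// mulr_sumr.
  apply: (@le_trans _ _ (\sum_(I <- sel) `|F I.2 - F I.1|)).
    rewrite big_seq [leRHS]big_seq; apply: ler_sum => I /lenF[+ _].
    by move=> /le_trans; apply; exact: ler_norm.
  by rewrite big_filter big_mkcond; apply: ler_sum => I _; case: ifP.
have -> : e = 2 * (e / 2) by rewrite mulrC divfK.
apply: (@le_trans _ _ (2 * \sum_(I <- sel) `|F I.2 - F I.1|)); last first.
  by rewrite ler_pM2l// ltW.
apply: (@le_trans _ _ (2 * \sum_(I <- sel) (G I.2 - G I.1))); last first.
  rewrite ler_pM2l// big_seq [leRHS]big_seq; apply: ler_sum => I /lenF[_].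
  by move=> /le_trans; apply; exact: ler_norm.
rewrite mulr_sumr big_filter [leRHS]big_mkcond; apply: ler_sum => I _.
case: ltP => GI; first by rewrite gtr0_norm// mulr_natl mulr2n.
by rewrite ler0_norm// addNr.
Qed.

End absolutely_continuous.

(** * Stieltjes measures and their densities *)

Section stieltjes.
Context {R : realType}.
Local Notation LS := (@lebesgue_stieltjes_measure R).
Local Notation mu := (@lebesgue_measure R).
Implicit Types (f g P : cumulative R R).

Lemma cumulative_ext (f : R -> R) : nondecreasing f ->
  (forall x, f t @[t --> x^'+] --> f x) ->
  exists c : cumulative R R, (c : R -> R) = f.
Proof.
move=> ndf rcf.
pose m := @isCumulative.Build R _ R f ndf rcf.
by exists (HB.pack_for (cumulative R R) f m).
Qed.

Lemma stieltjes_itv f (a b : R) : a <= b -> LS f `]a, b] = (f b - f a)%:E.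
Proof.
move=> ab; rewrite /lebesgue_stieltjes_measure /measure_extension measurable_mu_extE/=;
  last exact: is_ocitv.
by rewrite wlength_itv_bnd.
Qed.

Lemma stieltjesD f g P : (forall t, P t = f t + g t) ->
  forall A, measurable A -> LS P A = (LS f A + LS g A)%E.
Proof.
move=> PE A mA; rewrite -measure_addE.
apply: (@lebesgue_stieltjes_measure_unique _ P (measure_add (LS f) (LS g))) => //.
move=> _ /ocitvP[->|[[a b]/= /ltW ab ->]]; first by rewrite !measure0.
transitivity (LS f `]a, b] + LS g `]a, b])%E; last by rewrite [RHS]measure_addE.
by rewrite !stieltjes_itv// !PE -EFinD; congr (_%:E); ring.
Qed.

Lemma le_stieltjes f P :
  (forall s t, s <= t -> f t - f s <= P t - P s) ->
  forall A, measurable A -> (LS f A <= LS P A)%E.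
Proof.
move=> fP A mA.
have [||c cE] := @cumulative_ext (fun t => P t - f t).
- by move=> s t st; have := fP _ _ st; lra.
- move=> x; apply: cvgB; exact: cumulative_is_right_continuous.
rewrite (@stieltjesD f c P) ?leeDl// => t; by rewrite cE addrC subrK.
Qed.

(** The part [K * t] contributes a multiple of Lebesgue measure, which does not charge null sets. *)
Lemma stieltjes_null f P (K : R) : 0 <= K ->
  (forall s t, s <= t -> f t - f s <= P t - P s + K * (t - s)) ->
  forall A, measurable A -> mu A = 0%E -> (LS f A <= LS P A)%E.
Proof.
move=> K0 fP A mA A0.
have cvgK x : K * t @[t --> x^'+] --> K * x.
  by apply: cvgMr; apply: cvg_at_right_filter; exact: cvg_id.
have [||k kE] := @cumulative_ext (fun t => K * t) => //.
  by move=> s t st; rewrite ler_wpM2l.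
have [||c cE] := @cumulative_ext (fun t => P t + K * t).
- by move=> s t st; apply: lerD; [exact: cumulative_is_nondecreasing|rewrite ler_wpM2l].
- by move=> x; apply: cvgD => //; exact: cumulative_is_right_continuous.
have k0 : LS k A = 0%E.
  pose K' := NngNum K0; transitivity (mscale K' mu A);
    last by rewrite (_ : mscale _ _ _ = (K%:E * mu A)%E)// A0 mule0.
  apply: (@lebesgue_stieltjes_measure_unique _ k (mscale K' mu)) => //.
  move=> _ /ocitvP[->|[[a b]/= ab ->]]; first by rewrite !measure0.
  rewrite stieltjes_itv ?ltW// /mscale/= lebesgue_measure_itv/= lte_fin ab.
  by rewrite kE -EFinB -EFinM mulrBr.
rewrite -[leRHS]adde0 -k0 -(@stieltjesD P k c)//; last by move=> t; rewrite cE kE.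
by apply: le_stieltjes => // s t st; have := fP _ _ st; rewrite cE; lra.
Qed.

(** Up to a function of total increase [e], [f] is Lipschitz; so its measure gives every null subset
    of []0, T]] at most [e], for each [e]. Hence it is absolutely continuous and Radon-Nikodym
    applies. *)
Lemma stieltjes_density f (T : R) : 0 <= T ->
  (forall e : R, 0 < e -> exists P (K : R), [/\ 0 <= K, P T - P 0 <= e &
     forall s t, s <= t -> f t - f s <= P t - P s + K * (t - s)]) ->
  exists g : R -> R, mu.-integrable setT (EFin \o g) /\
    forall t, 0 <= t -> t <= T -> f t - f 0 = \int[mu]_(x in `]0, t]) g x.
Proof.
move=> T0 Hf.
have mD : measurable (`]0, T]%classic : set (measurableTypeR R)) by exact: measurable_itv.
have foo : (LS f `]0%R, T] < +oo)%E by rewrite stieltjes_itv// ltry.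
pose nu : {finite_measure set (measurableTypeR R) -> \bar R} := mfrestr mD foo.
have dom : nu `<< mu.
  apply/null_content_dominatesP => A mA A0; apply/eqP; rewrite eq_le measure_ge0 andbT.
  apply/lee_addgt0Pr => e e0; rewrite add0e.
  have [P [K [K0 PT fP]]] := Hf e e0.
  have mAD : measurable (A `&` `]0, T]) by exact: measurableI.
  apply: (@le_trans _ _ (LS P (A `&` `]0%R, T]))).
    apply: (stieltjes_null K0 fP mAD).
    apply/eqP; rewrite eq_le measure_ge0 andbT -A0.
    apply: le_measure; [by rewrite inE; exact: mAD|by rewrite inE|exact: subIsetl].
  apply: (@le_trans _ _ (LS P `]0%R, T])).
    by apply: le_measure; [by rewrite inE; exact: mAD|by rewrite inE|exact: subIsetr].
  by rewrite stieltjes_itv// lee_fin.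
have [g [g0 gfin gint gE]] := radon_nikodym_sigma_finite dom.
have gEF : EFin \o (fine \o g) = g by apply/funext => x /=; rewrite fineK.
exists (fine \o g); rewrite gEF; split => // t t0 tT.
rewrite /Rintegral; under eq_integral do rewrite fineK//.
rewrite -gE//= /mfrestr/= /mrestr/= setIidl ?stieltjes_itv//.
by apply: subset_itvl; rewrite bnd_simp.
Qed.

End stieltjes.

Section clip.
Context {R : realType}.
Variables (T : R).
Hypothesis T_ge0 : 0 <= T.

Definition clip (t : R) := Num.max 0 (Num.min t T).

Lemma clip_itv t : 0 <= clip t <= T.
Proof. by rewrite /clip le_max lexx/= ge_max T_ge0 ge_min lexx orbT. Qed.

Lemma clip_id t : 0 <= t -> t <= T -> clip t = t.
Proof. by move=> t0 tT; rewrite /clip (min_idPl tT) (max_idPr t0). Qed.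

Lemma clip_le s t : s <= t -> clip s <= clip t.
Proof.
move=> st; have := T_ge0; rewrite /clip /Num.max /Num.min.
by case: (ltP t T) => ?; case: (ltP s T) => ?; do ![case: (ltP 0 _) => ?]; lra.
Qed.

Lemma clip_lipschitz s t : s <= t -> clip t - clip s <= t - s.
Proof.
move=> st; have := T_ge0; rewrite /clip /Num.max /Num.min.
by case: (ltP t T) => ?; case: (ltP s T) => ?; do ![case: (ltP 0 _) => ?]; lra.
Qed.

Lemma continuous_clip : continuous clip.
Proof.
apply: max_fun_continuous; first exact: cst_continuous.
by apply: min_fun_continuous; [move=> ?; exact: cvg_id|exact: cst_continuous].
Qed.

Lemma cumulative_clip (V : R -> R) :
  (forall s t, 0 <= s -> s <= t -> t <= T -> V s <= V t) ->
  (forall t, 0 <= t -> t < T -> V s @[s --> t^'+] --> V t) ->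
  exists c : cumulative R R, (c : R -> R) = V \o clip.
Proof.
move=> ndV rcV; apply: cumulative_ext.
  move=> s t st /=; have /andP[s0 _] := clip_itv s; have /andP[_ tT] := clip_itv t.
  by apply: ndV => //; exact: clip_le.
move=> t; have [t0|t0] := ltP t 0; last have [tT|tT] := ltP t T.
- apply: (@cvg_trans _ ((fun=> V (clip t)) @ t^'+)); last exact: cvg_cst.
  apply: near_eq_cvg; near=> s => /=.
  suff -> : clip s = clip t by [].
  have s0 : s <= 0 by near: s; apply: nbhs_right_le.
  by rewrite /clip !(min_idPl _) ?(le_trans _ T_ge0)// ?(ltW t0)// !(max_idPl _)// ltW.
- rewrite /= clip_id//; last exact: ltW.
  apply: cvg_trans (rcV _ t0 tT); apply: near_eq_cvg; near=> s => /=.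
  rewrite clip_id//; first by rewrite (le_trans t0)//; apply/ltW.
  by near: s; apply: nbhs_right_le.
- apply: (@cvg_trans _ ((fun=> V (clip t)) @ t^'+)); last exact: cvg_cst.
  apply: near_eq_cvg; near=> s => /=.
  suff -> : clip s = clip t by [].
  have ts : t <= s by apply/ltW; near: s; exact: nbhs_right_gt.
  by rewrite /clip !(min_idPr _) ?(le_trans tT).
Unshelve. all: by end_near. Qed.

End clip.

(** * Jordan decomposition and the fundamental theorem of calculus *)

Section positive_variation.
Context {R : realType}.
Variables (T : R) (G : R -> R).
Hypotheses (T_ge0 : 0 <= T) (cG : continuous G) (BVG : bounded_variation 0 T G).
Local Notation TV := total_variation.

Lemma total_variation_fin s t : 0 <= s -> s <= t -> t <= T -> TV s t G \is a fin_num.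
Proof.
move=> s0 st tT; apply/bounded_variationP => //.
apply: (bounded_variationr s0 st); apply: (bounded_variationl _ tT BVG).
exact: le_trans st.
Qed.

(** Jordan's positive variation of [G] on [[0, t]], up to the additive constant [G 0 / 2]. *)
Definition posvar t := (fine (TV 0 t G) + G t) / 2.

Lemma posvarB s t : 0 <= s -> s <= t -> t <= T ->
  posvar t - posvar s = (fine (TV s t G) + (G t - G s)) / 2.
Proof.
move=> s0 st tT; rewrite /posvar (total_variationD G s0 st) fineD.
- by field.
- by apply: total_variation_fin => //; exact: le_trans tT.
- exact: total_variation_fin.
Qed.

Lemma posvar_le s t : 0 <= s -> s <= t -> t <= T -> posvar s <= posvar t.
Proof.
move=> s0 st tT; rewrite -subr_ge0 posvarB// divr_ge0//.
rewrite -lerBlDr sub0r -lee_fin fineK ?total_variation_fin//.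
apply: le_trans (total_variation_ge G st); rewrite lee_fin.
by rewrite opprB distrC ler_norm.
Qed.

Lemma posvar_right_continuous t : 0 <= t -> t < T ->
  posvar s @[s --> t^'+] --> posvar t.
Proof.
move=> t0 tT; apply: cvgMl; apply: cvgD.
  apply: (total_variation_right_continuous t0 tT) => //.
  by apply: cvg_at_right_filter; exact: cG.
by apply: cvg_at_right_filter; exact: cG.
Qed.

End positive_variation.

Section absolutely_continuous_density.
Context {R : realType}.
Local Notation mu := (@lebesgue_measure R).
Local Notation TV := total_variation.

Lemma abs_continuousN (T : R) (F : R -> R) :
  abs_continuous 0 T F -> abs_continuous 0 T (\- F).
Proof.
move=> ACF e /ACF[d d0 H]; exists d => // s s1 s2 s3.
rewrite (eq_bigr (fun I => `|F I.2 - F I.1|)) ?H// => I _.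
by rewrite -opprD normrN.
Qed.

(** Over [[s, t]] the positive variation of [F] exceeds that of [F - K * t] by at most
    [K * (t - s)], and the latter has small total increase for a suitable [K]. *)
Lemma abs_continuous_posvar_density (T : R) (F : R -> R) : 0 <= T -> continuous F ->
  abs_continuous 0 T F ->
  exists g : R -> R, mu.-integrable setT (EFin \o g) /\
    forall t, 0 <= t -> t <= T -> posvar F t - posvar F 0 = \int[mu]_(x in `]0, t]) g x.
Proof.
move=> T0 cF ACF; have BVF := abs_continuous_bounded_variation T0 ACF.
have [f fE] := cumulative_clip T0 (posvar_le BVF) (posvar_right_continuous cF BVF).
have [|g [gint gE]] := stieltjes_density (f := f) T0; last first.
  exists g; split=> // t t0 tT; rewrite -gE// fE/= !clip_id//.
move=> e e0.
have [K K0 HK] := abs_continuous_positive_variation T0 ACF (mulr_gt0 (ltr0n _ 2) e0).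
pose H t := F t - K * t.
have cH : continuous H.
  by move=> t; apply: cvgB; [exact: cF|apply: cvgMr; exact: cvg_id].
have HTV : (TV 0%R T H <= (2 * e - (H T - H 0))%:E)%E.
  apply: ub_ereal_sup => _ [_ [s sT <-] <-]; rewrite lee_fin.
  by have := HK _ sT; rewrite /H; lra.
have BVH : bounded_variation 0 T H.
  apply/bounded_variationP => //; rewrite ge0_fin_numE ?total_variation_ge0//.
  exact: le_lt_trans HTV (ltry _).
have [P PE] := cumulative_clip T0 (posvar_le BVH) (posvar_right_continuous cH BVH).
exists P, K; split=> //.
  rewrite PE/= !clip_id// (posvarB BVH)// ler_pdivrMr// mulrC.
  by rewrite -lerBrDr -lee_fin fineK ?(total_variation_fin BVH).
move=> s t st; rewrite fE PE/=.
have /andP[s0 _] := clip_itv T0 s; have /andP[_ tT] := clip_itv T0 t.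
have cst := clip_le T0 st; have cl := clip_lipschitz T0 st.
rewrite (posvarB BVF)// (posvarB BVH)//.
set a := clip T s in s0 cst cl *; set b := clip T t in tT cst cl *.
have : fine (TV a b F) <= fine (TV a b H) + K * (b - a).
  pose k := fun t : R => K * t.
  have kTV : TV a b k = (K * (b - a))%:E.
    rewrite nondecreasing_total_variation// /k ?mulrBr//.
    by move=> u v _ _ uv; rewrite ler_wpM2l.
  rewrite -lee_fin EFinD !fineK ?(total_variation_fin _ s0 cst tT)// -kTV.
  have -> : F = H \+ k by apply/funext => u; rewrite /H/= subrK.
  exact: total_variation_le.
have : K * (b - a) <= K * (t - s) by rewrite ler_wpM2l.
rewrite /H; lra.
Qed.

(** [F] is the difference of its own [posvar] and that of [\- F], both functions having the same
    total variation. Lebesgue differentiation then identifies the density with [derive1 F]. *)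
Lemma abs_continuous_density (T : R) (F : R -> R) : 0 <= T -> continuous F ->
  abs_continuous 0 T F ->
  exists g : R -> R, [/\ mu.-integrable setT (EFin \o g),
    forall t, 0 <= t -> t <= T -> F t - F 0 = \int[mu]_(x in `]0, t]) g x &
    {ae mu, forall t, 0 < t < T -> derive1 F t = g t}].
Proof.
move=> T0 cF ACF; have BVF := abs_continuous_bounded_variation T0 ACF.
have [g1 [ig1 g1E]] := abs_continuous_posvar_density T0 cF ACF.
have [||g2 [ig2 g2E]] := @abs_continuous_posvar_density T (\- F) T0.
- by move=> t; apply: cvgN; exact: cF.
- exact: abs_continuousN.
have ig : mu.-integrable setT (EFin \o (fun t => g1 t - g2 t)).
  by rewrite (_ : _ \o _ = (EFin \o g1) \- (EFin \o g2))%E//; exact: integrableB.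
have FE t : 0 <= t -> t <= T -> F t - F 0 = \int[mu]_(x in `]0, t]) (g1 x - g2 x).
  move=> t0 tT; rewrite RintegralB//=; last 2 first.
  - exact: integrableS ig1.
  - exact: integrableS ig2.
  by rewrite -g1E// -g2E// /posvar !total_variationN /=; field.
exists (fun t => g1 t - g2 t); split=> //.
have := @FTC1 R (fun t => g1 t - g2 t) (BRight 0).
set G := (fun x => \int[mu]_(t in _) _)%R => /= H.
have {}H : {ae mu, forall x, (BRight 0 < BRight x)%O ->
    derivable G x 1 /\ derive1 G x = g1 x - g2 x}.
  apply: H.
  - by move=> y; exact: integrableS ig.
  - rewrite (_ : (fun t => _) = (fun t => g1 t - g2 t) \_ [set: R]); last first.
      by apply/funext => x; rewrite patchE in_setT.
    exact: integrable_locally.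
move: H; apply: filterS; first exact: (ae_filter_ringOfSetsType mu).
move=> t /= H /andP[t0 tT].
have [|dG <-] := H; first by rewrite bnd_simp.
have FG : {near t, F =1 (fun x => F 0 + G x)}.
  have : \forall x \near t, x \in `]0, T[ by apply: near_in_itvoo; rewrite in_itv/= t0.
  apply: filterS => x; rewrite in_itv/= => /andP[x0 xT].
  by rewrite /G -FE ?(ltW x0) ?(ltW xT)// addrC subrK.
rewrite !derive1E (near_eq_derive _ FG)// deriveD//; first by rewrite derive_cst add0r.
Qed.

End absolutely_continuous_density.

(* No measurability is needed: the integral of a nonnegative function is a supremum
   over the simple functions below it. *)
Lemma ge0_integral_subset_le d (U : measurableType d) (R : realType)
    (m : {measure set U -> \bar R}) (A B : set U) (f g : U -> \bar R) :
  (forall x, A x -> 0 <= f x)%E -> (forall x, B x -> 0 <= g x)%E ->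
  (forall x, A x -> B x /\ (f x <= g x)%E) ->
  (\int[m]_(x in A) f x <= \int[m]_(x in B) g x)%E.
Proof.
move=> f0 g0 fg; rewrite integral_mkcond [leRHS]integral_mkcond.
have fA x : (0 <= (f \_ A) x)%E by rewrite patchE; case: ifPn => // /set_mem/f0.
have gB x : (0 <= (g \_ B) x)%E by rewrite patchE; case: ifPn => // /set_mem/g0.
rewrite !ge0_integralTE//; apply: le_ereal_sup => _ [s sf <-]; exists s => // x.
apply: le_trans (sf x) _; rewrite !patchE; case: ifPn => [/set_mem/fg[Bx fgx]|_].
  by rewrite mem_set.
by case: ifPn => // /set_mem/g0.
Qed.

(** * Lower bounds for the energy *)

Section energy.
Context {R : realType}.
Variables (c1 c2 y : R).
Hypotheses (c1_gt0 : 0 < c1) (c2_gt0 : 0 < c2).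
Local Notation mu := (@lebesgue_measure R).
Implicit Types (psi : cpath R * cpath R).

Definition pushed psi t := y * t + psi.1 t - psi.2 t.

(* Convex conjugate of the least energy spent per unit time by a displacement of speed
   [u], namely [(c1^-1 + c2^-1)^-1 * (u - y) ^+ 2]. *)
Definition conjugate p := p * y + p ^+ 2 / 4 * (c1^-1 + c2^-1).

(** Young's inequality in each channel, with multipliers [p] and [- p]. *)
Lemma conjugate_le p a b :
  p * (y + a - b) - conjugate p <= c1 * a ^+ 2 + c2 * b ^+ 2.
Proof.
have sq (c v q : R) : 0 < c -> q * v <= c * v ^+ 2 + q ^+ 2 / 4 * c^-1.
  move=> c0; rewrite -subr_ge0.
  rewrite (_ : _ - _ = c * (v - q / 2 / c) ^+ 2); last by field; rewrite gt_eqF.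
  by rewrite mulr_ge0 ?sqr_ge0// ltW.
have := sq c1 a p c1_gt0; have := sq c2 b (- p) c2_gt0.
by rewrite /conjugate sqrrN; lra.
Qed.

(** The value [0] at time [0] fits the extension by [0], so continuity on [[0, +oo[] becomes
    continuity on the line. *)
Lemma cpathP (p : cpath R) : [/\ forall t, t < 0 -> p t = 0, continuous p & p 0 = 0].
Proof.
have [p_neg + p0] : @path_set R (cpath_fun p) by exact: set_mem (valP p).
move=> /continuous_within_itvcyP[p_pos p_0]; split => // t.
have [t0|t0|->] := ltgtP t 0.
- apply: (near_cst_continuous 0); near=> s; apply: p_neg.
  by near: s; exact: lt_nbhsl.
- by apply: p_pos; rewrite in_itv/= t0.
- apply/left_right_continuousP; split => //.
  rewrite p0; apply: cvg_near_cst; near=> s; apply: p_neg.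
  by near: s; exact: nbhs_left_lt.
Unshelve. all: by end_near. Qed.

Lemma cpath_continuous (p : cpath R) : continuous p.
Proof. by have [] := cpathP p. Qed.

Lemma pushed_continuous psi : continuous (pushed psi).
Proof.
move=> t; apply: cvgB; last exact: cpath_continuous.
by apply: cvgD; [apply: cvgMr; exact: cvg_id|exact: cpath_continuous].
Qed.

Lemma pushed0 psi : pushed psi 0 = 0.
Proof.
have [_ _ p10] := cpathP psi.1; have [_ _ p20] := cpathP psi.2.
by rewrite /pushed p10 p20 mulr0 addr0 subr0.
Qed.

(** [conjugate_le] is integrated over each step with its own multiplier [p k], the increments of
    [pushed] being integrals of densities. *)
Lemma energy_ge (T : R) psi (t : nat -> R) (p : nat -> R) (n : nat) :
  t 0%N = 0 -> t n = T -> (forall k, (k < n)%N -> t k <= t k.+1) ->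
  ((\sum_(0 <= k < n) (p k * (pushed psi (t k.+1) - pushed psi (t k))
      - conjugate (p k) * (t k.+1 - t k)))%:E <= energy c1 c2 T psi)%E.
Proof.
move=> t0 tT tle; rewrite /energy; case: asboolP => [[AC1 AC2]|_]; last by rewrite leey.
have t_ge0 k : (k <= n)%N -> 0 <= t k.
  elim: k => [|k ih] kn; first by rewrite t0.
  by apply: le_trans (tle k kn); exact: ih (ltnW kn).
have t_leT k : (k <= n)%N -> t k <= T.
  rewrite -tT; elim: n tle {t_ge0 tT} => [|m ih] tle; first by rewrite leqn0 => /eqP->.
  rewrite leq_eqVlt => /predU1P[->//|]; rewrite ltnS => km.
  by apply: le_trans (tle m _) => //; apply: ih => // j jm; apply: tle; rewrite ltnW.
have T0 : 0 <= T by rewrite -tT; exact: t_ge0.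
have [g1 [ig1 g1E dg1]] := abs_continuous_density T0 (@cpath_continuous psi.1) AC1.
have [g2 [ig2 g2E dg2]] := abs_continuous_density T0 (@cpath_continuous psi.2) AC2.
pose e s := (c1 * g1 s ^+ 2 + c2 * g2 s ^+ 2)%:E.
have e_ge0 s : (0 <= e s)%E.
  by rewrite lee_fin addr_ge0// mulr_ge0 ?sqr_ge0// ltW.
have mg1 : measurable_fun setT g1 by apply/measurable_EFinP; exact: measurable_int ig1.
have mg2 : measurable_fun setT g2 by apply/measurable_EFinP; exact: measurable_int ig2.
have me : measurable_fun setT e.
  apply/measurable_EFinP; apply: measurable_funD.
  - by apply: measurable_funM => //; exact: measurable_funX.
  - by apply: measurable_funM => //; exact: measurable_funX.
apply: (@le_trans _ _ (\int[mu]_(s in `]0%R, T[) e s)%E); last first.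
  (* Off a null set [derive1] equals the densities, which give a measurable integrand and hence an
     integral additive over the steps. *)
  have [N [mN N0 HN]] : mu.-negligible (~` [set s | 0 < s < T ->
      derive1 psi.1 s = g1 s /\ derive1 psi.2 s = g2 s]).
    apply: (negligibleS _ (negligibleU dg1 dg2)) => s /=.
    move=> /not_implyP[sT /not_andP[H|H]]; [left|right] => /= /(_ sT); exact: H.
  rewrite (@ge0_negligible_integral _ _ _ _ _ N)//; last first.
    exact: measurable_funS me.
  apply: ge0_integral_subset_le => //.
    by move=> s _; rewrite lee_fin addr_ge0// mulr_ge0 ?sqr_ge0// ltW.
  move=> s [/=]; rewrite in_itv/= => /andP[s0 sT] NNs.
  split; first by rewrite in_itv/= !ltW.
  have [-> ->] : derive1 psi.1 s = g1 s /\ derive1 psi.2 s = g2 s.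
    by apply: contrapT => H; apply/NNs/HN => /= K; apply/H/K; rewrite s0.
  by [].
rewrite integral_itv_bndo_bndc; last exact: measurable_funS me.
suff main m : (m <= n)%N ->
    ((\sum_(0 <= k < m) (p k * (pushed psi (t k.+1) - pushed psi (t k))
      - conjugate (p k) * (t k.+1 - t k)))%:E <= \int[mu]_(s in `]0%R, t m]) e s)%E.
  by rewrite -tT; exact: main.
elim: m => [|m ih] mn; first by rewrite big_nil integral_ge0.
rewrite big_nat_recr//= EFinD.
have tm := tle m mn; have tm0 := t_ge0 m (ltnW mn); have tmT := t_leT _ mn.
rewrite (@itv_bndbnd_setU _ _ _ (BRight (t m)))//.
rewrite ge0_integral_setU//=; last 2 first.
- exact: measurable_funS me.
- apply/disj_setPS => s [/=]; rewrite !in_itv/= => /andP[_ sm] /andP[+ _].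
  by rewrite ltNge sm.
apply: leeD; first exact: ih (ltnW mn).
set a := t m in tm tm0 *; set b := t m.+1 in tm tmT *.
pose l s := p m * (y + g1 s - g2 s) - conjugate (p m).
have inc (g : R -> R) (F : R -> R) : mu.-integrable setT (EFin \o g) ->
  (forall t, 0 <= t -> t <= T -> F t - F 0 = \int[mu]_(x in `]0, t]) g x) ->
  F b - F a = \int[mu]_(x in `]a, b]) g x.
  move=> ig gE; rewrite -(@Rintegral_itvB _ g (BRight 0) (BRight b))//.
    by rewrite -!gE ?(le_trans tm0)// ?(le_trans tm)//; ring.
  exact: integrableS ig.
have muab : mu (`]a, b]%classic : set R) = (b - a)%:E.
  have := tm; rewrite le_eqVlt => /predU1P[->|ab].
    by rewrite set_itvoc0 measure0 subrr.
  by rewrite lebesgue_measure_itv/= lte_fin ab.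
have muab_lt : (mu (`]a, b]%classic : set R) < +oo)%E by rewrite muab ltry.
have icst (k : R) : mu.-integrable `]a, b] (EFin \o cst k).
  apply: measurable_bounded_integrable => //.
  by exists `|k|; split=> [|M kM s _ /=]; [exact: num_real|exact: ltW].
have ig1' : mu.-integrable `]a, b] (EFin \o g1) by exact: integrableS ig1.
have ig2' : mu.-integrable `]a, b] (EFin \o g2) by exact: integrableS ig2.
have igZ (g : R -> R) : mu.-integrable `]a, b] (EFin \o g) ->
    mu.-integrable `]a, b] (EFin \o (fun s => p m * g s)).
  by move=> ig; exact: (integrableZl _ (p m) ig).
have il : mu.-integrable `]a, b] (EFin \o l).
  rewrite (_ : _ \o _ = (fun s => ((p m)%:E * (g1 s)%:E - (p m)%:E * (g2 s)%:E)
     + (p m * y - conjugate (p m))%:E)%E); last first.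
    by apply/funext => s; rewrite /= -!EFinM -EFinB -EFinD /l; congr (_%:E); ring.
  apply: integrableD => //; last exact: icst.
  by apply: integrableB => //; exact: integrableZl.
have -> : p m * (pushed psi b - pushed psi a) - conjugate (p m) * (b - a) =
    \int[mu]_(s in `]a, b]) l s.
  rewrite /l (_ : (fun s => _) = (fun s => (p m * g1 s - p m * g2 s)
     + (p m * y - conjugate (p m)))); last by apply/funext => s; ring.
  rewrite RintegralD//=; last 2 first.
  - rewrite (_ : _ \o _ = (fun s => (p m)%:E * (g1 s)%:E - (p m)%:E * (g2 s)%:E)%E)//.
    by apply: integrableB => //; exact: integrableZl.
  - exact: icst.
  rewrite RintegralB//=; [|exact: igZ|exact: igZ].
  rewrite !RintegralZl// Rintegral_cst// (_ : fine _ = b - a) ?[X in fine X]muab//.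
  by rewrite -(inc _ _ ig1 g1E) -(inc _ _ ig2 g2E) /pushed; ring.
(* [l] may be negative, but its positive part still lies below the nonnegative [e]. *)
apply: (@le_trans _ _ (\int[mu]_(s in `]a, b]) (EFin \o l)^\+ s)%E).
  rewrite /Rintegral fineK; last exact: integrable_fin_num.
  rewrite integralE leeBlDr ?leeDl ?integral_ge0//.
  by apply: integrable_fin_num => //; exact: integrable_funeneg.
apply: ge0_integral_subset_le => // s abs; split => //=.
by rewrite funeposE ge_max e_ge0 andbT lee_fin conjugate_le.
Qed.

End energy.

(** * Dropping the lower control *)

Section controls.
Context {R : realType}.
Implicit Types (f : R -> R) (rho : control R).

Lemma controlP rho : @control_set R (control_fun rho).
Proof. exact: set_mem (valP rho). Qed.

Lemma control_ge0 rho t : 0 <= rho t.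
Proof.
have [rneg rpos _ _ _] := controlP rho.
by have [/rneg ->//|/rpos] := ltP t 0.
Qed.

Lemma control_le rho s t : s <= t -> rho s <= rho t.
Proof.
have [rneg _ rle _ _] := controlP rho => st.
by have [/rneg ->|s0] := ltP s 0; [exact: control_ge0|exact: rle].
Qed.

Lemma control_right rho t : rho s @[s --> t^'+] --> rho t.
Proof.
have [rneg _ _ rc _] := controlP rho.
have [t0|/rc//] := ltP t 0; rewrite (rneg _ t0).
apply: cvg_near_cst; near=> s; apply: rneg.
by near: s; exact: nbhs_right_lt.
Unshelve. all: by end_near. Qed.

Lemma control_set_intro f : (forall t, t < 0 -> f t = 0) -> 0 <= f 0 ->
  (forall s t, 0 <= s -> s <= t -> f s <= f t) ->
  (forall t, 0 <= t -> f s @[s --> t^'+] --> f t) -> control_set f.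
Proof.
move=> fneg f0 fle frc; split => //.
  by move=> t t0; apply: le_trans f0 _; exact: fle.
move=> t t0; apply: nondecreasing_at_left_is_cvgr; near=> s.
  have s0 : 0 < s by near: s; exact: nbhs_left_gt.
  move=> u v; rewrite !in_itv/= => /andP[su _] _ uv; apply: fle => //.
  by rewrite ltW// (lt_trans s0).
have s0 : 0 < s by near: s; exact: nbhs_left_gt.
exists (f t) => _ [u /= + <-]; rewrite in_itv/= => /andP[su ut]; apply: fle; rewrite ltW//.
exact: lt_trans su.
Unshelve. all: by end_near. Qed.

Definition mk_control f (H : control_set f) : control R := exist _ f (mem_set H).

End controls.

Section first_crossing.
Context {R : realType}.
Variables (f : R -> R) (rho : control R).
Hypotheses (cf : continuous f) (f0_ge0 : 0 <= f 0).

(** A predicate rather than a number, since [rho] may never reach [f]. *)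
Definition first_crossing s :=
  [/\ 0 <= s, f s <= rho s & forall u, 0 <= u -> u < s -> rho u < f u].

Lemma first_crossing_uniq s s' : first_crossing s -> first_crossing s' -> s = s'.
Proof.
move=> [s0 sf sle] [s'0 s'f s'le]; apply/eqP; rewrite eq_le !leNgt.
apply/andP; split; apply/negP => H.
- by have := sle _ s'0 H; rewrite ltNge s'f.
- by have := s'le _ s0 H; rewrite ltNge sf.
Qed.

Lemma near_right_lt t : rho t < f t -> \forall s \near t^'+, rho s < f s.
Proof.
move=> H; have C : f s - rho s @[s --> t^'+] --> f t - rho t.
  apply: cvgB; last exact: control_right.
  by apply: cvg_at_right_filter; exact: cf.
have P : 0 < f t - rho t by rewrite subr_gt0.
near=> s; rewrite -subr_gt0; near: s; exact: cvgr_gt C _ P.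
Unshelve. all: by end_near. Qed.

(** The infimum of the crossing times is attained: [f] is continuous and [rho] right-continuous, so
    [rho < f] at the infimum would persist just after it. *)
Lemma first_crossing_ex t : 0 <= t -> f t <= rho t -> exists2 s, first_crossing s & s <= t.
Proof.
move=> t0 tf; pose S := [set s | 0 <= s /\ f s <= rho s].
have Slb : has_lbound S by exists 0 => s [].
have S0 : has_inf S by split => //; exists t.
have inf0 : 0 <= inf S by apply: lb_le_inf => [|s []//]; exists t.
have before u : 0 <= u -> u < inf S -> rho u < f u.
  move=> u0; apply: contraTlt => uf; rewrite -leNgt; exact: ge_inf.
exists (inf S); last exact: ge_inf.
split => //; rewrite leNgt; apply/negP => /[dup] Hinf /near_right_lt[e /= e0 He].
suff : inf S + e <= inf S by rewrite gerDl leNgt e0.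
apply: lb_le_inf; first by exists t.
move=> s [s0 sf]; rewrite leNgt; apply/negP => se.
have [sinf|sinf] := ltP (inf S) s.
  have := He s; rewrite /ball/= ltr0_norm ?subr_lt0// opprB ltrBlDl => /(_ se sinf).
  by rewrite ltNge sf.
have : rho s < f s.
  move: sinf; rewrite le_eqVlt => /predU1P[->//|]; exact: before.
by rewrite ltNge sf.
Qed.

(** [rho] may jump over [f] at [s], but it stays below [f] before [s], and [f] has no jump. So a
    control that follows [rho] and equals [f s] from [s] on is still nondecreasing. *)
Lemma first_crossing_le s u : first_crossing s -> 0 <= u -> u < s -> rho u <= f s.
Proof.
move=> [s0 sf sle] u0 us.
have C : f v @[v --> s^'-] --> f s by apply: cvg_at_left_filter; exact: cf.
apply: (cvgr_to_ge C); near=> v.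
have uv : u < v by near: v; exact: nbhs_left_gt.
apply: le_trans (control_le rho (ltW uv)) _; apply/ltW/sle.
- exact: ltW (le_lt_trans u0 uv).
- by near: v; exact: nbhs_left_lt.
Unshelve. all: by end_near. Qed.

Lemma first_crossing_ge0 s : first_crossing s -> 0 <= f s.
Proof.
move=> H; have [s0 _ _] := H; move: s0; rewrite le_eqVlt => /predU1P[<-//|s0].
exact: le_trans (control_ge0 rho 0) (first_crossing_le H (lexx 0) s0).
Qed.

(** The jump of [rho] at the crossing is truncated, so that the state lands exactly on [0]. *)
Definition stopped t :=
  if `[< exists2 s, first_crossing s & s <= t >] then f (xget 0 first_crossing)
  else rho t.

Lemma stopped_after s t : first_crossing s -> s <= t -> stopped t = f s.
Proof.
move=> H st; rewrite /stopped asboolT; last by exists s.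
by congr f; apply: (first_crossing_uniq _ H); exact: (xgetPex 0 (ex_intro _ s H)).
Qed.

Lemma stopped_before t : (forall s, first_crossing s -> t < s) -> stopped t = rho t.
Proof. by move=> H; rewrite /stopped asboolF// => -[s /H]; rewrite ltNge => /negbTE ->. Qed.

Lemma stopped_control : control_set stopped.
Proof.
apply: control_set_intro.
- move=> t t0; rewrite stopped_before => [|s [s0 _ _]]; last exact: lt_le_trans s0.
  by have [rneg _ _ _ _] := controlP rho; exact: rneg.
- have [[s Hs s0]|H] := pselect (exists2 s, first_crossing s & s <= 0).
    by rewrite (stopped_after Hs s0); exact: first_crossing_ge0 Hs.
  rewrite stopped_before ?control_ge0// => s Hs; rewrite ltNge; apply/negP => s0.
  by apply: H; exists s.
- move=> s t s0 st.
  have [[u Hu us]|H] := pselect (exists2 u, first_crossing u & u <= s).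
    by rewrite !(stopped_after Hu)// (le_trans us).
  have {}H u : first_crossing u -> s < u.
    by move=> Hu; rewrite ltNge; apply/negP => us; apply: H; exists u.
  rewrite (stopped_before H).
  have [[u Hu ut]|H'] := pselect (exists2 u, first_crossing u & u <= t).
    by rewrite (stopped_after Hu ut); apply: first_crossing_le => //; exact: H.
  rewrite stopped_before; first exact: control_le.
  by move=> u Hu; rewrite ltNge; apply/negP => us; apply: H'; exists u.
- move=> t t0.
  have [[u Hu ut]|H] := pselect (exists2 u, first_crossing u & u <= t).
    rewrite (stopped_after Hu ut); apply: cvg_near_cst; near=> s.
    by apply: stopped_after => //; apply: le_trans ut _; near: s; exact: nbhs_right_ge.
  have {}H u : first_crossing u -> t < u.
    by move=> Hu; rewrite ltNge; apply/negP => us; apply: H; exists u.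
  rewrite (stopped_before H).
  have [v tv Hv] : exists2 v, t < v & forall u, first_crossing u -> v <= u.
    have [[u Hu]|NH] := pselect (exists u, first_crossing u).
      by exists u => [|u' Hu']; [exact: H|rewrite (first_crossing_uniq Hu Hu')].
    exists (t + 1); first by rewrite ltrDl.
    by move=> u Hu; exfalso; apply: NH; exists u.
  apply: cvg_trans (@control_right _ rho t); apply: near_eq_cvg; near=> s.
  rewrite stopped_before// => u /Hv; apply: lt_le_trans.
  by near: s; exact: nbhs_right_lt.
Unshelve. all: by end_near. Qed.

End first_crossing.

Lemma first_crossing_upto {R : realType} (f f' : R -> R) (rho rho' : control R) t s :
  eq_upto t f f' -> eq_upto t rho rho' -> s <= t ->
  first_crossing f rho s -> first_crossing f' rho' s.
Proof.
move=> ff rr st [s0 sf sle]; split => //.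
- by rewrite -ff ?s0// -rr ?s0.
- move=> u u0 us; have ut : 0 <= u <= t by rewrite u0 (le_trans (ltW us)).
  by rewrite -ff// -rr//; exact: sle.
Qed.

(** * Comparison of the two games *)

Section hit_le_game.
Context {R : realType}.
Variables (D r c1 c2 y : R) (h : R -> R).
Hypotheses (D_gt0 : 0 < D) (r_gt0 : 0 < r).
Hypotheses (h_incr : {in `[0, D] &, {homo h : u v / u < v}}) (h_0 : h 0 = 0).

Lemma h_le u v : 0 <= u -> u <= v -> v <= D -> h u <= h v.
Proof.
move=> u0; rewrite le_eqVlt => /predU1P[->//|uv] vD; apply/ltW/h_incr => //.
- by rewrite in_itv/= u0 (le_trans (ltW uv)).
- by rewrite in_itv/= vD (le_trans u0 (ltW uv)).
Qed.

Lemma h_ge0 u : 0 <= u -> u <= D -> 0 <= h u.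
Proof. by move=> u0 uD; rewrite -h_0; exact: h_le. Qed.

Lemma hit_dynamicsE x psi rho t :
  hit_dynamics y x psi rho t = x + pushed y psi t - rho t.
Proof. by rewrite /hit_dynamics /pushed; ring. Qed.

Lemma dynamicsE x psi zeta rho t :
  dynamics y x psi zeta rho t = x + pushed y psi t + zeta t - rho t.
Proof. by rewrite /dynamics /pushed; ring. Qed.

Lemma uncontrolled_continuous x psi : continuous (fun t => x + pushed y psi t).
Proof. by move=> t; apply: cvgD; [exact: cvg_cst|exact: pushed_continuous]. Qed.

Lemma pushed_upto t (psi psi' : cpath R * cpath R) :
  eq_upto2 t psi psi' -> eq_upto t (pushed y psi) (pushed y psi').
Proof. by move=> [e1 e2] s st; rewrite /pushed e1// e2. Qed.

Lemma hit_value_le_game_value x : 0 <= x <= D ->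
  (hit_value D r c1 c2 y h x <= game_value D r c1 c2 y h x)%E.
Proof.
move=> /andP[x0 xD]; apply: le_ereal_inf_tmp => _ [alpha [[_ alpha_causal] alpha_adm] <-].
pose f psi t := x + pushed y psi t.
have f0 psi : 0 <= f psi 0 by rewrite /f pushed0 addr0.
pose rho psi := (alpha psi).2.
have Sc psi : control_set (stopped (f psi) (rho psi)).
  exact: stopped_control (@uncontrolled_continuous x psi) (f0 psi).
pose beta psi := mk_control (Sc psi).
have betaE psi t : beta psi t = stopped (f psi) (rho psi) t by [].
have f_dyn psi t : dynamics y x psi (alpha psi).1 (alpha psi).2 t =
    f psi t + (alpha psi).1 t - rho psi t by rewrite dynamicsE.
have b_dyn psi t : hit_dynamics y x psi (beta psi) t =
    f psi t - stopped (f psi) (rho psi) t by rewrite hit_dynamicsE.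
have before psi s t : first_crossing (f psi) (rho psi) s -> t < s ->
    beta psi t = rho psi t.
  by move=> Hs ts; rewrite betaE stopped_before// => u /(first_crossing_uniq Hs) <-.
have hit psi s : first_crossing (f psi) (rho psi) s -> hit_time y x psi (beta psi) = s%:E.
  move=> Hs; have [s0 _ sle] := Hs; apply/eqP; rewrite eq_le; apply/andP; split.
    apply: ereal_inf_lbound; exists s => //; split => //.
    by rewrite b_dyn (stopped_after Hs)// subrr.
  apply: le_ereal_inf_tmp => _ [t [t0 +] <-]; rewrite lee_fin leNgt => Ht.
  apply/negP => ts; move: Ht; rewrite hit_dynamicsE (before _ _ _ Hs ts) => /eqP.
  by rewrite gt_eqF// subr_gt0; exact: sle.
have nohit psi : ~ (exists s, first_crossing (f psi) (rho psi) s) ->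
    forall t, 0 <= t -> beta psi t = rho psi t /\ rho psi t < f psi t.
  move=> H t t0; rewrite betaE stopped_before; last first.
    by move=> s Hs; exfalso; apply: H; exists s.
  split => //; rewrite ltNge; apply/negP => /first_crossing_ex.
  by move=> /(_ (@uncontrolled_continuous x psi) t0)[s Hs _]; apply: H; exists s.
have run psi t : 0 <= t -> beta psi t = rho psi t -> rho psi t < f psi t ->
    0 <= hit_dynamics y x psi (beta psi) t /\
    hit_dynamics y x psi (beta psi) t <= dynamics y x psi (alpha psi).1 (alpha psi).2 t.
  move=> t0 bt rf; rewrite hit_dynamicsE bt f_dyn; split.
    by rewrite subr_ge0 ltW.
  by rewrite lerD2r lerDl control_ge0.
have beta_adm : hit_admissible D y x beta.
  split.
    move=> t psi psi' t0 e u /andP[u0 ut].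
    have ef : eq_upto u (f psi) (f psi').
      move=> v /andP[v0 vu]; rewrite /f (pushed_upto e)// v0; exact: le_trans ut.
    have er : eq_upto u (rho psi) (rho psi').
      have [_ er] := alpha_causal _ _ _ t0 e.
      by move=> v /andP[v0 vu]; apply: er; rewrite v0 (le_trans vu).
    rewrite !betaE.
    (* Whether a crossing has occurred by time [u] depends only on data up to [u]; this makes [beta]
       causal. *)
    have [[s Hs su]|H] := pselect (exists2 s, first_crossing (f psi) (rho psi) s & s <= u).
      have Hs' := first_crossing_upto ef er su Hs.
      rewrite (stopped_after Hs su) (stopped_after Hs' su) ef// su andbT.
      by case: Hs.
    rewrite !stopped_before ?er ?u0 ?lexx//.
    - move=> s Hs; rewrite ltNge; apply/negP => su; apply: H; exists s => //.
      by apply: first_crossing_upto su Hs => v /[dup] vt; [move/ef ->|move/er ->].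
    - by move=> s Hs; rewrite ltNge; apply/negP => su; apply: H; exists s.
  move=> psi t t0 tH.
  have [[s Hs]|H] := pselect (exists s, first_crossing (f psi) (rho psi) s).
    move: tH; rewrite (hit _ _ Hs) lee_fin le_eqVlt => /predU1P[->|ts].
      by rewrite b_dyn (stopped_after Hs)// subrr lexx ltW.
    have [_ _ sle] := Hs.
    have [-> le] := run psi t t0 (before _ _ _ Hs ts) (sle _ t0 ts).
    by rewrite (le_trans le)//; have /andP[] := alpha_adm psi t t0.
  have [bt rt] := nohit _ H t t0; have [-> le] := run psi t t0 bt rt.
  by rewrite (le_trans le)//; have /andP[] := alpha_adm psi t t0.
apply: (@le_trans _ _ (ereal_sup
    [set hit_cost r c1 c2 y h x psi (beta psi) | psi in hit_paths y x beta])).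
  by apply: ereal_inf_lbound; exists beta.
apply: ub_ereal_sup => _ [psi Hpsi <-].
have [[s Hs]|H] := pselect (exists s, first_crossing (f psi) (rho psi) s); last first.
  exfalso; move: Hpsi; rewrite /hit_paths/= ltNge => /negP; apply.
  apply: le_ereal_inf_tmp => _ [t [t0 +] <-]; have [bt rt] := nohit _ H t t0.
  by rewrite hit_dynamicsE bt => /eqP; rewrite gt_eqF// subr_gt0.
have [s0 sf sle] := Hs.
(* In the original game the maximizer may choose the hitting time [s] as horizon. *)
apply: (@le_trans _ _ (cost r c1 c2 y h x s psi (alpha psi).1 (alpha psi).2)); last first.
  by apply: ereal_sup_ubound; exists (psi, s).
rewrite /hit_cost (hit _ _ Hs)/= /cost; apply: leeB => //; apply: leeD; last first.
  by rewrite lee_fin betaE (stopped_after Hs)// ler_pM2l.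
have ok t : 0 <= t -> t <= s -> 0 <= hit_dynamics y x psi (beta psi) t /\
    hit_dynamics y x psi (beta psi) t <= dynamics y x psi (alpha psi).1 (alpha psi).2 t.
  move=> t0; rewrite le_eqVlt => /predU1P[->|ts].
    rewrite b_dyn (stopped_after Hs)// subrr; split => //.
    by have /andP[] := alpha_adm psi s s0.
  exact: run psi t t0 (before _ _ _ Hs ts) (sle _ t0 ts).
have dD t : 0 <= t -> dynamics y x psi (alpha psi).1 (alpha psi).2 t <= D.
  by move=> t0; have /andP[] := alpha_adm psi t t0.
apply: ge0_integral_subset_le => t /=; rewrite in_itv/= => /andP[t0 ts].
- have [a b] := ok t t0 ts; rewrite lee_fin h_ge0//; exact: le_trans (dD t t0).
- by have /andP[a b] := alpha_adm psi t t0; rewrite lee_fin h_ge0.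
- have [a b] := ok t t0 ts; split; first by rewrite t0.
  by rewrite lee_fin h_le// dD.
Qed.

End hit_le_game.

(** * The value function *)

Section value_function.
Context {R : realType}.
Variables (D r c1 c2 y : R) (h : R -> R).
Hypotheses (D_gt0 : 0 < D) (r_gt0 : 0 < r) (c1_gt0 : 0 < c1) (c2_gt0 : 0 < c2).
Hypotheses (h_cont : {within `[0, D], continuous h}).
Hypotheses (h_incr : {in `[0, D] &, {homo h : u v / u < v}}) (h_0 : h 0 = 0).
Hypothesis y_large : r / (4 * (c1^-1 + c2^-1)^-1) <= - y.
Local Notation mu := (@lebesgue_measure R).
Local Notation G := (conjugate c1 c2 y).
Local Notation K := (c1^-1 + c2^-1).

Lemma K_gt0 : 0 < K.
Proof. by rewrite addr_gt0// invr_gt0. Qed.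

Lemma drift_le : r * K / 4 <= - y.
Proof. by move: y_large; rewrite invfM invrK mulrA mulrAC. Qed.

Lemma y_lt0 : y < 0.
Proof.
rewrite -oppr_gt0; apply: lt_le_trans drift_le.
by rewrite divr_gt0// mulr_gt0// K_gt0.
Qed.

(* Reflecting at a level [z] is safe exactly when [h z] is at most this threshold. *)
Definition reflection_threshold := - G r.

Lemma reflection_threshold_ge0 : 0 <= reflection_threshold.
Proof.
rewrite /reflection_threshold /conjugate (_ : - _ = r * (- y - r * K / 4)); last by ring.
by rewrite mulr_ge0 ?subr_ge0 ?drift_le// ltW.
Qed.

(* The smaller lower_root of [G p = - m]. *)
Definition lower_root m := 2 / K * (- y - Num.sqrt (y ^+ 2 - m * K)).

(** An equality at [m = reflection_threshold], where [r] is a root of [G p = - m]. *)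
Lemma discriminant m : m <= reflection_threshold -> (y + r * K / 2) ^+ 2 <= y ^+ 2 - m * K.
Proof.
move=> mh; have : m * K <= reflection_threshold * K by rewrite ler_pM2r// K_gt0.
rewrite /reflection_threshold /conjugate => H; rewrite -subr_ge0.
rewrite (_ : _ - _ = - (r * y + r ^+ 2 / 4 * K) * K - m * K) ?subr_ge0//.
by set k := K; field.
Qed.

Lemma discriminant_ge0 m : m <= reflection_threshold -> 0 <= y ^+ 2 - m * K.
Proof. by move=> /discriminant; apply: le_trans; exact: sqr_ge0. Qed.

Lemma conjugate_lower_root m : m <= reflection_threshold -> G (lower_root m) = - m.
Proof.
move=> /discriminant_ge0 /sqr_sqrtr; rewrite /lower_root /conjugate; have := K_gt0.
set k := K => k0; set s := Num.sqrt _ => sE.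
rewrite (_ : _ + _ = (s ^+ 2 - y ^+ 2) / k); last by field; rewrite gt_eqF.
by rewrite sE addrAC subrr add0r mulNr mulfK// gt_eqF.
Qed.

Lemma lower_root_le_r m : m <= reflection_threshold -> lower_root m <= r.
Proof.
move=> mh; have K0 := K_gt0.
have : `|y + r * K / 2| <= Num.sqrt (y ^+ 2 - m * K).
  by rewrite -sqrtr_sqr ler_wsqrtr// discriminant.
rewrite ler_norml => /andP[+ _]; rewrite /lower_root => H.
by rewrite mulrAC ler_pdivrMr//; lra.
Qed.

(** Equivalently [y + p * K / 2 <= 0] for the root [p]: the velocity it prescribes never points
    up. *)
Lemma lower_root_le_y m : lower_root m <= - y * (2 / K).
Proof.
rewrite /lower_root mulrC ler_pM2r ?divr_gt0 ?K_gt0//.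
by rewrite gerBl sqrtr_ge0.
Qed.

Lemma lower_root_le m m' : m <= m' -> lower_root m <= lower_root m'.
Proof.
move=> mm; rewrite /lower_root ler_pM2l ?divr_gt0 ?K_gt0// lerD2l lerN2 ler_wsqrtr//.
by rewrite lerD2l lerN2 ler_pM2r ?K_gt0.
Qed.

Lemma lower_root0 : lower_root 0 = 0.
Proof. by rewrite /lower_root mul0r subr0 sqrtr_sqr ltr0_norm ?y_lt0// subrr mulr0. Qed.

(** [h] is arbitrary outside [[0, D]]; this version is continuous and nondecreasing on the line. *)
Definition hc z := h (clip D z).

Lemma hc_continuous : continuous hc.
Proof.
move/subspace_continuousP : h_cont => H t.
apply: (@cvg_comp _ _ _ (clip D) h _ (within `[0, D] (nbhs (clip D t)))); last first.
  by apply: H => /=; rewrite in_itv/= clip_itv// ltW.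
move=> P; rewrite /within/= => HP.
have near_t : \forall s \near t, `[0, D]%classic (clip D s) -> P (clip D s).
  exact: (@continuous_clip _ D t _ HP).
change (\forall s \near t, P (clip D s)); near=> s.
have : `[0, D]%classic (clip D s) -> P (clip D s) by near: s.
by apply; rewrite /= in_itv/= clip_itv// ltW.
Unshelve. all: by end_near. Qed.

Lemma hc_id z : 0 <= z -> z <= D -> hc z = h z.
Proof. by move=> z0 zD; rewrite /hc clip_id. Qed.

Lemma hc_le u v : u <= v -> hc u <= hc v.
Proof.
move=> uv; have D0 := ltW D_gt0.
have /andP[u0 _] := clip_itv D0 u; have /andP[_ vD] := clip_itv D0 v.
by apply: (h_le h_incr) => //; exact: clip_le.
Qed.

Lemma hc_ge0 z : 0 <= hc z.
Proof.
have D0 := ltW D_gt0; have /andP[u0 uD] := clip_itv D0 z.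
exact: (h_ge0 h_incr).
Qed.

Lemma hc0 : hc 0 = 0.
Proof. by rewrite hc_id// ltW. Qed.

(** The cap keeps the discriminant of [lower_root] nonnegative and the root at most [r]. *)
Definition capped z := Num.min (hc z) reflection_threshold.

Lemma capped_ge0 z : 0 <= capped z.
Proof. by rewrite le_min hc_ge0 reflection_threshold_ge0. Qed.

Lemma capped_le z : capped z <= reflection_threshold.
Proof. by rewrite ge_min lexx orbT. Qed.

Definition slope z := lower_root (capped z).

Lemma slope_le u v : u <= v -> slope u <= slope v.
Proof. by move=> uv; apply: lower_root_le; rewrite le_min !ge_min hc_le//= lexx orbT. Qed.

Lemma slope_ge0 z : 0 <= slope z.
Proof. by rewrite -lower_root0; apply: lower_root_le; exact: capped_ge0. Qed.

Lemma slope_le_r z : slope z <= r.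
Proof. exact/lower_root_le_r/capped_le. Qed.

Lemma conjugate_slope z : G (slope z) = - capped z.
Proof. exact/conjugate_lower_root/capped_le. Qed.

Lemma slope0 : slope 0 = 0.
Proof. by rewrite /slope /capped hc0 (min_idPl reflection_threshold_ge0) lower_root0. Qed.

Lemma slope_continuous : continuous slope.
Proof.
move=> z; rewrite /slope /lower_root; apply: cvgMr; apply: cvgB; first exact: cvg_cst.
apply: (@continuous_comp _ _ _ (fun z => y ^+ 2 - capped z * K) Num.sqrt); last first.
  exact: sqrt_continuous.
apply: cvgB; first exact: cvg_cst.
apply: cvgMl; move: z; apply: min_fun_continuous; first exact: hc_continuous.
exact: cst_continuous.
Qed.

Definition W z := \int[mu]_(s in `]0, z]) slope s.

Lemma W0 : W 0 = 0.
Proof. by rewrite /W set_itvoc0 Rintegral_set0. Qed.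

Lemma itvoc_lty a b : (mu (`]a, b]%classic : set R) < +oo)%E.
Proof. by rewrite lebesgue_measure_itv/=; case: ifP => _; rewrite -?EFinB ltry. Qed.

Lemma slope_integrable a b : mu.-integrable `]a, b] (EFin \o slope).
Proof.
apply: measurable_bounded_integrable => //.
- exact: itvoc_lty.
- by apply: measurable_funTS; apply: continuous_measurable_fun; exact: slope_continuous.
- exists r; split=> [|M rM s _ /=]; first exact: num_real.
  by rewrite ger0_norm ?slope_ge0// (le_trans (slope_le_r s))// ltW.
Qed.

Lemma W_increment a b : 0 <= a -> a <= b ->
  slope a * (b - a) <= W b - W a /\ W b - W a <= slope b * (b - a).
Proof.
move=> a0 ab; rewrite /W (@Rintegral_itvB _ slope (BRight 0) (BRight b))//; last first.
  exact: slope_integrable.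
have muab : fine (mu `]a, b]) = b - a.
  have := ab; rewrite le_eqVlt => /predU1P[->|ab'].
    by rewrite set_itvoc0 measure0 subrr.
  by rewrite lebesgue_measure_itv/= lte_fin ab'.
have icst (k : R) : mu.-integrable `]a, b] (EFin \o cst k).
  apply: measurable_bounded_integrable => //.
    exact: itvoc_lty.
  by exists `|k|; split=> [|M kM s _ /=]; [exact: num_real|exact: ltW].
have cst_int k : \int[mu]_(s in `]a, b]) k = k * (b - a).
  by rewrite Rintegral_cst// -muab.
rewrite -!cst_int; split; apply: le_Rintegral => //.
- exact: icst.
- exact: slope_integrable.
- by move=> s; rewrite /= in_itv/= => /andP[/ltW /slope_le].
- exact: slope_integrable.
- exact: icst.
- by move=> s; rewrite /= in_itv/= => /andP[_ /slope_le].
Qed.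

Lemma W_le a b : 0 <= a -> a <= b -> W a <= W b.
Proof.
move=> a0 ab; have [+ _] := W_increment a0 ab; rewrite -subr_ge0; apply: le_trans.
by rewrite mulr_ge0 ?slope_ge0 ?subr_ge0.
Qed.

Lemma W_ge0 z : 0 <= z -> 0 <= W z.
Proof. by move=> z0; rewrite -W0 W_le. Qed.

Lemma W_increment_le a b : 0 <= a -> a <= b -> W b - W a <= r * (b - a).
Proof.
move=> a0 ab; have [_] := W_increment a0 ab; move/le_trans; apply.
by rewrite ler_wpM2r ?subr_ge0// slope_le_r.
Qed.

(* [W] is convex with subgradient [slope]. *)
Lemma W_convex u v : 0 <= u -> 0 <= v -> W v - W u <= slope v * (v - u).
Proof.
move=> u0 v0; have [uv|vu] := leP u v; first by have [] := W_increment u0 uv.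
by have [+ _] := W_increment v0 (ltW vu); lra.
Qed.

(** If [h] stays below the threshold, the minimum puts the barrier at [D]. *)
Lemma barrier_ex : exists2 b, 0 <= b <= D & h b = Num.min reflection_threshold (h D).
Proof.
have D0 := ltW D_gt0.
have hD : 0 <= h D by rewrite (h_ge0 h_incr).
have [|b + hb] := @IVT R h 0 D (Num.min reflection_threshold (h D)) D0 h_cont.
  rewrite h_0 (min_idPl hD) (max_idPr hD) ge_min lexx orbT andbT.
  by rewrite le_min reflection_threshold_ge0.
by rewrite in_itv/= => bD; exists b.
Qed.

Definition barrier := sval (cid2 barrier_ex).

Lemma barrier_itv : 0 <= barrier <= D.
Proof. by rewrite /barrier; case: cid2. Qed.

Lemma h_barrier : h barrier = Num.min reflection_threshold (h D).
Proof. by rewrite /barrier; case: cid2. Qed.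

Lemma barrier_lt b : barrier < b -> b <= D -> reflection_threshold < h b.
Proof.
move=> Bb bD; have /andP[B0 BD] := barrier_itv.
have hbD : h b <= h D by apply: (h_le h_incr) => //; exact: ltW (le_lt_trans B0 Bb).
have : h barrier < h b.
  apply: h_incr => //; rewrite in_itv/=; first by rewrite B0.
  by rewrite bD (le_trans B0 (ltW Bb)).
rewrite h_barrier /Num.min; case: ifP => // _ /lt_le_trans/(_ hbD).
by rewrite ltxx.
Qed.

(* Below the barrier [W' = slope] balances the running cost against the energy; above it
   pushing down at unit price [r] is cheaper. *)
Definition Wf x := W (Num.min x barrier) + r * Num.max (x - barrier) 0.

End value_function.

(** Raising [g] to [+oo] on the null set [N] leaves its integral unchanged and makes the inequality
    hold everywhere on [A], so that the pointwise comparison covers an arbitrary nonnegative [f]. *)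
Lemma ge0_integral_ae_le d (U : measurableType d) (R : realType)
    (m : {measure set U -> \bar R}) (A N : set U) (f g : U -> \bar R) :
  measurable A -> measurable N -> m N = 0%E -> measurable_fun A g ->
  (forall x, A x -> 0 <= f x)%E -> (forall x, A x -> 0 <= g x)%E ->
  (forall x, A x -> ~ N x -> (f x <= g x)%E) ->
  (\int[m]_(x in A) f x <= \int[m]_(x in A) g x)%E.
Proof.
move=> mA mN N0 mg f0 g0 fg.
pose g' x := (g x + (+oo)%E * (\1_N x)%:E)%E.
have g'E x : ~ N x -> g' x = g x.
  by move=> Nx; rewrite /g' indicE memNset// mule0 adde0.
have mg' : measurable_fun A g'.
  apply: emeasurable_funD => //; apply: measurable_funeM.
  by apply/measurable_EFinP; exact: measurable_indic.
apply: (@le_trans _ _ (\int[m]_(x in A) g' x)%E); last first.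
  rewrite (ae_eq_integral g)//; exists N; split => // x /= H.
  by apply: contrapT => Nx; apply: H => Ax; exact: g'E.
apply: ge0_integral_subset_le => // x Ax.
  by rewrite adde_ge0 ?g0// mule_ge0// lee_fin.
split => //; have [Nx|Nx] := pselect (N x); last by rewrite g'E// fg.
by rewrite /g' indicE mem_set// mule1 addey ?leey// gt_eqF// (lt_le_trans _ (g0 x Ax))// ltNy0.
Qed.

(** * Piecewise constant velocities *)

Section grid.
Context {R : realType}.
Variables (d : R) (N : nat).
Hypothesis d_gt0 : 0 < d.
Local Notation mu := (@lebesgue_measure R).
Implicit Types (v a : nat -> R) (t s : R) (k : nat).

(** [clip d] shifted by [k * d] is the primitive of the indicator of the [k]-th step, so this path
    has velocity [v k] there and rests after [N * d]. *)
Definition plin v t := \sum_(0 <= k < N) v k * clip d (t - k%:R * d).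

Definition step a t : R := \sum_(0 <= k < N) a k * \1_(`]k%:R * d, k.+1%:R * d]) t.

Lemma clip_le0 t : t <= 0 -> clip d t = 0.
Proof.
by move=> t0; rewrite /clip (min_idPl (le_trans t0 (ltW d_gt0))) (max_idPl t0).
Qed.

Lemma clip_ge t : d <= t -> clip d t = d.
Proof. by move=> dt; rewrite /clip (min_idPr dt) (max_idPr (ltW d_gt0)). Qed.

Lemma grid_le j k : (j <= k)%N -> j%:R * d <= k%:R * d.
Proof. by move=> jk; rewrite ler_pM2r// ler_nat. Qed.

Lemma grid_find t : 0 < t -> t <= N%:R * d ->
  exists2 k, (k < N)%N & k%:R * d < t <= k.+1%:R * d.
Proof.
move=> t0; elim: N => [|n ih]; first by rewrite mul0r leNgt t0.
move=> tn; have [tn'|tn'] := leP t (n%:R * d); last by exists n => //; rewrite tn'.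
by have [k kn H] := ih tn'; exists k => //; rewrite ltnW.
Qed.

Lemma plin_in v k t : (k < N)%N -> k%:R * d <= t <= k.+1%:R * d ->
  plin v t = plin v (k%:R * d) + v k * (t - k%:R * d).
Proof.
move=> kN /andP[kt tk]; apply/eqP; rewrite addrC -subr_eq; apply/eqP.
rewrite /plin -sumrB (bigD1_seq k) ?iota_uniq ?mem_index_iota//= big1 ?addr0.
  rewrite subrr (clip_le0 (lexx 0)) mulr0 subr0 clip_id ?subr_ge0//.
  by move: tk; rewrite mulrSr mulrDl mul1r lerBlDl.
move=> j; rewrite neq_ltn => /orP[jk|kj].
  by have := grid_le jk; rewrite mulrSr mulrDl mul1r => ?; rewrite !clip_ge ?subrr//; lra.
have := grid_le (ltnW kj); have := grid_le kj => ? ?.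
by rewrite !clip_le0 ?subrr//; lra.
Qed.

Lemma plin0 v t : t <= 0 -> plin v t = 0.
Proof.
move=> t0; rewrite /plin big1// => k _; rewrite clip_le0 ?mulr0// subr_le0.
by rewrite (le_trans t0)// mulr_ge0// ltW.
Qed.

Lemma plin_cst c t : 0 <= t -> t <= N%:R * d -> plin (fun=> c) t = c * t.
Proof.
have main k : (k <= N)%N -> plin (fun=> c) (k%:R * d) = c * (k%:R * d).
  elim: k => [|k ih] kN; first by rewrite mul0r plin0// mulr0.
  rewrite (plin_in _ kN); last by rewrite lexx andbT grid_le.
  by rewrite ih ?(ltnW kN)//; ring.
rewrite le_eqVlt => /predU1P[<-|t0] tN; first by rewrite plin0// mulr0.
have [k kN /andP[kt tk]] := grid_find t0 tN.
rewrite (plin_in _ kN) ?(ltW kt)// main ?(ltnW kN)//; ring.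
Qed.

Lemma eq_plin v v' k t : (forall j, (j < k)%N -> v j = v' j) -> t <= k%:R * d ->
  plin v t = plin v' t.
Proof.
move=> vv tk; apply: eq_bigr => j _; have [jk|kj] := ltnP j k; first by rewrite vv.
by rewrite clip_le0 ?mulr0// subr_le0 (le_trans tk)// grid_le.
Qed.

Lemma plin_continuous v : continuous (plin v).
Proof.
move=> t; rewrite /plin; apply: cvg_big => [|k _]; first exact: add_continuous.
apply: cvgMr; apply: (@continuous_comp _ _ _ (fun t => t - k%:R * d) (clip d)).
  by apply: cvgB; [exact: cvg_id|exact: cvg_cst].
exact: continuous_clip.
Qed.

Lemma plin_path v : path_set (plin v).
Proof.
split; [by move=> t /ltW; exact: plin0| |exact: plin0].
by apply: continuous_subspaceT; exact: plin_continuous.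
Qed.

Definition plin_cpath v : cpath R := exist _ (plin v) (mem_set (plin_path v)).

Lemma plin_abs_continuous v T : abs_continuous 0 T (plin v).
Proof.
pose L := \sum_(0 <= k < N) `|v k| + 1.
have L0 : 0 < L by rewrite ltr_wpDl// sumr_ge0.
have lip s t : s <= t -> `|plin v t - plin v s| <= L * (t - s).
  move=> st; rewrite /plin -sumrB (le_trans (ler_norm_sum _ _ _))//.
  rewrite /L mulrDl mulr_suml ler_wpDr ?mul1r ?subr_ge0//.
  apply: ler_sum => k _; rewrite -mulrBr normrM ler_wpM2l// ger0_norm.
    by rewrite (le_trans (clip_lipschitz (ltW d_gt0) _))//; lra.
  by rewrite subr_ge0 clip_le ?(ltW d_gt0)//; lra.
move=> e e0; exists (e / L); first by rewrite divr_gt0.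
move=> S S1 _; rewrite ltr_pdivlMr// mulrC => SL.
apply: le_lt_trans SL; rewrite mulr_sumr big_seq [leRHS]big_seq; apply: ler_sum.
by move=> I /(allP S1) /and3P[_ I12 _]; exact: lip.
Qed.

Lemma plin_derive v k t : (k < N)%N -> k%:R * d < t < k.+1%:R * d ->
  derive1 (plin v) t = v k.
Proof.
move=> kN tk.
have E : {near t, plin v =1 (fun s => (plin v (k%:R * d) - v k * (k%:R * d)) + v k * s)}.
  have : \forall s \near t, s \in `]k%:R * d, k.+1%:R * d[ by apply: near_in_itvoo; rewrite in_itv.
  apply: filterS => s; rewrite in_itv/= => /andP[ks sk].
  by rewrite (plin_in _ kN) ?(ltW ks) ?(ltW sk)//; ring.
rewrite derive1E (near_eq_derive _ E)//.
by rewrite deriveD// derive_cst add0r deriveZ//= derive_id [_ *: _]mulr1.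
Qed.

Lemma step_in a k t : (k < N)%N -> k%:R * d < t <= k.+1%:R * d -> step a t = a k.
Proof.
move=> kN tk; rewrite /step (bigD1_seq k) ?iota_uniq ?mem_index_iota//=.
rewrite indicE mem_set /= ?in_itv// mulr1 big1 ?addr0// => j jk.
rewrite indicE memNset ?mulr0//= in_itv/= => /andP[jt tj].
move: tk jk => /andP[kt tk]; rewrite neq_ltn => /orP[|] /grid_le; lra.
Qed.

Lemma step_ge0 a t : (forall k, 0 <= a k) -> 0 <= step a t.
Proof. by move=> a0; apply: sumr_ge0 => k _; rewrite mulr_ge0. Qed.

Lemma step_measurable a (A : set R) : measurable_fun A (step a).
Proof.
apply: measurable_funTS; rewrite /step; apply: measurable_sum => k.
by apply: measurable_funM => //; exact: measurable_indic.
Qed.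

Lemma step_integral a T : 0 <= T -> (forall k, 0 <= a k) ->
  (\int[mu]_(t in `[0%R, T]) (step a t)%:E)%E = (plin a T)%:E.
Proof.
move=> T0 a0; rewrite /step.
under eq_integral do rewrite -sumEFin.
have mi k : measurable_fun (`[0%R, T] : set R)
    (EFin \o (\1_(`]k%:R * d, k.+1%:R * d]) : R -> R)).
  by apply/measurable_EFinP; exact: measurable_indic.
have m0 k : measurable_fun (`[0%R, T] : set R)
    (EFin \o (fun t => a k * \1_(`]k%:R * d, k.+1%:R * d]) t)).
  by apply/measurable_EFinP; apply: measurable_funM => //; exact: measurable_indic.
rewrite ge0_integral_sum//; last by move=> k t _; rewrite lee_fin mulr_ge0.
rewrite /plin -sumEFin; apply: eq_bigr => k _.
under eq_integral do rewrite EFinM.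
rewrite ge0_integralZl//=; [|exact: mi|by rewrite lee_fin].
rewrite integral_indic//= EFinM; congr (_ * _)%E.
have k0 : 0 <= k%:R * d by rewrite mulr_ge0// ltW.
have -> : `]k%:R * d, k.+1%:R * d] `&` `[0, T] = `]k%:R * d, Num.min (k.+1%:R * d) T]%classic.
  apply/seteqP; split => t /=; rewrite !in_itv/= le_min.
    by move=> [/andP[-> ->] /andP[_ ->]].
  by move=> /and3P[kt -> ->]; rewrite kt (le_trans k0 (ltW kt)).
rewrite lebesgue_measure_itv/= lte_fin /clip.
case: ltP => [kT|Tk].
  rewrite -EFinB; congr (_%:E); move: kT; rewrite lt_min mulrSr mulrDl mul1r.
  move=> /andP[_ kT]; rewrite (max_idPr _); last by rewrite le_min subr_ge0 !ltW.
  by rewrite /Num.min; case: (ltP (_ + d) T) => ?; case: (ltP (T - _) d) => ?; lra.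
congr (_%:E); move: Tk; rewrite mulrSr mulrDl mul1r /Num.min /Num.max.
by case: (ltP (_ + d) T) => ?; case: (ltP (T - _) d) => ?; case: (ltP 0 _) => ?; lra.
Qed.

End grid.

(** * The maximizer against a hitting strategy *)

Section closed_loop.
Context {R : realType}.
Variables (D r c1 c2 y : R) (h : R -> R).
Hypotheses (D_gt0 : 0 < D) (r_gt0 : 0 < r) (c1_gt0 : 0 < c1) (c2_gt0 : 0 < c2).
Hypotheses (h_cont : {within `[0, D], continuous h}).
Hypotheses (h_incr : {in `[0, D] &, {homo h : u v / u < v}}) (h_0 : h 0 = 0).
Hypothesis y_large : r / (4 * (c1^-1 + c2^-1)^-1) <= - y.
Local Notation mu := (@lebesgue_measure R).
Local Notation K := (c1^-1 + c2^-1).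
Variables (d : R) (N : nat).
Hypothesis d_gt0 : 0 < d.
Let K_gt0 : 0 < K := K_gt0 c1_gt0 c2_gt0.
Implicit Types v : nat -> R.

(* The cheapest way of giving the state the velocity [v k] on the [k]-th step. *)
Definition steer v : cpath R * cpath R :=
  (plin_cpath N d_gt0 (fun k => (v k - y) / (c1 * K)),
   plin_cpath N d_gt0 (fun k => - ((v k - y) / (c2 * K)))).

Lemma pushed_steer v t : 0 <= t -> t <= N%:R * d -> pushed y (steer v) t = plin d N v t.
Proof.
move=> t0 tN; rewrite /pushed -(plin_cst d_gt0 y t0 tN) /cpath_fun/= /plin.
rewrite -sumrN -!big_split/=; apply: eq_bigr => k _.
have := K_gt0; have := c1_gt0; have := c2_gt0 => ? ? ?.
rewrite -!mulNr -!mulrDl; congr (_ * _).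
rewrite opprK addrAC -addrA.
have -> : (v k - y) / (c2 * K) + (v k - y) / (c1 * K) = v k - y.
  have -> : (v k - y) / (c2 * K) + (v k - y) / (c1 * K) = (v k - y) * (K / K).
    by rewrite !invfM; ring.
  by rewrite divff ?mulr1// gt_eqF.
by rewrite addrC subrK.
Qed.

(** The derivatives are constant inside each step; the grid nodes, where [derive1] may be junk, form
    a countable null set. *)
Lemma energy_steer v T : 0 <= T -> T <= N%:R * d ->
  (energy c1 c2 T (steer v) <= (plin d N (fun k => (v k - y) ^+ 2 / K) T)%:E)%E.
Proof.
move=> T0 TN; rewrite /energy asboolT; last first.
  by split; exact: plin_abs_continuous.
have e0 k : 0 <= (v k - y) ^+ 2 / K by rewrite divr_ge0 ?sqr_ge0// ltW.
rewrite -(step_integral N d_gt0 T0 e0).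
have cG : countable (range (fun k => k%:R * d : R)) by apply: card_le_trans (card_image_le _ _) _.
apply: (@ge0_integral_ae_le _ _ _ mu _ (range (fun k => k%:R * d : R))) => //.
- exact: countable_measurable.
- exact: countable_lebesgue_measure0.
- by apply/measurable_EFinP; exact: step_measurable.
- by move=> t _; rewrite lee_fin addr_ge0// mulr_ge0 ?sqr_ge0// ltW.
- by move=> t _; rewrite lee_fin step_ge0.
move=> t; rewrite /= in_itv/= => /andP[t0 tT] nt.
have tpos : 0 < t.
  by rewrite lt_neqAle t0 andbT; apply/eqP => H; apply: nt; exists 0%N => //; rewrite mul0r.
have [k kN /andP[kt tk]] := grid_find tpos (le_trans tT TN).
have tk' : t < k.+1%:R * d.
  by rewrite lt_neqAle tk andbT; apply/eqP => H; apply: nt; exists k.+1.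
rewrite (step_in d_gt0 _ kN); last by rewrite kt.
rewrite !(plin_derive d_gt0 _ kN) ?kt ?tk'// lee_fin.
rewrite le_eqVlt; apply/orP; left; apply/eqP.
have -> : c1 * ((v k - y) / (c1 * K)) ^+ 2 + c2 * (- ((v k - y) / (c2 * K))) ^+ 2 =
    (v k - y) ^+ 2 * (K / K) / K.
  have := c1_gt0; have := c2_gt0 => c20 c10; rewrite sqrrN.
  have sq (c k' w : R) : 0 < c -> 0 < k' -> c * (w / (c * k')) ^+ 2 = w ^+ 2 / k' ^+ 2 * c^-1.
    by move=> c0 k0; field; rewrite !gt_eqF.
  by rewrite !sq// -mulrDr; move: K => k'; rewrite expr2 invfM; ring.
by rewrite divff ?mulr1// gt_eqF.
Qed.

Variables (x : R) (alpha : cpath R * cpath R -> control R).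
Hypotheses (x_itv : 0 <= x <= D) (alpha_adm : hit_admissible D y x alpha).

(** Velocities of the first [k] steps, the later ones defaulting to [0] when the strategy is
    consulted. *)
Fixpoint history (u : nat -> R -> R) k : seq R :=
  if k is k'.+1 then
    let psi := steer (nth 0 (history u k')) in
    rcons (history u k') (u k' (hit_dynamics y x psi (alpha psi) (k'%:R * d)))
  else [::].

(** By causality the state at time [k * d] depends only on the velocities before step [k], so the
    default values in [history] do not affect the feedback. *)
Lemma closed_loop (u : nat -> R -> R) : exists v, forall k,
  v k = u k (hit_dynamics y x (steer v) (alpha (steer v)) (k%:R * d)).
Proof.
have sz k : size (history u k) = k by elim: k => //= k ih; rewrite size_rcons ih.
pose v k := nth 0 (history u k.+1) k; exists v => k.
have hv j : (j < k)%N -> nth 0 (history u k) j = v j.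
  elim: (k) => // n ih; rewrite ltnS leq_eqVlt => /predU1P[->//|jn].
  by rewrite /= nth_rcons sz jn ih.
have e : eq_upto2 (k%:R * d) (steer (nth 0 (history u k))) (steer v).
  split=> s /andP[_ sk]; rewrite /cpath_fun/=;
    by apply: (@eq_plin _ _ _ d_gt0 _ _ k) => // j jk; rewrite hv.
have kd0 : 0 <= k%:R * d by rewrite mulr_ge0// ltW.
rewrite {1}/v /= nth_rcons sz ltnn eqxx !hit_dynamicsE.
rewrite (pushed_upto _ e) ?lexx ?kd0// (alpha_adm.1 _ _ _ kd0 e)// lexx kd0//.
Qed.

Variables (v : nat -> R) (N1 : nat) (A s0 : R).
Hypotheses (v_up : forall k, (k < N1)%N -> v k <= A).
Hypotheses (v_low : forall k, (N1 <= k)%N -> v k <= - s0).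
Hypotheses (N1_le : (N1 <= N)%N).
Hypotheses (N_large : x + N1%:R * A * d - (N - N1)%:R * s0 * d < 0).

Local Notation psi := (steer v).
Local Notation rho := (alpha psi).
Local Notation phi t := (hit_dynamics y x psi rho t).

Lemma plin_end : plin d N v (N%:R * d) <= N1%:R * A * d - (N - N1)%:R * s0 * d.
Proof.
rewrite /plin (@eq_big_nat _ _ _ _ _ _ (fun k => v k * d)); last first.
  move=> k /andP[_ kN]; rewrite clip_ge//.
  by have := grid_le d_gt0 kN; rewrite mulrSr mulrDl mul1r; lra.
rewrite -mulr_suml -mulrBl ler_pM2r// (@big_cat_nat _ _ _ N1)//=.
apply: lerD.
  rewrite -[N1 in leRHS]subn0 mulr_natl -(sumr_const_nat N1 0 A).
  by rewrite big_nat_cond [leRHS]big_nat_cond; apply: ler_sum => k /andP[/andP[_ /v_up]].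
rewrite -mulrN mulr_natl -(sumr_const_nat N N1 (- s0)).
by rewrite big_nat_cond [leRHS]big_nat_cond; apply: ler_sum => k /andP[/andP[/v_low]].
Qed.

(** By [N_large] the uncontrolled path is negative at the end of the grid, so the control has
    crossed it. At the first crossing admissibility still applies and forbids jumping past [0], so
    the state is exactly [0] there. *)
Lemma hit_before_end : exists tau, [/\ 0 <= tau, tau <= N%:R * d,
  hit_time y x psi rho = tau%:E, phi tau = 0 &
  forall t, 0 <= t -> t <= tau -> 0 <= phi t <= D].
Proof.
have Nd0 : 0 <= N%:R * d by rewrite mulr_ge0// ltW.
have [_ adm] := alpha_adm.
pose f t := x + pushed y psi t.
have cf : continuous f := @uncontrolled_continuous _ y x psi.
have phiE t : phi t = f t - rho t by rewrite hit_dynamicsE.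
have fN : f (N%:R * d) <= rho (N%:R * d).
  rewrite (@le_trans _ _ 0) ?control_ge0// /f pushed_steer//.
  by apply: ltW; apply: le_lt_trans N_large; rewrite -addrA lerD2l plin_end.
have [s Hs sN] := first_crossing_ex cf Nd0 fN.
have [s_ge0 sf sle] := Hs.
have before t : 0 <= t -> t < s -> phi t <> 0.
  by move=> t0 ts; rewrite phiE => /eqP; rewrite gt_eqF// subr_gt0; exact: sle.
have hs : (s%:E <= hit_time y x psi rho)%E.
  apply: le_ereal_inf_tmp => _ [t [t0 tphi] <-]; rewrite lee_fin leNgt.
  by apply/negP => ts; exact: before t0 ts tphi.
have phis : phi s = 0.
  have /andP[+ _] := adm _ _ s_ge0 hs; rewrite phiE => s1.
  by apply/eqP; rewrite eq_le s1 andbT subr_le0.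
exists s; split => //.
  apply/eqP; rewrite eq_le hs andbT; apply: ereal_inf_lbound; by exists s.
move=> t t0 ts; apply: adm => //; apply: le_trans hs; by rewrite lee_fin.
Qed.

End closed_loop.

(** * Cost of a grid path up to the hitting time *)

Section hit_cost_lower_bound.
Context {R : realType}.
Variables (D r c1 c2 y : R) (h : R -> R).
Hypotheses (D_gt0 : 0 < D) (r_gt0 : 0 < r) (c1_gt0 : 0 < c1) (c2_gt0 : 0 < c2).
Hypotheses (h_incr : {in `[0, D] &, {homo h : u v / u < v}}) (h_0 : h 0 = 0).
Local Notation K := (c1^-1 + c2^-1).
Local Notation hc := (hc D h).
Variables (d : R) (N : nat).
Hypothesis d_gt0 : 0 < d.
Variables (x : R) (rho : control R) (v : nat -> R) (tau : R).
Local Notation psi := (steer c1 c2 y N d_gt0 v).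
Local Notation phi t := (hit_dynamics y x psi rho t).
Hypotheses (tau_ge0 : 0 <= tau) (tau_le : tau <= N%:R * d).
Hypotheses (hit_tau : hit_time y x psi rho = tau%:E).
Hypothesis phi_itv : forall t, 0 <= t -> t <= tau -> 0 <= phi t <= D.

(** The grid is frozen at [tau]: steps starting after [tau] have duration [0] and drop out of the
    sums. *)
Definition node k := Num.min (k%:R * d) tau.
Definition duration k := clip d (tau - k%:R * d).
(* Within the step the state is at least its final value minus [Num.max (v k) 0 * d],
   because [rho] only pushes it down. *)
Definition gain k :=
  (hc (phi (node k.+1) - Num.max (v k) 0 * d) - (v k - y) ^+ 2 / K) * duration k
    + r * (rho (node k.+1) - rho (node k)).

Lemma node_itv k : 0 <= node k <= tau.
Proof. by rewrite /node le_min tau_ge0 mulr_ge0 ?(ltW d_gt0)//= ge_min lexx orbT. Qed.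

Lemma duration_itv k : 0 <= duration k <= d.
Proof. exact/clip_itv/ltW. Qed.

Lemma node_le k : node k <= node k.+1.
Proof.
rewrite /node le_min ge_min ge_min lexx orbT andbT.
by rewrite ler_pM2r// ler_nat leqnSn.
Qed.

Lemma hit_dynamics_step t : 0 <= t -> t <= tau -> phi t = x + plin d N v t - rho t.
Proof. by move=> t0 tt; rewrite hit_dynamicsE pushed_steer// (le_trans tt). Qed.

Lemma node_late k : tau <= k%:R * d -> node k = tau /\ duration k = 0.
Proof.
move=> tk; split; first by rewrite /node (min_idPr tk).
by rewrite /duration clip_le0// subr_le0.
Qed.

Lemma node_early k : k%:R * d <= tau -> node k = k%:R * d /\
  node k.+1 = k%:R * d + duration k.
Proof.
move=> tk; split; first by rewrite /node (min_idPl tk).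
have := d_gt0; rewrite /node /duration /clip mulrSr mulrDl mul1r => d0.
by rewrite /Num.min /Num.max; case: (ltP (_ + d) _) => ?; case: (ltP (tau - _) d) => ?;
  case: (ltP 0 _) => ?; lra.
Qed.

Lemma phi_node k : (k < N)%N ->
  phi (node k.+1) = phi (node k) + v k * duration k - (rho (node k.+1) - rho (node k)).
Proof.
move=> kN; have /andP[n0 nt] := node_itv k; have /andP[n0' nt'] := node_itv k.+1.
rewrite !hit_dynamics_step//.
have [tk|/ltW tk] := leP (k%:R * d) tau.
  have [nk nk1] := node_early tk; have /andP[d0 dd] := duration_itv k.
  rewrite nk1 nk (plin_in d_gt0 v kN); last first.
    by rewrite lerDl d0/= mulrSr mulrDl mul1r lerD2l.
  by ring.
have [nk ->] := node_late tk.
have tk1 : tau <= k.+1%:R * d by rewrite (le_trans tk)// grid_le.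
by have [-> _] := node_late tk1; rewrite nk; ring.
Qed.

(** The increments of [rho] in [gain] telescope and miss only the initial jump, whence the term
    [r * rho 0]. *)
Lemma hit_cost_ge :
  ((\sum_(0 <= k < N) gain k + r * rho 0)%:E <= hit_cost r c1 c2 y h x psi rho)%E.
Proof.
have K0 := K_gt0 c1_gt0 c2_gt0.
pose hl k := hc (phi (node k.+1) - Num.max (v k) 0 * d).
pose e k := (v k - y) ^+ 2 / K.
have -> : \sum_(0 <= k < N) gain k + r * rho 0 =
    plin d N hl tau + r * rho tau - plin d N e tau.
  have E : plin d N hl tau - plin d N e tau = \sum_(0 <= k < N) (hl k - e k) * duration k.
    by rewrite /plin -sumrB; apply: eq_bigr => k _; rewrite mulrBl.
  transitivity (\sum_(0 <= k < N) (hl k - e k) * duration k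
      + r * (rho (node N) - rho (node 0)) + r * rho 0).
    by rewrite big_split/= -mulr_sumr telescope_sumr.
  have -> : node 0 = 0 by rewrite /node mul0r (min_idPl tau_ge0).
  have -> : node N = tau by rewrite /node (min_idPr tau_le).
  by rewrite -E; ring.
rewrite EFinB EFinD /hit_cost hit_tau; apply: leeB; last exact: energy_steer.
apply: leeD => //; rewrite -(step_integral N d_gt0 tau_ge0); last first.
  by move=> k; exact: hc_ge0.
have hphi t : 0 <= t -> t <= tau -> hc (phi t) = h (phi t).
  by move=> t0 tt; have /andP[a b] := phi_itv t0 tt; rewrite hc_id.
apply: ge0_integral_subset_le => t /=; rewrite in_itv/= => /andP[t0 tt].
- by rewrite lee_fin step_ge0// => k; exact: hc_ge0.
- by rewrite lee_fin -hphi// hc_ge0.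
- split; first by rewrite t0.
  rewrite lee_fin -hphi//.
  (* The steps are open on the left, so [step] vanishes at time [0]. *)
  move: (t0); rewrite le_eqVlt => /predU1P[<-|tpos].
    rewrite (_ : step _ _ _ _ = 0) ?hc_ge0// /step big1// => k _.
    rewrite indicE memNset ?mulr0//= in_itv/= => /andP[].
    by rewrite ltNge mulr_ge0// ltW.
  have [k kN /andP[kt tk]] := grid_find tpos (le_trans tt tau_le).
  rewrite (step_in d_gt0 _ kN) ?kt// /hl; apply: hc_le => //.
  have ktau : k%:R * d <= tau by rewrite ltW// (lt_le_trans kt).
  have [nk nk1] := node_early ktau.
  have /andP[n0 nt] := node_itv k.+1.
  have tn : t <= node k.+1 by rewrite /node le_min tk tt.
  have /andP[d0 dd] := duration_itv k.
  have p1 : plin d N v (node k.+1) = plin d N v (k%:R * d) + v k * duration k.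
    rewrite nk1 (plin_in d_gt0 v kN); first by congr (_ + _ * _); ring.
    by rewrite lerDl d0/= mulrSr mulrDl mul1r lerD2l.
  have p2 : plin d N v t = plin d N v (k%:R * d) + v k * (t - k%:R * d).
    by apply: plin_in => //; rewrite ltW.
  rewrite !hit_dynamics_step// p1 p2.
  have rle := control_le rho tn.
  have tle : t - k%:R * d <= duration k by rewrite lerBlDl -nk1.
  suff : v k * (duration k - (t - k%:R * d)) <= Num.max (v k) 0 * d by lra.
  apply: (@le_trans _ _ (Num.max (v k) 0 * (duration k - (t - k%:R * d)))).
    by rewrite ler_wpM2r ?subr_ge0// le_max lexx.
  by rewrite ler_wpM2l ?le_max ?lexx ?orbT//; lra.
Qed.

End hit_cost_lower_bound.

(** * One step of the maximizer's policy *)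

Section policy.
Context {R : realType}.
Variables (D r c1 c2 y : R) (h : R -> R).
Hypotheses (D_gt0 : 0 < D) (r_gt0 : 0 < r) (c1_gt0 : 0 < c1) (c2_gt0 : 0 < c2).
Hypotheses (h_cont : {within `[0, D], continuous h}).
Hypotheses (h_incr : {in `[0, D] &, {homo h : u v / u < v}}) (h_0 : h 0 = 0).
Hypothesis y_large : r / (4 * (c1^-1 + c2^-1)^-1) <= - y.
Local Notation K := (c1^-1 + c2^-1).
Local Notation hc := (hc D h).
Local Notation slope := (slope D r c1 c2 y h).
Local Notation W := (W D r c1 c2 y h).
Local Notation hs := (reflection_threshold r c1 c2 y).

(** The velocity [y + p * K / 2] maximizes [p * u - (u - y) ^+ 2 / K] over [u]; here
    [p = l * slope a], and [p = r] in [up]. With [l < 1] it stays at most [(1 - l) * y]. *)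
Definition down l a := y + l * slope a * K / 2.
Definition up := y + r * K / 2.

Lemma down_le l a : 0 <= l -> down l a <= - ((1 - l) * - y).
Proof.
move=> l0; have K0 := K_gt0 c1_gt0 c2_gt0.
have sl : slope a * K / 2 <= - y.
  have := lower_root_le_y y c1_gt0 c2_gt0 (capped D r c1 c2 y h a).
  rewrite -/(slope a) => /(ler_wpM2r (ltW K0)); rewrite mulrA -(mulrA _ K^-1) mulVf ?gt_eqF//; lra.
have := ler_wpM2l l0 sl; rewrite /down; lra.
Qed.

(** The running cost is taken at the end of the step, where the state is lower; the term [- d * hc]
    of the potential pays for this and telescopes. Convexity bounds the drop of [W] by the slope at
    the start. *)
Lemma down_step l a b th dr d : 0 <= l -> l <= 1 -> 0 <= a -> 0 <= b -> 0 <= th -> th <= d ->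
  0 <= dr -> b = a + down l a * th - dr ->
  (l * W a - d * hc a) - (l * W b - d * hc b) <=
  (hc (b - Num.max (down l a) 0 * d) - (down l a - y) ^+ 2 / K) * th + r * dr.
Proof.
move=> l0 l1 a0 b0 th0 thd dr0 bE; have K0 := K_gt0 c1_gt0 c2_gt0.
have y0 := y_lt0 r_gt0 c1_gt0 c2_gt0 y_large.
have vle := down_le a l0.
have v0 : down l a <= 0.
  apply: le_trans vle _; rewrite oppr_le0 mulr_ge0//; first by rewrite subr_ge0.
  by rewrite oppr_ge0 ltW.
rewrite (max_idPr v0) mul0r subr0.
set q := l * slope a.
have s0 : 0 <= slope a by exact: slope_ge0.
have q0 : 0 <= q by rewrite mulr_ge0.
have qr : q <= r.
  by apply: (@le_trans _ _ (slope a)); [rewrite ler_piMl|exact: slope_le_r].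
have vE : (down l a - y) ^+ 2 / K = q ^+ 2 / 4 * K.
  rewrite /down -/q; set k := K; field; by rewrite gt_eqF.
(* The right-hand side is [G q]. Since [G] decreases on [[0, slope a]], it is at least
   [G (slope a) = - capped a]. *)
have Gq : - hc a <= q * down l a - q ^+ 2 / 4 * K.
  have : conjugate c1 c2 y (slope a) = - capped D r c1 c2 y h a by exact: conjugate_slope.
  rewrite /conjugate => E.
  have cap : capped D r c1 c2 y h a <= hc a by rewrite /capped ge_min lexx.
  have sK : slope a * K / 2 <= - y.
    have := @down_le 1 a ler01; rewrite /down subrr mul0r oppr0 mul1r; lra.
  have qs : q <= slope a by rewrite ler_piMl.
  have qK : q * K <= slope a * K by rewrite ler_wpM2r// ltW.
  have : 0 <= (slope a - q) * (- y - (slope a + q) * K / 4).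
    by rewrite mulr_ge0 ?subr_ge0//; lra.
  rewrite /down -/q; lra.
have ba : b <= a.
  rewrite bE; have : down l a * th <= 0 by rewrite mulr_le0_ge0.
  lra.
have hab : hc b <= hc a by exact: hc_le.
have hd : (hc a - hc b) * th <= (hc a - hc b) * d by rewrite ler_wpM2l// subr_ge0.
have Wab : l * (W a - W b) <= q * (a - b).
  rewrite /q -mulrA ler_wpM2l//; exact: W_convex.
have rdr : q * dr <= r * dr by rewrite ler_wpM2r.
have := ler_wpM2r th0 Gq; rewrite vE => Gth.
have qdr : q * dr = q * (a - b) + q * down l a * th.
  by rewrite bE; ring.
nra.
Qed.

(** [up] is optimal for the slope [r], and [G r = - hs]; so the gain is the excess of [hl] over [hs]
    plus [r] per unit of descent. *)
Lemma up_step hl a b th dr : b = a + up * th - dr ->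
  (hl - (up - y) ^+ 2 / K) * th + r * dr = (hl - hs) * th + r * (a - b).
Proof.
move=> ->; have K0 := K_gt0 c1_gt0 c2_gt0; rewrite /up /reflection_threshold /conjugate.
set k := K; field; by rewrite gt_eqF.
Qed.

End policy.

(** * The maximizer's reply to a strategy *)

Section reply.
Context {R : realType}.
Variables (D r c1 c2 y : R) (h : R -> R).
Hypotheses (D_gt0 : 0 < D) (r_gt0 : 0 < r) (c1_gt0 : 0 < c1) (c2_gt0 : 0 < c2).
Hypotheses (h_cont : {within `[0, D], continuous h}).
Hypotheses (h_incr : {in `[0, D] &, {homo h : u v / u < v}}) (h_0 : h 0 = 0).
Hypothesis y_large : r / (4 * (c1^-1 + c2^-1)^-1) <= - y.
Local Notation hc := (hc D h).
Local Notation W := (W D r c1 c2 y h).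
Local Notation hs := (reflection_threshold r c1 c2 y).
Local Notation down := (down D r c1 c2 y h).
Local Notation up := (up r c1 c2 y).

Let W_le_r (a b : R) : 0 <= a -> a <= b -> W b - W a <= r * (b - a).
Proof. exact: W_increment_le. Qed.

(** [a0] is the state after the initial jump, and playing up is allowed on the first [N1] steps
    while the state is at least [b]. A control that lets the state stay there loses [eta] per unit
    time, which gives the second bound on [C]; one that brings it below [b] pays [r] per unit of
    descent, which gives the first. Without an up phase, the potential [l * W a0] is what is gained,
    up to a term in [d]. *)
Lemma maximizer_reply x alpha (N1 : nat) (b l d eta : R) :
  0 <= x <= D -> hit_admissible D y x alpha ->
  0 < d -> 0 <= l -> l < 1 -> 0 < b -> 0 <= eta ->
  ((0 < N1)%N -> hs + eta <= hc (b - `|up| * d)) ->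
  exists psi a0, [/\ hit_paths y x alpha psi, 0 <= a0, a0 <= x &
    forall C, (N1 = 0%N \/ a0 < b -> C <= l * W a0 - d * hc a0) ->
      ((0 < N1)%N -> b <= a0 -> C <= r * (a0 - b) + l * W b - d * (hs + hc D) /\
         C <= N1%:R * eta * d - r * D - d * hc D) ->
      ((r * (x - a0) + C)%:E <= hit_cost r c1 c2 y h x psi (alpha psi))%E].
Proof.
move=> x_itv alpha_adm d0 l0 l1 b0 eta0 Hb.
have K0 := K_gt0 c1_gt0 c2_gt0; have y0 := y_lt0 r_gt0 c1_gt0 c2_gt0 y_large.
have hs0 : 0 <= hs by exact: reflection_threshold_ge0.
pose s0 := (1 - l) * - y.
have s0_gt0 : 0 < s0 by rewrite mulr_gt0 ?subr_gt0// oppr_gt0.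
(* Enough steps down at speed [s0] to undo [x] and [N1] steps up. *)
pose M := Num.bound ((x + N1%:R * `|up| * d) / (s0 * d)).
pose N := (N1 + M)%N.
have N1N : (N1 <= N)%N by rewrite leq_addr.
have N_large : x + N1%:R * `|up| * d - (N - N1)%:R * s0 * d < 0.
  rewrite /N addKn subr_lt0 -(mulrA M%:R) -ltr_pdivrMr; last exact: mulr_gt0.
  apply: archi_boundP; apply: divr_ge0; last by apply/ltW/mulr_gt0.
  apply: addr_ge0; first by case/andP: x_itv.
  by apply: mulr_ge0 (ltW d0); exact: mulr_ge0.
pose u k a := if (k < N1)%N && (b <= a) then up else down l a.
have down_le0 a : down l a <= - s0 by exact: down_le.
have [v vE] := closed_loop c1 c2 N d0 alpha_adm u.
have v_up k : (k < N1)%N -> v k <= `|up|.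
  move=> _; rewrite vE /u; case: ifP => _; first exact: ler_norm.
  by rewrite (le_trans (down_le0 _))// (@le_trans _ _ 0)// oppr_le0 ltW.
have v_low k : (N1 <= k)%N -> v k <= - s0.
  by move=> kN; rewrite vE /u ltnNge kN/=.
have [tau [tau0 tauN hit phi0 phi_itv]] :=
  hit_before_end c1_gt0 c2_gt0 d0 alpha_adm v_up v_low N1N N_large.
set psi := steer c1 c2 y N d0 v in vE hit phi0 phi_itv *.
set rho := alpha psi in vE hit phi0 phi_itv *.
pose ph k := hit_dynamics y x psi rho (node d tau k).
pose S k := \sum_(0 <= j < k) gain D r c1 c2 y h N d0 x rho v tau j.
pose B a := l * W a - d * hc a.
pose low k := ~~ ((k < N1)%N && (b <= ph k)).
have ph_itv k : 0 <= ph k <= D.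
  by apply: phi_itv; have /andP[] := node_itv d0 tau0 k.
have ph0E : ph 0%N = x - rho 0.
  by rewrite /ph /node mul0r (min_idPl tau0) hit_dynamicsE pushed0 addr0.
have late k : tau <= k%:R * d -> ph k = 0.
  by move=> tk; rewrite /ph; have [-> _] := node_late d0 tk.
have SS k : S k.+1 = S k + gain D r c1 c2 y h N d0 x rho v tau k.
  by rewrite /S big_nat_recr.
have early k : k%:R * d < tau -> v k = u k (ph k).
  by move=> kt; rewrite vE /ph; have [-> _] := node_early d0 (ltW kt).
have phS k : (k < N)%N -> ph k.+1 = ph k + v k * duration d tau k -
    (rho (node d tau k.+1) - rho (node d tau k)) by exact: phi_node.
have dr0 k : 0 <= rho (node d tau k.+1) - rho (node d tau k).
  by rewrite subr_ge0 control_le// node_le.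
(* The low phase is absorbing, because both the velocity and the control only lower the state in
   it. *)
have lowS k : (k < N)%N -> low k -> low k.+1 /\ S k + B (ph k) <= S k.+1 + B (ph k.+1).
  move=> kN lk; have [tk|kt] := leP tau (k%:R * d).
    have tk1 : tau <= k.+1%:R * d by rewrite (le_trans tk)// grid_le.
    have [n1 _] := node_late d0 tk1; have [n2 dk] := node_late d0 tk.
    split; first by rewrite /low late// negb_and -ltNge b0 orbT.
    by rewrite SS /gain dk n1 n2 subrr !mulr0 !addr0 !late.
  have vk : v k = down l (ph k) by rewrite early// /u (negbTE lk).
  have /andP[th0 thd] := duration_itv d0 tau k.
  have /andP[a0 aD] := ph_itv k; have /andP[b0' bD] := ph_itv k.+1.
  have E := phS k kN; rewrite vk in E.
  have le : ph k.+1 <= ph k.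
    rewrite E; have : down l (ph k) * duration d tau k <= 0.
      by rewrite mulr_le0_ge0// (le_trans (down_le0 _))// oppr_le0 ltW.
    by have := dr0 k; lra.
  split.
    move: lk; rewrite /low !negb_and -!leqNgt -!ltNge => /orP[k1|k2].
      by rewrite leqW.
    by rewrite (le_lt_trans le k2) orbT.
  have := down_step D_gt0 r_gt0 c1_gt0 c2_gt0 h_cont h_incr h_0 y_large l0 (ltW l1)
    a0 b0' th0 thd (dr0 k) E.
  rewrite -/(B (ph k)) -/(B (ph k.+1)) SS /gain vk -/(ph k.+1); lra.
(* The loss [hs * d] is incurred once, on the step that leaves the region above [b]: there only [0]
   bounds [h] from below. *)
have upS k : (k < N)%N -> ~~ low k ->
    S k + r * (ph k - ph k.+1) - hs * d <= S k.+1 /\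
    (b <= ph k.+1 -> S k + r * (ph k - ph k.+1) + eta * d <= S k.+1).
  rewrite negbK => kN /andP[kN1 bk].
  have kt : k%:R * d < tau.
    by rewrite ltNge; apply/negP => /late E; move: bk; rewrite E leNgt b0.
  have vk : v k = up by rewrite early// /u kN1 bk.
  have /andP[th0 thd] := duration_itv d0 tau k.
  have E := phS k kN; rewrite vk in E.
  have G := @up_step _ r c1 c2 y c1_gt0 c2_gt0 (hc (ph k.+1 - Num.max up 0 * d)) _ _ _ _ E.
  have SE : S k.+1 = S k + ((hc (ph k.+1 - Num.max up 0 * d) - hs) * duration d tau k
      + r * (ph k - ph k.+1)) by rewrite SS /gain vk -/(ph k.+1) G.
  rewrite SE; split.
    have : - hs * d <= (hc (ph k.+1 - Num.max up 0 * d) - hs) * duration d tau k.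
      have := hc_ge0 D_gt0 h_incr h_0 (ph k.+1 - Num.max up 0 * d).
      have := ler_wpM2l hs0 thd; set H := hc _ => ? ?.
      have : 0 <= H * duration d tau k by rewrite mulr_ge0.
      lra.
    lra.
  move=> bk1.
  have kt1 : k.+1%:R * d < tau.
    by rewrite ltNge; apply/negP => /late E'; move: bk1; rewrite E' leNgt b0.
  have -> : duration d tau k = d.
    by rewrite /duration clip_ge//; move: kt1; rewrite mulrSr mulrDl mul1r; lra.
  have := Hb (leq_ltn_trans (leq0n k) kN1).
  have : hc (b - `|up| * d) <= hc (ph k.+1 - Num.max up 0 * d).
    apply: hc_le => //; apply: lerB => //; rewrite ler_pM2r//.
    by rewrite ge_max ler_norm normr_ge0.
  set H1 := hc _; set H2 := hc _ => H12 H1e.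
  have : eta * d <= (H2 - hs) * d by rewrite ler_pM2r//; lra.
  lra.
exists psi, (ph 0%N); split.
- by rewrite /hit_paths/= -/rho hit ltry.
- by case/andP: (ph_itv 0%N).
- by rewrite ph0E gerBl control_ge0.
move=> C C1 C2.
have hcD k : hc (ph k) <= hc D by apply: hc_le => //; case/andP: (ph_itv k).
(* Either the up phase has lasted so far and has accumulated its gain, or the low phase holds and
   the guarantee [C] is already secured. *)
have main k : (k <= N)%N ->
    ([/\ ~~ low k, b <= ph 0%N & r * (ph 0%N - ph k) + k%:R * eta * d <= S k]) \/
    (low k /\ C <= S k + B (ph k)).
  elim: k => [_|k ih kN].
    have S0 : S 0%N = 0 by rewrite /S big_nil.
    have [l0'|nl0] := boolP (low 0%N); [right|left]; split => //; rewrite ?S0.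
    - rewrite add0r; apply: C1; move: l0'; rewrite /low negb_and -leqNgt leqn0 -ltNge.
      by move=> /orP[/eqP|]; [left|right].
    - by move: nl0; rewrite negbK => /andP[].
    - by rewrite subrr mulr0 !mul0r addr0.
  have [[nlk b00 Sk]|[lk Sk]] := ih (ltnW kN); last first.
    by right; have [? ?] := lowS k kN lk; split => //; apply: le_trans Sk _.
  have [U1 U2] := upS k kN nlk.
  have N1k : (k < N1)%N by move: nlk; rewrite negbK => /andP[].
  have N1_gt0 : (0 < N1)%N by exact: leq_ltn_trans N1k.
  have k_eta : 0 <= k%:R * eta * d by rewrite !mulr_ge0// ltW.
  have [bk1|bk1] := leP b (ph k.+1).
    have {}U2 := U2 bk1.
    have Sk1 : r * (ph 0%N - ph k.+1) + k.+1%:R * eta * d <= S k.+1.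
      rewrite mulrSr !mulrDl mul1r; lra.
    have [lk1|nlk1] := boolP (low k.+1); [right|left]; split => //.
    (* With the state still above [b], the up phase can end only because its [N1] steps are used
       up. *)
    have kE : k.+1 = N1.
      by move: lk1; rewrite /low bk1 andbT -leqNgt => ?; apply/eqP; rewrite eqn_leq N1k.
    have [_ C3] := C2 N1_gt0 b00.
    have /andP[p0 pD] := ph_itv 0%N; have /andP[q0 qD] := ph_itv k.+1.
    have rq : r * (ph k.+1 - ph 0%N) <= r * D by rewrite ler_pM2l//; lra.
    have lW : 0 <= l * W (ph k.+1) by rewrite mulr_ge0// W_ge0.
    have dh : d * hc (ph k.+1) <= d * hc D by rewrite ler_pM2l.
    by move: C3; rewrite -kE /B; lra.
  right; split; first by rewrite /low negb_and -(ltNge _ b) bk1 orbT.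
  have [C3 _] := C2 N1_gt0 b00.
  have /andP[q0 qD] := ph_itv k.+1.
  have dh : d * hc (ph k.+1) <= d * hc D by rewrite ler_pM2l.
  have Wr : W b - W (ph k.+1) <= r * (b - ph k.+1) by apply: W_le_r => //; exact: ltW.
  have lWr : l * (W b - W (ph k.+1)) <= r * (b - ph k.+1).
    apply: le_trans (ler_wpM2l l0 Wr) _; rewrite mulrA; apply: ler_wpM2r.
      by rewrite subr_ge0 ltW.
    by rewrite ler_piMl// ltW.
  by move: Sk U1 C3; rewrite /B; lra.
have phN : ph N = 0.
  by rewrite /ph /node (min_idPr tauN).
have [[nlN _ _]|[_ CN]] := main N (leqnn N).
  by move: nlN; rewrite /low phN negbK leNgt b0 andbF.
have hD0 : hc 0 = 0 by exact: hc0.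
move: CN; rewrite /B phN hD0 W0 !mulr0 subrr addr0 => CN.
apply: le_trans (hit_cost_ge r D_gt0 c1_gt0 c2_gt0 h_incr h_0 tau0 tauN hit phi_itv).
by rewrite lee_fin ph0E -/(S N); lra.
Qed.

End reply.

(** * The potential bounds the hitting value from below *)

Section lower_bound.
Context {R : realType}.
Variables (D r c1 c2 y : R) (h : R -> R).
Hypotheses (D_gt0 : 0 < D) (r_gt0 : 0 < r) (c1_gt0 : 0 < c1) (c2_gt0 : 0 < c2).
Hypotheses (h_cont : {within `[0, D], continuous h}).
Hypotheses (h_incr : {in `[0, D] &, {homo h : u v / u < v}}) (h_0 : h 0 = 0).
Hypothesis y_large : r / (4 * (c1^-1 + c2^-1)^-1) <= - y.
Local Notation hc := (hc D h).
Local Notation W := (W D r c1 c2 y h).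
Local Notation hs := (reflection_threshold r c1 c2 y).
Local Notation barrier := (barrier D_gt0 r_gt0 h_cont h_incr h_0 y_large).
Local Notation Wf := (Wf D_gt0 r_gt0 h_cont h_incr h_0 y_large).
Local Notation up := (up r c1 c2 y).

Lemma Wf_low x : x <= barrier -> Wf x = W x.
Proof.
move=> xB; rewrite /Wf (min_idPl xB) (max_idPr _) ?mulr0 ?addr0//.
by rewrite subr_le0.
Qed.

Lemma Wf_high x : barrier <= x -> Wf x = W barrier + r * (x - barrier).
Proof.
move=> xB; rewrite /Wf (min_idPr xB) (max_idPl _)//.
by rewrite subr_ge0.
Qed.

Lemma scale_near_one (w e : R) : 0 <= w -> 0 < e ->
  exists2 l, 0 <= l < 1 & w - e <= l * w.
Proof.
move=> w0 e0; pose m := Num.min (1 / 2) (e / (w + 1)).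
have w1 : 0 < w + 1 by rewrite ltr_wpDl.
have m0 : 0 < m by rewrite lt_min !divr_gt0.
exists (1 - m).
  have : m <= 1 / 2 by rewrite ge_min lexx.
  by lra.
have : m * w <= e; last by lra.
apply: (@le_trans _ _ (m * (w + 1))); first by rewrite ler_pM2l// lerDl.
by rewrite -ler_pdivlMr// ge_min lexx orbT.
Qed.

Lemma Wf_le_hit_value x : 0 <= x <= D ->
  ((Wf x)%:E <= hit_value D r c1 c2 y h x)%E.
Proof.
move=> x_itv; have /andP[x0 xD] := x_itv.
have /andP[B0 BD] := barrier_itv D_gt0 r_gt0 h_cont h_incr h_0 y_large.
have hs0 : 0 <= hs by exact: reflection_threshold_ge0.
have hD0 : 0 <= hc D by exact: hc_ge0.
apply: le_ereal_inf_tmp => _ [alpha alpha_adm <-].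
apply/lee_subgt0Pr => e e0; rewrite -EFinB.
suff [psi hit H] : exists2 psi, hit_paths y x alpha psi &
    ((Wf x - e)%:E <= hit_cost r c1 c2 y h x psi (alpha psi))%E.
  by apply: le_trans H _; apply: ereal_sup_ubound; exists psi.
have W0' z : 0 <= z -> 0 <= W z by move=> z0; exact: W_ge0.
have dW a b : 0 <= a -> a <= b -> W b - W a <= r * (b - a) by move=> *; exact: W_increment_le.
have Wle a b : 0 <= a -> a <= b -> W a <= W b by move=> *; exact: W_le.
have e2 : 0 < e / 4 by rewrite divr_gt0.
have [xB|Bx] := leP x barrier.
  have [l /andP[l0 l1] lW] := scale_near_one (W0' x x0) e2.
  pose d := e / 4 / (hc D + 1).
  have d0 : 0 < d by rewrite divr_gt0// ltr_wpDl.
  have dD : d * hc D <= e / 4.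
    rewrite -[leRHS](@divfK _ (hc D + 1)) -/d ?gt_eqF ?ltr_wpDl//.
    by rewrite ler_pM2l// lerDl.
  (* No upward play: [N1 = 0], and [1] is a placeholder for [b]. *)
  have [//|psi [a0 [hit a00 a0x H]]] := @maximizer_reply _ D r c1 c2 y h D_gt0 r_gt0
    c1_gt0 c2_gt0 h_cont h_incr h_0 y_large x alpha 0 1 l d 0 x_itv alpha_adm d0 l0 l1
    ltr01 (lexx 0).
  exists psi => //; apply: le_trans (H (l * W a0 - d * hc D) _ _) => //.
    rewrite lee_fin Wf_low//.
    have d1 := dW _ _ a00 a0x; have d2 := Wle _ _ a00 a0x.
    have : l * (W x - W a0) <= r * (x - a0).
      by apply: le_trans d1; rewrite ler_piMl ?subr_ge0// ltW.
    lra.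
  by move=> _; rewrite lerD2l lerN2 ler_pM2l// hc_le// (le_trans a0x).
(* Above the barrier [h] exceeds the threshold strictly, by [2 * eta] at [b], while [Wf] grows by at
   most [e / 4] from the barrier to [b]. *)
pose b := Num.min x (barrier + e / 4 / r).
have Bb : barrier < b by rewrite lt_min Bx ltrDl divr_gt0.
have bx : b <= x by rewrite ge_min lexx.
have bB : r * (b - barrier) <= e / 4.
  have : b <= barrier + e / 4 / r by rewrite ge_min lexx orbT.
  by rewrite -lerBlDl ler_pdivlMr// mulrC.
have b_gt0 : 0 < b by exact: le_lt_trans Bb.
have bD : b <= D by exact: le_trans xD.
have hcb : hs < hc b by rewrite hc_id ?(ltW b_gt0)//; exact: barrier_lt Bb bD.
pose eta := (hc b - hs) / 2.
have eta0 : 0 < eta by rewrite divr_gt0// subr_gt0.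
have [e1 e10 He1] : exists2 e1, 0 < e1 & forall z, `|b - z| < e1 -> `|hc b - hc z| < eta.
  have hb : hc z @[z --> b] --> hc b by exact: hc_continuous.
  move/cvgrPdist_lt : hb => /(_ _ eta0)[e1 /= e10 He1].
  by exists e1.
have [l /andP[l0 l1] lW] := scale_near_one (W0' b (ltW b_gt0)) e2.
(* The first bound keeps a step up within the modulus of [hc] at [b], the second keeps the
   discretization loss below [e / 4]. *)
pose d := Num.min (e1 / 2 / (`|up| + 1)) (e / 4 / (hs + hc D + 1)).
have u1 : 0 < `|up| + 1 by rewrite ltr_wpDl.
have h1 : 0 < hs + hc D + 1 by rewrite ltr_wpDl// addr_ge0.
have d0 : 0 < d by rewrite lt_min !divr_gt0.
have du : `|up| * d < e1.
  apply: (@le_lt_trans _ _ (e1 / 2)); last by rewrite ltr_pdivrMr// ltr_pMr// ltr1n.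
  apply: (@le_trans _ _ ((`|up| + 1) * d)); first by rewrite ler_pM2r// lerDl.
  by rewrite mulrC -ler_pdivlMr// ge_min lexx.
have dh : d * (hs + hc D) <= e / 4.
  apply: (@le_trans _ _ (d * (hs + hc D + 1))); first by rewrite ler_pM2l// lerDl.
  by rewrite -ler_pdivlMr// ge_min lexx orbT.
(* Chosen so that the excess accumulated over all [N1] steps outweighs anything the control could
   save by keeping the state above [b]. *)
pose N1 := (Num.bound ((2 * (r * D) + W b) / (eta * d))).+1.
have HN1 : 2 * (r * D) + W b <= N1%:R * eta * d.
  have ed0 : 0 < eta * d by exact: mulr_gt0.
  rewrite -mulrA -ler_pdivrMr//.
  apply: (@le_trans _ _ (Num.bound ((2 * (r * D) + W b) / (eta * d)))%:R).
    apply/ltW/archi_boundP; apply: divr_ge0; last exact: ltW.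
    by apply: addr_ge0; [rewrite mulr_ge0// mulr_ge0// ltW|apply: W0'; exact: ltW].
  by rewrite ler_nat.
have Hb : (0 < N1)%N -> hs + eta <= hc (b - `|up| * d).
  move=> _; have := He1 (b - `|up| * d).
  rewrite opprB addrCA subrr addr0 ger0_norm ?mulr_ge0 ?(ltW d0)// => /(_ du).
  by move=> /(le_lt_trans (ler_norm _)); rewrite /eta; lra.
have [psi [a0 [hit a00 a0x H]]] := @maximizer_reply _ D r c1 c2 y h D_gt0 r_gt0
    c1_gt0 c2_gt0 h_cont h_incr h_0 y_large x alpha N1 b l d eta x_itv alpha_adm d0 l0 l1
    b_gt0 (ltW eta0) Hb.
have hca : d * hc a0 <= d * hc D by rewrite ler_pM2l// hc_le// (le_trans a0x).
have dhs : 0 <= d * hs by rewrite mulr_ge0// ltW.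
have dhD : 0 <= d * hc D by rewrite mulr_ge0// ltW.
have lWb : l * W b <= W b by rewrite ler_piMl ?W0' ?(ltW b_gt0)// ltW.
have ra0 : r * a0 <= r * D by rewrite ler_pM2l// (le_trans a0x).
have rb : 0 <= r * b by rewrite mulr_ge0// ltW.
exists psi => //.
apply: le_trans (H (r * (a0 - b) + l * W b - d * (hs + hc D)) _ _).
- rewrite lee_fin Wf_high ?(ltW Bx)//.
  by have := Wle _ _ B0 (ltW Bb); lra.
- move=> [//|a0b]; have d1 := dW _ _ a00 (ltW a0b).
  have d2 := Wle _ _ a00 (ltW a0b).
  have : l * (W b - W a0) <= r * (b - a0).
    by apply: le_trans d1; rewrite ler_piMl ?subr_ge0// ltW.
  by lra.
- by move=> _ ba0; split => //; lra.
Qed.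

End lower_bound.

(** * Reflection at [0] and at a moving level *)

Section running_supremum.
Context {R : realType}.
Implicit Types (g f b : R -> R) (s t e d T : R).

Lemma uniform_modulus f T e : continuous f -> 0 < e -> exists2 d, 0 < d &
  forall s s', 0 <= s -> s <= T -> `|s - s'| < d -> `|f s - f s'| < e.
Proof.
move=> cf e0.
have /compact_near_coveringP H := @segment_compact R 0 T.
pose P d s := forall s', `|s - s'| < d -> `|f s - f s'| < e.
have {H} H : \forall d \near 0^'+, `[0, T] `<=` P d.
  apply: H => s _.
  have /cvgrPdist_lt/(_ (e / 2)) := cf s.
  rewrite divr_gt0// => /(_ isT)[n /= n0 Hn].
  exists (ball s (n / 2), [set d | d < n / 2]) => /=.
    split; first by apply: nbhsx_ballx; rewrite divr_gt0.
    by apply: nbhs_right_lt; rewrite divr_gt0.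
  move=> [s' d] [/= ss' dn] s'' s's''.
  have H1 : `|s - s'| < n.
    by apply: lt_trans ss' _; rewrite ltr_pdivrMr// ltr_pMr// ltr1n.
  have H2 : `|s - s''| < n.
    rewrite (_ : s - s'' = (s - s') + (s' - s'')); last by ring.
    apply: le_lt_trans (ler_normD _ _) _; move: ss'; rewrite /ball/=; lra.
  have := Hn _ H1; have := Hn _ H2.
  rewrite (_ : f s' - f s'' = (f s - f s'') - (f s - f s')); last by ring.
  by move=> ? ?; apply: le_lt_trans (ler_normB _ _) _; lra.
near (0 : R)^'+ => d; exists d; first by near: d; exact: nbhs_right_gt.
move=> s s' s0 sT; have : `[0, T] `<=` P d by near: d.
by apply; rewrite /= in_itv/= s0.
Unshelve. all: by end_near. Qed.

(** The regulator of one-sided Skorokhod reflection: with [g = - f] it keeps [f + rsup g]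
    nonnegative. Constant for [t <= 0], it is continuous on the line. *)
Definition rsup g t := sup [set Num.max (g s) 0 | s in `[0, Num.max t 0]].

Lemma rsup_attained g t : continuous g -> exists s, [/\ 0 <= s, s <= Num.max t 0,
  rsup g t = Num.max (g s) 0 & forall u, 0 <= u -> u <= Num.max t 0 -> g u <= rsup g t].
Proof.
move=> cg; have t0 : 0 <= Num.max t 0 by rewrite le_max lexx orbT.
have [|s + Hs] := @EVT_max R (fun s => Num.max (g s) 0) 0 (Num.max t 0) t0.
  apply: continuous_subspaceT; apply: max_fun_continuous => //.
  exact: cst_continuous.
rewrite in_itv/= => /andP[s0 st].
have E : rsup g t = Num.max (g s) 0.
  apply/eqP; rewrite eq_le; apply/andP; split.
    apply: ge_sup; first by exists (Num.max (g s) 0); exists s => //=; rewrite in_itv/= s0.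
    by move=> _ [u uI <-]; exact: Hs.
  apply: sup_upper_bound; last by exists s => //=; rewrite in_itv/= s0.
  split; first by exists (Num.max (g s) 0); exists s => //=; rewrite in_itv/= s0.
  by exists (Num.max (g s) 0) => _ [u uI <-]; exact: Hs.
exists s; split => // u u0 ut; rewrite E (le_trans _ (Hs u _)) ?le_max ?lexx//.
by rewrite in_itv/= u0.
Qed.

Lemma rsup_ge0 g t : continuous g -> 0 <= rsup g t.
Proof. by move=> /(rsup_attained t)[s [_ _ -> _]]; rewrite le_max lexx orbT. Qed.

Lemma rsup_ge g s t : continuous g -> 0 <= s -> s <= t -> g s <= rsup g t.
Proof.
move=> /(rsup_attained t)[u [_ _ _ H]] s0 st; apply: H => //.
by rewrite le_max st.
Qed.

Lemma rsup_le g t c : continuous g -> 0 <= c ->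
  (forall s, 0 <= s -> s <= Num.max t 0 -> g s <= c) -> rsup g t <= c.
Proof.
move=> /(rsup_attained t)[u [u0 ut -> _]] c0 H.
by rewrite ge_max c0 H.
Qed.

Lemma rsup_mono g s t : continuous g -> s <= t -> rsup g s <= rsup g t.
Proof.
move=> cg st; have /(rsup_attained t)[u [_ _ _ H]] := cg.
apply: rsup_le => //; first exact: rsup_ge0.
move=> v v0 vs; apply: H => //; apply: le_trans vs _.
by rewrite ge_max le_max st/= le_max lexx orbT.
Qed.

Lemma rsup_dist g g' t e : continuous g -> continuous g' -> 0 <= e -> 0 <= t ->
  (forall s, 0 <= s -> s <= t -> `|g s - g' s| <= e) -> `|rsup g t - rsup g' t| <= e.
Proof.
move=> cg cg' e0 t0 H; have tE : Num.max t 0 = t by exact/max_idPl.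
have le g1 g2 : continuous g1 -> continuous g2 ->
    (forall s, 0 <= s -> s <= t -> g1 s <= g2 s + e) -> rsup g1 t <= rsup g2 t + e.
  move=> c1 c2 H12; apply: rsup_le => //; first by rewrite addr_ge0// rsup_ge0.
  by move=> s s0; rewrite tE => st; rewrite (le_trans (H12 _ s0 st))// lerD2r rsup_ge.
rewrite ler_norml; apply/andP; split.
  rewrite lerBrDr addrC lerBlDr; apply: le => // s s0 st.
  by have := H s s0 st; rewrite ler_norml => /andP[]; lra.
rewrite lerBlDr addrC; apply: le => // s s0 st.
by have := H s s0 st; rewrite ler_norml => /andP[]; lra.
Qed.

Lemma eq_rsup g g' t : 0 <= t -> (forall s, 0 <= s -> s <= t -> g s = g' s) ->
  rsup g t = rsup g' t.
Proof.
move=> t0 H; rewrite /rsup; congr sup; apply/seteqP; split => _ [s sI <-]; exists s => //;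
  move: sI; rewrite /= in_itv/= (max_idPl t0) => /andP[s0 st]; by rewrite H.
Qed.

(* A running supremum only grows at times where it is attained. *)
Lemma rsup_grows g s t : continuous g -> 0 <= s -> s <= t -> rsup g s < rsup g t ->
  exists u, [/\ s <= u, u <= t & g u = rsup g t].
Proof.
move=> cg s0 st lt; have [u [u0 ut E _]] := rsup_attained t cg.
have tE : Num.max t 0 = t by apply/max_idPl; exact: le_trans st.
have gu : g u = rsup g t.
  have := rsup_ge0 s cg; move: E lt; rewrite /Num.max; case: ifP => // _ -> lt s0'.
  by move: (le_lt_trans s0' lt); rewrite ltxx.
rewrite tE in ut; exists u; split => //; rewrite leNgt; apply/negP => us.
by move: lt; rewrite ltNge -gu rsup_ge// ltW.
Qed.

Lemma rsup_continuous g : continuous g -> continuous (rsup g).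
Proof.
move=> cg t; apply/cvgrPdist_le => e e0.
pose q (u : R) := Num.max u 0.
have cq : continuous (q : R -> R).
  by apply: max_fun_continuous; [move=> ?; exact: cvg_id|exact: cst_continuous].
have e2 : 0 < e / 2 by rewrite divr_gt0.
have qE u : rsup g u = rsup g (q u).
  by rewrite /rsup/q; congr (sup [set _ | _ in [set` Interval _ (BRight _)]]); rewrite -maxA maxxx.
have [n n0 Hn] : exists2 n, 0 < n & forall z, `|q t - z| < n -> `|g (q t) - g z| < e / 2.
  have gq : g z @[z --> q t] --> g (q t) by exact: cg.
  by move/cvgrPdist_lt : gq => /(_ _ e2)[n /= n0 Hn]; exists n.
have incr a c : 0 <= a -> a <= c -> `|q t - a| < n -> `|q t - c| < n ->
    rsup g c <= rsup g a + e.
  move=> a0 ac Ha Hc; apply: rsup_le => //; first by rewrite addr_ge0 ?rsup_ge0// ltW.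
  move=> u u0; rewrite (max_idPl (le_trans a0 ac)) => uc.
  have [ua|au] := leP u a.
    by rewrite (@le_trans _ _ (rsup g a)) ?rsup_ge// lerDl ltW.
  have Hu : `|q t - u| < n
    by move: Ha Hc; rewrite !ltr_norml => /andP[? ?] /andP[? ?]; apply/andP; split; lra.
  have := Hn _ Ha; have := Hn _ Hu; rewrite !ltr_norml => /andP[h1 _] /andP[_ h2].
  by have := rsup_ge cg a0 (lexx a); lra.
have : q s @[s --> t] --> q t by exact: cq.
move=> /cvgrPdist_lt/(_ _ n0); apply: filterS => s Hs.
rewrite (qE t) (qE s).
have q0 u : 0 <= q u by rewrite le_max lexx orbT.
have qt : `|q t - q t| < n by rewrite subrr normr0.
rewrite ler_norml; have [st|/ltW ts] := leP (q s) (q t).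
  have := incr _ _ (q0 s) st Hs qt; have := rsup_mono cg st; lra.
have := incr _ _ (q0 t) ts qt Hs; have := rsup_mono cg ts; lra.
Qed.

End running_supremum.

(** * Two-sided reflection by alternating one-sided ones *)

Section reflection.
Context {R : realType}.
Variables (f b : R -> R).
Hypotheses (cf : continuous f) (cb : continuous b).
Hypothesis b_gt0 : forall t, 0 <= t -> 0 < b t.
Hypothesis b_noninc : forall s t, 0 <= s -> s <= t -> b t <= b s.

(* Alternately reflecting at [0] and at [b]; each round settles at least the time span
   needed by [f] to rise by [b]. *)
Fixpoint rho_ n : R -> R :=
  if n is n'.+1 then
    rsup (fun s => f s + rsup (fun u => rho_ n' u - f u) s - b s)
  else fun=> 0.
Arguments rho_ : simpl never.
Definition zeta_ n := rsup (fun u => rho_ n u - f u).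

Lemma rho_S n t : rho_ n.+1 t = rsup (fun s => f s + zeta_ n s - b s) t.
Proof. by []. Qed.

Lemma rho_continuous n : continuous (rho_ n).
Proof.
elim: n => [|n ih]; first exact: cst_continuous.
have cz : continuous (zeta_ n).
  by apply: rsup_continuous => t; apply: cvgB; [exact: ih|exact: cf].
apply: (@rsup_continuous _ (fun s => f s + zeta_ n s - b s)) => t.
apply: cvgB; last exact: cb.
by apply: cvgD; [exact: cf|exact: cz].
Qed.

Lemma zeta_arg_continuous n : continuous (fun u => rho_ n u - f u).
Proof. by move=> t; apply: cvgB; [exact: rho_continuous|exact: cf]. Qed.

Lemma zeta_continuous n : continuous (zeta_ n).
Proof. exact/rsup_continuous/zeta_arg_continuous. Qed.

Lemma rho_arg_continuous n : continuous (fun s => f s + zeta_ n s - b s).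
Proof.
move=> t; apply: cvgB; last exact: cb.
by apply: cvgD; [exact: cf|exact: zeta_continuous].
Qed.

Lemma rho_ge0 n t : 0 <= rho_ n t.
Proof. by case: n => // n; rewrite rho_S; apply: rsup_ge0; exact: rho_arg_continuous. Qed.

Lemma zeta_ge0 n t : 0 <= zeta_ n t.
Proof. by apply: rsup_ge0; exact: zeta_arg_continuous. Qed.

Lemma rho_leS n t : rho_ n t <= rho_ n.+1 t.
Proof.
elim: n t => [|n ih] t; first exact: rho_ge0.
rewrite [leLHS]rho_S; apply: rsup_le; [exact: rho_arg_continuous|exact: rho_ge0|].
move=> s s0 st; rewrite [leRHS]rho_S.
have [u [_ _ _ H]] := rsup_attained t (@rho_arg_continuous n.+1).
apply: le_trans (H s s0 st); rewrite lerD2r lerD2l; apply: rsup_le.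
- exact: zeta_arg_continuous.
- exact: zeta_ge0.
- move=> v v0; rewrite (max_idPl s0) => vs.
  by apply: le_trans (rsup_ge (@zeta_arg_continuous n.+1) v0 vs); rewrite lerD2r.
Qed.

Lemma rho_mono m n t : (m <= n)%N -> rho_ m t <= rho_ n t.
Proof.
move=> /subnKC <-; elim: (n - m)%N => [|k ih]; first by rewrite addn0.
by rewrite addnS (le_trans ih)// rho_leS.
Qed.

(** A change of [rho_] at [t] traces back to a change of [zeta_] at some [s <= t], and this to a
    change of [rho_] one round earlier at some [s' <= s]. Between [s'] and [s] the path [f] rises by
    more than [b s], which takes time at least [d]. *)
Lemma rho_slow T d n t : 0 < d ->
  (forall s s', 0 <= s' -> s' <= s -> s <= T -> s - s' < d -> f s - f s' < b s) ->
  0 <= t -> t <= T -> rho_ n t < rho_ n.+1 t -> n%:R * d <= t.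
Proof.
move=> d0 Hd; elim: n t => [|n ih] t t0 tT; first by rewrite mul0r.
move=> lt; have [s [s0 + E _]] := rsup_attained t (@rho_arg_continuous n.+1).
rewrite (max_idPl t0) => st.
have r0 : 0 <= rho_ n.+1 t by exact: rho_ge0.
have Es : rho_ n.+2 t = f s + zeta_ n.+1 s - b s.
  move: lt E; rewrite -rho_S /Num.max; case: ifP => // _ lt E.
  by move: lt; rewrite E ltNge r0.
have ltz : zeta_ n s < zeta_ n.+1 s.
  rewrite ltNge; apply/negP => zs; move: lt; rewrite ltNge => /negP; apply.
  rewrite Es; apply: le_trans (rsup_ge (@rho_arg_continuous n) s0 st).
  by rewrite lerD2r lerD2l.
have [s' [s'0 + E' _]] := rsup_attained s (@zeta_arg_continuous n.+1).
rewrite (max_idPl s0) => s's.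
have z0 : 0 <= zeta_ n s by exact: zeta_ge0.
have Es' : zeta_ n.+1 s = rho_ n.+1 s' - f s'.
  move: ltz; rewrite /zeta_ E' /Num.max; case: ifP => // _; rewrite -/(zeta_ n s).
  by rewrite ltNge z0.
have ltr : rho_ n s' < rho_ n.+1 s'.
  rewrite ltNge; apply/negP => rs; move: ltz; rewrite ltNge => /negP; apply.
  rewrite Es'; apply: le_trans (rsup_ge (@zeta_arg_continuous n) s'0 s's).
  by rewrite lerD2r.
have sT := le_trans st tT.
have ns' := ih s' s'0 (le_trans s's sT) ltr.
have ds : d <= s - s'.
  rewrite leNgt; apply/negP => /(Hd _ _ s'0 s's sT) fb.
  have rm : rho_ n.+1 s' <= rho_ n.+1 t.
    by rewrite !rho_S; apply: rsup_mono; [exact: rho_arg_continuous|exact: le_trans st].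
  by move: lt; rewrite Es Es'; lra.
by rewrite mulrSr mulrDl mul1r; lra.
Qed.

Lemma rho_stable T d n : 0 < d -> T < n%:R * d ->
  (forall s s', 0 <= s' -> s' <= s -> s <= T -> s - s' < d -> f s - f s' < b s) ->
  forall m t, (n <= m)%N -> 0 <= t -> t <= T -> rho_ m t = rho_ n t.
Proof.
move=> d0 nT Hd m t nm t0 tT; move: nm => /subnKC <-.
elim: (m - n)%N => [|k ih]; first by rewrite addn0.
rewrite addnS -[RHS]ih; apply/eqP; rewrite eq_le rho_leS andbT leNgt; apply/negP => lt.
have := rho_slow d0 Hd t0 tT lt.
have : n%:R * d <= (n + k)%:R * d by rewrite ler_pM2r// ler_nat leq_addr.
lra.
Qed.

Lemma rho_settles T : 0 <= T -> exists n, forall m t, (n <= m)%N -> 0 <= t -> t <= T ->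
  rho_ m t = rho_ n t.
Proof.
move=> T0; have [d d0 Hd] := uniform_modulus T cf (b_gt0 T0).
exists (Num.bound (T / d)); apply: (rho_stable d0).
  by rewrite -ltr_pdivrMr//; apply: archi_boundP; rewrite divr_ge0// ltW.
move=> s s' s'0 s's sT ss'; apply: lt_le_trans (b_noninc (le_trans s'0 s's) sT).
apply: le_lt_trans (ler_norm _) (Hd _ _ (le_trans s'0 s's) sT _).
by rewrite ger0_norm// subr_ge0.
Qed.

Definition rho_lim t := sup (range (fun n => rho_ n t)).
Definition zeta_lim := rsup (fun u => rho_lim u - f u).

Lemma rho_limE n t : (forall m, (n <= m)%N -> rho_ m t = rho_ n t) -> rho_lim t = rho_ n t.
Proof.
move=> H; apply/eqP; rewrite eq_le.
have ub m : rho_ m t <= rho_ n t.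
  have [nm|/ltnW mn] := leqP n m; first by rewrite H.
  exact: rho_mono.
apply/andP; split.
  by apply: ge_sup; [exists (rho_ n t); exists n|move=> _ [m _ <-]].
apply: sup_upper_bound; last by exists n.
by split; [exists (rho_ n t); exists n|exists (rho_ n t) => _ [m _ <-]].
Qed.

Lemma zeta_limE n t : 0 <= t ->
  (forall m s, (n <= m)%N -> 0 <= s -> s <= t -> rho_ m s = rho_ n s) ->
  zeta_lim t = zeta_ n t.
Proof.
move=> t0 H; apply: eq_rsup => // s s0 st; rewrite (@rho_limE n)// => m nm.
exact: H.
Qed.

(* On [0, T] the limits are iterates, hence form a fixed point. *)
Lemma reflection_on T : 0 <= T -> exists n, [/\
  forall t, 0 <= t -> t <= T -> rho_lim t = rho_ n t,
  forall t, 0 <= t -> t <= T -> zeta_lim t = zeta_ n t &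
  forall t, 0 <= t -> t <= T -> rho_ n.+1 t = rho_ n t].
Proof.
move=> /rho_settles[n Hn]; exists n; split => t t0 tT.
- by apply: rho_limE => m nm; exact: Hn.
- apply: zeta_limE => // m s nm s0 st; apply: Hn => //; exact: le_trans tT.
- exact: Hn.
Qed.

Lemma reflection_itv t : 0 <= t -> 0 <= f t + zeta_lim t - rho_lim t <= b t.
Proof.
move=> t0; have [n [rE zE fix_]] := reflection_on t0.
rewrite rE// zE//; apply/andP; split.
  have := rsup_ge (@zeta_arg_continuous n) t0 (lexx t); rewrite -/(zeta_ n); lra.
have := rsup_ge (@rho_arg_continuous n) t0 (lexx t); rewrite -rho_S fix_//; lra.
Qed.

(** Complementarity: [zeta_lim] grows only where its running supremum is attained, and there the
    lower constraint is active. *)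
Lemma zeta_lim_grows s t : 0 <= s -> s <= t -> zeta_lim s < zeta_lim t ->
  exists u, [/\ s <= u, u <= t & f u + zeta_lim u - rho_lim u = 0].
Proof.
move=> s0 st; have t0 := le_trans s0 st; have [n [rE zE _]] := reflection_on t0.
rewrite (zE s)// (zE t)// => /(rsup_grows (@zeta_arg_continuous n) s0 st)[u [su ut]].
rewrite -/(zeta_ n) => gu; exists u; split => //.
have u0 := le_trans s0 su; have /andP[le0 _] := reflection_itv u0.
apply/eqP; rewrite eq_le le0 andbT (zE u)// (rE u)//.
have : zeta_ n u <= zeta_ n t by apply: rsup_mono => //; exact: zeta_arg_continuous.
by rewrite -gu; lra.
Qed.

Lemma rho_lim_grows s t : 0 <= s -> s <= t -> rho_lim s < rho_lim t ->
  exists u, [/\ s <= u, u <= t & f u + zeta_lim u - rho_lim u = b u].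
Proof.
move=> s0 st; have t0 := le_trans s0 st; have [n [rE zE fix_]] := reflection_on t0.
rewrite (rE s)// (rE t)// -(fix_ s)// -(fix_ t)//.
move=> /(rsup_grows (@rho_arg_continuous n) s0 st)[u [su ut]].
rewrite -rho_S => gu; exists u; split => //.
have u0 := le_trans s0 su; have /andP[_ leb] := reflection_itv u0.
apply/eqP; rewrite eq_le leb/= (zE u)// (rE u)// -(fix_ u)//.
have : rho_ n.+1 u <= rho_ n.+1 t.
  by rewrite !rho_S; apply: rsup_mono => //; exact: rho_arg_continuous.
by rewrite -gu; lra.
Qed.

Lemma rho_lim_mono s t : 0 <= s -> s <= t -> rho_lim s <= rho_lim t.
Proof.
move=> s0 st; have t0 := le_trans s0 st; have [n [rE zE fix_]] := reflection_on t0.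
rewrite !rE// -!fix_// !rho_S; apply: rsup_mono => //; exact: rho_arg_continuous.
Qed.

Lemma zeta_lim_mono s t : 0 <= s -> s <= t -> zeta_lim s <= zeta_lim t.
Proof.
move=> s0 st; have t0 := le_trans s0 st; have [n [rE zE fix_]] := reflection_on t0.
rewrite !zE//; apply: rsup_mono => //; exact: zeta_arg_continuous.
Qed.

Lemma rsup0 (g : R -> R) : continuous g -> rsup g 0 = Num.max (g 0) 0.
Proof.
move=> /(rsup_attained 0)[s [s0 + -> _]]; rewrite maxxx => s0'.
by have -> : s = 0 by apply/eqP; rewrite eq_le s0 s0'.
Qed.

(** As [b 0 > 0], both boundaries cannot be active at time [0], so the only initial push is the one
    down to [b 0]. *)
Lemma reflection0 : 0 <= f 0 -> zeta_lim 0 = 0 /\ rho_lim 0 = Num.max (f 0 - b 0) 0.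
Proof.
move=> f0; have [n [rE zE fix_]] := reflection_on (lexx 0).
have b0 := b_gt0 (lexx 0).
rewrite rE// zE//; have := fix_ 0 (lexx 0) (lexx 0).
rewrite rho_S rsup0; last exact: rho_arg_continuous.
have zn : zeta_ n 0 = Num.max (rho_ n 0 - f 0) 0.
  by rewrite /zeta_ rsup0//; exact: zeta_arg_continuous.
move=> rn.
have z0 : zeta_ n 0 = 0.
  move: rn zn; set z := zeta_ n 0; set ro := rho_ n 0; rewrite /Num.max.
  by case: (ltP (f 0 + z - b 0)) => ?; case: (ltP (ro - f 0)) => ?; lra.
by rewrite -rn z0 addr0.
Qed.

Lemma rho_lim_continuous t : 0 <= t -> rho_lim s @[s --> t^'+] --> rho_lim t.
Proof.
move=> t0; have t1 : 0 <= t + 1 by rewrite addr_ge0.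
have [n [rE zE fix_]] := reflection_on t1.
rewrite rE ?lerDl//; apply: (@cvg_trans _ (rho_ n s @[s --> t^'+])); last first.
  by apply: cvg_at_right_filter; exact: rho_continuous.
apply: near_eq_cvg; near=> s; rewrite rE//.
  by rewrite (le_trans t0)//; near: s; exact: nbhs_right_ge.
by near: s; apply: nbhs_right_le; rewrite ltrDl.
Unshelve. all: by end_near. Qed.

Lemma zeta_lim_continuous t : 0 <= t -> zeta_lim s @[s --> t^'+] --> zeta_lim t.
Proof.
move=> t0; have t1 : 0 <= t + 1 by rewrite addr_ge0.
have [n [rE zE fix_]] := reflection_on t1.
rewrite zE ?lerDl//; apply: (@cvg_trans _ (zeta_ n s @[s --> t^'+])); last first.
  by apply: cvg_at_right_filter; exact: zeta_continuous.
apply: near_eq_cvg; near=> s; rewrite zE//.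
  by rewrite (le_trans t0)//; near: s; exact: nbhs_right_ge.
by near: s; apply: nbhs_right_le; rewrite ltrDl.
Unshelve. all: by end_near. Qed.

End reflection.

(** * Causality and continuity of the reflection in the path *)

Section reflection_dependence.
Context {R : realType}.
Variable b : R -> R.
Hypothesis cb : continuous b.
Hypothesis b_gt0 : forall t, 0 <= t -> 0 < b t.
Hypothesis b_noninc : forall s t, 0 <= s -> s <= t -> b t <= b s.

Lemma rho_upto (f f' : R -> R) t n : eq_upto t f f' ->
  forall s, 0 <= s -> s <= t -> rho_ f b n s = rho_ f' b n s.
Proof.
move=> e; elim: n => // n ih s s0 st; rewrite !rho_S; apply: eq_rsup => // u u0 us.
have ut := le_trans us st.
rewrite e ?u0//; congr (_ + _ - _); apply: eq_rsup => // v v0 vu.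
by rewrite ih ?(le_trans vu)// e ?v0 ?(le_trans vu).
Qed.

Lemma rho_lim_upto (f f' : R -> R) t : eq_upto t f f' ->
  forall s, 0 <= s -> s <= t -> rho_lim f b s = rho_lim f' b s.
Proof.
move=> e s s0 st.
rewrite /rho_lim (_ : (fun n => rho_ f b n s) = (fun n => rho_ f' b n s))//.
by apply/funext => n; exact: (@rho_upto f f' t n e).
Qed.

Lemma zeta_lim_upto (f f' : R -> R) t : eq_upto t f f' ->
  forall s, 0 <= s -> s <= t -> zeta_lim f b s = zeta_lim f' b s.
Proof.
move=> e s s0 st; apply: eq_rsup => // u u0 us; have ut := le_trans us st.
by rewrite (rho_lim_upto e)// e ?u0.
Qed.

(** Every running supremum adds the error of [f] once more; the factors count the one-sided
    reflections performed. *)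
Lemma iterates_dist (f f' : R -> R) T eta n : continuous f -> continuous f' -> 0 <= eta ->
  (forall t, 0 <= t -> t <= T -> `|f t - f' t| <= eta) ->
  forall t, 0 <= t -> t <= T ->
    `|rho_ f b n t - rho_ f' b n t| <= (2 * n)%:R * eta /\
    `|zeta_ f b n t - zeta_ f' b n t| <= (2 * n).+1%:R * eta.
Proof.
move=> cf cf' eta0 H.
have zeta_dist m : (forall t, 0 <= t -> t <= T ->
      `|rho_ f b m t - rho_ f' b m t| <= (2 * m)%:R * eta) ->
    forall t, 0 <= t -> t <= T ->
      `|zeta_ f b m t - zeta_ f' b m t| <= (2 * m).+1%:R * eta.
  move=> Hr t t0 tT; apply: rsup_dist => //.
  - exact: zeta_arg_continuous.
  - exact: zeta_arg_continuous.
  - by rewrite mulr_ge0.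
  move=> s s0 st; have sT := le_trans st tT.
  rewrite (_ : _ - _ = (rho_ f b m s - rho_ f' b m s) - (f s - f' s)); last by ring.
  apply: le_trans (ler_normB _ _) _; rewrite mulrSr mulrDl mul1r.
  by apply: lerD; [exact: Hr|exact: H].
suff rho_dist t : 0 <= t -> t <= T -> `|rho_ f b n t - rho_ f' b n t| <= (2 * n)%:R * eta.
  by move=> t t0 tT; split; [exact: rho_dist|exact: zeta_dist].
elim: n t => [|n ih] t t0 tT; first by rewrite subrr normr0 muln0 mul0r.
rewrite !rho_S; apply: rsup_dist => //.
- exact: rho_arg_continuous.
- exact: rho_arg_continuous.
- by rewrite mulr_ge0.
move=> s s0 st; have sT := le_trans st tT.
rewrite (_ : _ - _ = (f s - f' s) + (zeta_ f b n s - zeta_ f' b n s)); last by ring.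
apply: le_trans (ler_normD _ _) _; rewrite mulnS add2n mulrSr mulrDl mul1r addrC.
by apply: lerD; [exact: zeta_dist|exact: H].
Qed.

(** The number of rounds is uniform near [f]: within time [d] the path [f] moves by less than
    [b T / 2], and errors of [b T / 4] at both ends keep the rise of [f'] below [b T]. After that
    many rounds both limits are reached and [iterates_dist] applies. *)
Lemma reflection_modulus (f : R -> R) T e : continuous f -> 0 <= T -> 0 < e ->
  exists2 eta, 0 < eta & forall f', continuous f' ->
    (forall t, 0 <= t -> t <= T -> `|f t - f' t| <= eta) ->
    forall t, 0 <= t -> t <= T ->
      `|rho_lim f b t - rho_lim f' b t| < e /\ `|zeta_lim f b t - zeta_lim f' b t| < e.
Proof.
move=> cf T0 e0; have bT := b_gt0 T0.
have [d d0 Hd] := uniform_modulus T cf (divr_gt0 bT (ltr0n _ 2)).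
pose n := Num.bound (T / d).
have nT : T < n%:R * d.
  by rewrite -ltr_pdivrMr//; apply: archi_boundP; rewrite divr_ge0// ltW.
pose eta := Num.min (b T / 4) (e / 2 / (2 * n).+1%:R).
have eta0 : 0 < eta by rewrite lt_min !divr_gt0.
exists eta => // f' cf' H.
have stable g : continuous g -> (forall t, 0 <= t -> t <= T -> `|f t - g t| <= eta) ->
    forall m t, (n <= m)%N -> 0 <= t -> t <= T -> rho_ g b m t = rho_ g b n t.
  move=> cg Hg; apply: (rho_stable cg cb d0 nT) => s s' s'0 s's sT ss'.
  have s0 := le_trans s'0 s's.
  apply: lt_le_trans (b_noninc s0 sT).
  have := Hd s s' s0 sT; rewrite ger0_norm ?subr_ge0// => /(_ ss').
  have := Hg s s0 sT; have := Hg s' s'0 (le_trans s's sT).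
  have etab : eta <= b T / 4 by rewrite ge_min lexx.
  rewrite !ler_norml !ltr_norml => /andP[h1 h2] /andP[h3 h4] /andP[h5 h6]; lra.
have ff t : 0 <= t -> t <= T -> `|f t - f t| <= eta.
  by move=> _ _; rewrite subrr normr0 ltW.
move=> t t0 tT.
have [h1 h2] := iterates_dist n cf cf' (ltW eta0) H t0 tT.
have lim_eq g : continuous g -> (forall t, 0 <= t -> t <= T -> `|f t - g t| <= eta) ->
    rho_lim g b t = rho_ g b n t /\ zeta_lim g b t = zeta_ g b n t.
  move=> cg Hg; have S := stable g cg Hg; split.
    by apply: rho_limE => // m nm; exact: S.
  apply: zeta_limE => // m s nm s0 st; apply: S => //; exact: le_trans tT.
have [-> ->] := lim_eq f cf ff; have [-> ->] := lim_eq f' cf' H.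
have eta_e : (2 * n).+1%:R * eta < e.
  apply: (@le_lt_trans _ _ (e / 2)); last by rewrite ltr_pdivrMr// ltr_pMr// ltr1n.
  by rewrite mulrC -ler_pdivlMr// ge_min lexx orbT.
split; last exact: le_lt_trans eta_e.
apply: le_lt_trans h1 _; apply: le_lt_trans eta_e.
by rewrite ler_pM2r// ler_nat.
Qed.

End reflection_dependence.

(** * Topology of paths and controls *)

Section function_space_topology.
Context {R : realType}.

Lemma cpath_near (p : cpath R) (T e : R) : 0 < e ->
  nbhs p [set q : cpath R | forall t, 0 <= t -> t <= T -> `|p t - q t| < e].
Proof.
move=> e0.
pose val (q : cpath R) : {family compact, R -> R} := cpath_fun q.
have cv : {for p, continuous val} by exact: initial_continuous.
have N : nbhs (val p) [set g | forall t, `[0, T]%classic t ->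
    [set xy : R * R | ball xy.1 e xy.2] (val p t, g t)].
  apply: fam_nbhs; last exact: segment_compact.
  by rewrite -entourage_ballE; exists e.
apply: (@filterS _ (nbhs p) _ _ _ _ (cv _ N)) => q Hq t t0 tT.
by apply: Hq; rewrite /= in_itv/= t0.
Qed.

Lemma control_continuous (X : topologicalType) (F : X -> control R) :
  (forall x T e, 0 <= T -> 0 < e -> \forall z \near x, forall t, 0 <= t -> t <= T ->
     `|F x t - F z t| < e) -> continuous F.
Proof.
move=> HF; apply: continuous_comp_initial => x.
apply/fam_cvgP => A cA P /uniform_nbhs[E [/= entE EP]].
have [e e0 He] : exists2 e, 0 < e & forall u v : R, `|u - v| < e -> E (u, v).
  move: entE; rewrite -entourage_ballE => -[e /= e0 He].
  by exists e => // u v uv; apply: He.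
have [T T0 HT] : exists2 T, 0 <= T & forall t, A t -> t <= T.
  have [M [Mreal HM]] := compact_bounded cA.
  exists (Num.max 0 (M + 1)); first by rewrite le_max lexx.
  move=> t At; rewrite le_max; apply/orP; right; apply: le_trans (ler_norm _) _.
  by apply: HM At; rewrite ltrDl.
have := HF x T e T0 e0; apply: filterS => z Hz; apply: EP => t At /=.
apply: He; have [t0|t0] := ltP t 0.
  have [n1 _ _ _ _] := controlP (F x); have [n2 _ _ _ _] := controlP (F z).
  by have := n1 t t0; have := n2 t t0; rewrite /control_fun => -> ->; rewrite subrr normr0.
by apply: Hz => //; exact: HT.
Qed.

Lemma continuous_borel (X Y : topologicalType) (F : X -> Y) :
  continuous F -> borel_measurable F.
Proof.
move=> cF B /(_ [set C | <<s @open X >> (F @^-1` C)]); apply; split.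
- split.
  + rewrite /= preimage_set0; exact: sigma_algebra0.
  + move=> C /= HC; rewrite setTD preimage_setC -setTD; exact: sigma_algebraCD.
  + move=> C /= HC; rewrite preimage_bigcup; exact: sigma_algebra_bigcup.
- by move=> O oO /=; apply: sub_gen_smallest; move/continuousP : cF; apply.
Qed.

End function_space_topology.

(** * The reflecting strategy and its admissibility *)

Section reflection_strategy.
Context {R : realType}.
Variables (D y x : R) (b : R -> R).
Hypotheses (x_ge0 : 0 <= x) (cb : continuous b).
Hypothesis b_itv : forall t, 0 <= t -> 0 < b t <= D.
Hypothesis b_noninc : forall s t, 0 <= s -> s <= t -> b t <= b s.

Let b_gt0 t : 0 <= t -> 0 < b t.
Proof. by move=> /b_itv/andP[]. Qed.

Definition uncontrolled psi t := x + pushed y psi t.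

Lemma from_zero_control (g : R -> R) : 0 <= g 0 ->
  (forall s t, 0 <= s -> s <= t -> g s <= g t) ->
  (forall t, 0 <= t -> g s @[s --> t^'+] --> g t) ->
  control_set (fun t => if t < 0 then 0 else g t).
Proof.
move=> g0 gle gc; apply: control_set_intro.
- by move=> t ->.
- by rewrite ltxx.
- by move=> s t s0 st; rewrite !ltNge s0 (le_trans s0 st)/= gle.
- move=> t t0; rewrite ltNge t0/=; apply: cvg_trans (gc t t0).
  apply: near_eq_cvg; near=> s; rewrite ltNge (le_trans t0)//.
Unshelve. all: by end_near. Qed.

Lemma uncontrolled0 psi : 0 <= uncontrolled psi 0.
Proof. by rewrite /uncontrolled pushed0 addr0. Qed.

Lemma zeta_control psi :
  control_set (fun t => if t < 0 then 0 else zeta_lim (uncontrolled psi) b t).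
Proof.
have cf : continuous (uncontrolled psi) := @uncontrolled_continuous _ y x psi.
apply: from_zero_control.
- by have [-> _] := reflection0 cf cb b_gt0 b_noninc (uncontrolled0 psi).
- by move=> s t; exact: zeta_lim_mono.
- by move=> t; exact: zeta_lim_continuous.
Qed.

Lemma rho_control psi :
  control_set (fun t => if t < 0 then 0 else rho_lim (uncontrolled psi) b t).
Proof.
have cf : continuous (uncontrolled psi) := @uncontrolled_continuous _ y x psi.
apply: from_zero_control.
- have [_ ->] := reflection0 cf cb b_gt0 b_noninc (uncontrolled0 psi).
  by rewrite le_max lexx orbT.
- by move=> s t; exact: rho_lim_mono.
- by move=> t; exact: rho_lim_continuous.
Qed.

Definition reflecting psi : control R * control R :=
  (mk_control (zeta_control psi), mk_control (rho_control psi)).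

Lemma reflecting1E psi t : 0 <= t -> (reflecting psi).1 t = zeta_lim (uncontrolled psi) b t.
Proof.
move=> t0; transitivity (if t < 0 then 0 else zeta_lim (uncontrolled psi) b t) => //.
by rewrite ltNge t0.
Qed.

Lemma reflecting2E psi t : 0 <= t -> (reflecting psi).2 t = rho_lim (uncontrolled psi) b t.
Proof.
move=> t0; transitivity (if t < 0 then 0 else rho_lim (uncontrolled psi) b t) => //.
by rewrite ltNge t0.
Qed.

Lemma reflecting_continuous : continuous reflecting.
Proof.
have near_psi (psi : cpath R * cpath R) (T e : R) : 0 <= T -> 0 < e ->
    nbhs psi [set psi' : cpath R * cpath R | forall t, 0 <= t -> t <= T ->
      `|rho_lim (uncontrolled psi) b t - rho_lim (uncontrolled psi') b t| < e /\
      `|zeta_lim (uncontrolled psi) b t - zeta_lim (uncontrolled psi') b t| < e].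
  move=> T0 e0.
  have cf psi' : continuous (uncontrolled psi') := @uncontrolled_continuous _ y x psi'.
  have [eta eta0 H] := reflection_modulus cb b_gt0 b_noninc (cf psi) T0 e0.
  have eta2 : 0 < eta / 2 by rewrite divr_gt0.
  have N1 := cpath_near psi.1 T eta2; have N2 := cpath_near psi.2 T eta2.
  have : nbhs psi [set psi' : cpath R * cpath R |
      (forall t, 0 <= t -> t <= T -> `|psi.1 t - psi'.1 t| < eta / 2) /\
      (forall t, 0 <= t -> t <= T -> `|psi.2 t - psi'.2 t| < eta / 2)].
    exists ([set q : cpath R | forall t, 0 <= t -> t <= T -> `|psi.1 t - q t| < eta / 2],
      [set q : cpath R | forall t, 0 <= t -> t <= T -> `|psi.2 t - q t| < eta / 2]) => //.
  apply: filterS => psi' [H1 H2]; apply: H => // t t0 tT.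
  rewrite /uncontrolled /pushed (_ : _ - _ = (psi.1 t - psi'.1 t) - (psi.2 t - psi'.2 t));
    last by ring.
  by apply: le_trans (ler_normB _ _) _; have := H1 t t0 tT; have := H2 t t0 tT; lra.
have c1 : continuous (fun psi => (reflecting psi).1).
  apply: control_continuous => psi T e T0 e0.
  have := near_psi psi T e T0 e0; apply: filterS => psi' H t t0 tT.
  by rewrite !reflecting1E//; case: (H t t0 tT).
have c2 : continuous (fun psi => (reflecting psi).2).
  apply: control_continuous => psi T e T0 e0.
  have := near_psi psi T e T0 e0; apply: filterS => psi' H t t0 tT.
  by rewrite !reflecting2E//; case: (H t t0 tT).
by move=> psi P HP; exact: (cvg_pair (c1 psi) (c2 psi) HP).
Qed.

Lemma reflecting_dynamics psi t : 0 <= t ->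
  dynamics y x psi (reflecting psi).1 (reflecting psi).2 t =
  uncontrolled psi t + zeta_lim (uncontrolled psi) b t - rho_lim (uncontrolled psi) b t.
Proof. by move=> t0; rewrite dynamicsE reflecting1E// reflecting2E. Qed.

Lemma reflecting_admissible : admissible D y x reflecting.
Proof.
split; first split.
- by apply: continuous_borel; exact: reflecting_continuous.
- move=> t psi psi' t0 e.
  have ef : eq_upto t (uncontrolled psi) (uncontrolled psi').
    by move=> s st; rewrite /uncontrolled (pushed_upto y e).
  split=> s /andP[s0 st]; first by rewrite !reflecting1E//; exact: (zeta_lim_upto b ef).
  by rewrite !reflecting2E//; exact: (rho_lim_upto b ef).
- move=> psi t t0; rewrite reflecting_dynamics//.
  have cf : continuous (uncontrolled psi) := @uncontrolled_continuous _ y x psi.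
  have /andP[-> H] := reflection_itv cf cb b_gt0 b_noninc t0.
  by rewrite (le_trans H)//; have /andP[] := b_itv t0.
Qed.

End reflection_strategy.

(** * Cost of the reflecting strategy *)

Section barrier_curve.
Context {R : realType}.
Variables (D r c1 c2 y : R) (h : R -> R).
Hypotheses (D_gt0 : 0 < D) (r_gt0 : 0 < r) (c1_gt0 : 0 < c1) (c2_gt0 : 0 < c2).
Hypotheses (h_cont : {within `[0, D], continuous h}).
Hypotheses (h_incr : {in `[0, D] &, {homo h : u v / u < v}}) (h_0 : h 0 = 0).
Hypothesis y_large : r / (4 * (c1^-1 + c2^-1)^-1) <= - y.
Local Notation hs := (reflection_threshold r c1 c2 y).
Local Notation barrier := (barrier D_gt0 r_gt0 h_cont h_incr h_0 y_large).
Local Notation W := (W D r c1 c2 y h).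
Local Notation Wf := (Wf D_gt0 r_gt0 h_cont h_incr h_0 y_large).
Local Notation slope := (slope D r c1 c2 y h).
Local Notation hc := (hc D h).
Local Notation G := (conjugate c1 c2 y).
Local Notation mu := (@lebesgue_measure R).

(* An integrable allowance for the running cost above the threshold, so that the
   reflecting level stays positive even when the threshold is [0]. *)
Definition allowance e t : R := e / (1 + Num.max t 0) ^+ 2.

Lemma one_plus_gt0 (t : R) : 0 < 1 + Num.max t 0.
Proof. by rewrite ltr_pwDl// le_max lexx orbT. Qed.

Lemma allowance_gt0 e t : 0 < e -> 0 < allowance e t.
Proof. by move=> e0; rewrite divr_gt0// exprn_gt0// one_plus_gt0. Qed.

Lemma allowance_le e s t : 0 < e -> s <= t -> allowance e t <= allowance e s.
Proof.
move=> e0 st; rewrite /allowance ler_pM2l// lef_pV2 ?posrE ?exprn_gt0 ?one_plus_gt0//.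
rewrite ler_sqr ?nnegrE ?(ltW (one_plus_gt0 _))// lerD2l ge_max !le_max st/=.
by rewrite lexx orbT.
Qed.

(** The allowance is the derivative of [- e / (1 + t)] and decreases, so its value at the right end
    of a step is below its mean. The total over all times is at most [e]. *)
Lemma allowance_telescope e s t : 0 < e -> 0 <= s -> s <= t ->
  allowance e t * (t - s) <= e / (1 + s) - e / (1 + t).
Proof.
move=> e0 s0 st; rewrite /allowance (max_idPl (le_trans s0 st)).
have s1 : 0 < 1 + s by rewrite ltr_pwDl.
have t1 : 0 < 1 + t by rewrite ltr_pwDl// (le_trans s0).
have -> : e / (1 + s) - e / (1 + t) = e * (t - s) / ((1 + s) * (1 + t)).
  by field; rewrite !gt_eqF.
rewrite mulrAC ler_wpM2l//; first by rewrite mulr_ge0 ?subr_ge0// ltW.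
by rewrite lef_pV2 ?posrE ?mulr_gt0 ?exprn_gt0// expr2 ler_pM2r// lerD2l.
Qed.

Lemma allowance_continuous e : continuous (allowance e).
Proof.
have c1p : continuous (fun t : R => 1 + Num.max t 0).
  move=> t; apply: cvgD; first exact: cvg_cst.
  move: t; apply: max_fun_continuous; [by move=> ?; exact: cvg_id|exact: cst_continuous].
move=> t; apply: cvgMr; apply: cvgV; first by rewrite gt_eqF// exprn_gt0// one_plus_gt0.
rewrite (_ : (fun t => _ ^+ 2) = (fun t => (1 + Num.max t 0) * (1 + Num.max t 0))).
  by rewrite expr2; apply: cvgM; exact: c1p.
by apply/funext => s; rewrite expr2.
Qed.

Lemma hD_gt0 : 0 < h D.
Proof. by rewrite -h_0; apply: h_incr; rewrite // in_itv/= ?lexx ltW. Qed.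

Lemma h_le_inv u v : 0 <= u -> u <= D -> 0 <= v -> v <= D -> h u <= h v -> u <= v.
Proof.
move=> u0 uD v0 vD; apply: contraTT; rewrite -!ltNge => vu; apply: h_incr => //;
  by rewrite in_itv/= ?u0 ?v0.
Qed.

Definition h_inv v := xget 0 [set z | 0 <= z <= D /\ h z = v].

Lemma h_invP v : 0 <= v -> v <= h D -> 0 <= h_inv v <= D /\ h (h_inv v) = v.
Proof.
move=> v0 vD; apply: (xgetPex 0 (P := [set z | 0 <= z <= D /\ h z = v])).
have D0 := ltW D_gt0.
have [|z + hz] := @IVT R h 0 D v D0 h_cont.
  by rewrite h_0 (min_idPl (ltW hD_gt0)) (max_idPr (ltW hD_gt0)) v0.
by rewrite in_itv/= => zI; exists z.
Qed.

Lemma h_inv_continuous : {within `[0, h D], continuous h_inv}.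
Proof.
have hK : {in `[0, D], cancel h h_inv}.
  move=> z; rewrite in_itv/= => /andP[z0 zD].
  have hz0 : 0 <= h z by exact: (h_ge0 h_incr).
  have hzD : h z <= h D by apply: (h_le h_incr).
  have [/andP[i0 iD] E] := h_invP hz0 hzD.
  by apply/eqP; rewrite eq_le; apply/andP; split; apply: h_le_inv; rewrite ?E.
by have := segment_can_le_continuous (ltW D_gt0) h_cont hK; rewrite h_0.
Qed.

(** Clipping to [[0, h D]] puts the level at [D] when [h] does not reach the threshold plus the
    allowance. *)
Definition level e t := h_inv (clip (h D) (hs + allowance e t)).

Lemma level_continuous e : continuous (level e).
Proof.
move=> t; apply: (@continuous_comp _ _ _ (fun t => hs + allowance e t)
    (fun v => h_inv (clip (h D) v))).
  by apply: cvgD; [exact: cvg_cst|exact: allowance_continuous].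
exact: (hc_continuous hD_gt0 h_inv_continuous).
Qed.

Let hs_ge0 : 0 <= hs.
Proof. exact: reflection_threshold_ge0. Qed.

Lemma level_spec e t : 0 < e -> [/\ 0 < level e t, level e t <= D &
  h (level e t) = Num.min (hs + allowance e t) (h D)].
Proof.
move=> e0; have a0 := allowance_gt0 t e0.
have hD0 := hD_gt0.
have -> : Num.min (hs + allowance e t) (h D) = clip (h D) (hs + allowance e t).
  rewrite /clip (max_idPr _)// le_min (ltW hD_gt0) andbT.
  by rewrite addr_ge0// ltW.
have /andP[v0 vD] := clip_itv (ltW hD0) (hs + allowance e t).
have [/andP[l0 lD] lE] := h_invP v0 vD; split => //.
rewrite lt_neqAle l0 andbT; apply/eqP => l00.
move: lE; rewrite -/(level e t) -l00 h_0 => /eqP; rewrite eq_sym => /eqP.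
rewrite /clip (max_idPr _); last by rewrite le_min (ltW hD_gt0) andbT addr_ge0// ltW.
by apply/eqP; rewrite gt_eqF// lt_min hD0 andbT ltr_wpDl.
Qed.

Lemma level_noninc e s t : 0 < e -> s <= t -> level e t <= level e s.
Proof.
move=> e0 st; have [s0 sD sE] := level_spec s e0; have [t0 tD tE] := level_spec t e0.
apply: h_le_inv; rewrite ?(ltW s0) ?(ltW t0)// sE tE.
by rewrite le_min !ge_min lexx orbT andbT lerD2l allowance_le.
Qed.

Lemma barrier_le_level e t : 0 < e -> barrier <= level e t.
Proof.
move=> e0; have [t0 tD tE] := level_spec t e0.
have /andP[B0 BD] := barrier_itv D_gt0 r_gt0 h_cont h_incr h_0 y_large.
apply: h_le_inv; rewrite ?(ltW t0)// tE h_barrier.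
rewrite le_min !ge_min lexx orbT andbT.
by rewrite lerDl (ltW (allowance_gt0 t e0)).
Qed.

Lemma h_level_le e t : 0 < e -> h (level e t) <= hs + allowance e t.
Proof. by move=> e0; have [_ _ ->] := level_spec t e0; rewrite ge_min lexx. Qed.

(* A convex potential with slope [r] above [kap], close to [Wf] when [kap] is close to
   the barrier. *)
Definition bent_slope kap z := if z <= kap then slope z else r.
Definition bent kap z := W (Num.min z kap) + r * Num.max (z - kap) 0.

Let W_sub (u v : R) : 0 <= u -> 0 <= v -> W v - W u <= slope v * (v - u).
Proof. by move=> *; exact: W_convex. Qed.

Let W_lip (a b : R) : 0 <= a -> a <= b -> W b - W a <= r * (b - a).
Proof. by move=> *; exact: W_increment_le. Qed.

Let W_mono (a b : R) : 0 <= a -> a <= b -> W a <= W b.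
Proof. by move=> *; exact: W_le. Qed.

Let slope_r z : slope z <= r.
Proof. exact: slope_le_r. Qed.

Lemma bent_low kap z : z <= kap -> bent kap z = W z.
Proof.
by move=> zk; rewrite /bent (min_idPl zk) (max_idPr _) ?mulr0 ?addr0// subr_le0.
Qed.

Lemma bent_high kap z : kap <= z -> bent kap z = W kap + r * (z - kap).
Proof. by move=> zk; rewrite /bent (min_idPr zk) (max_idPl _)// subr_ge0. Qed.

Lemma bent_convex kap u v : 0 <= kap -> 0 <= u -> 0 <= v ->
  bent kap v - bent kap u <= bent_slope kap v * (v - u).
Proof.
move=> k0 u0 v0; rewrite /bent_slope; case: (leP v kap) => [vk|/ltW kv].
  rewrite (bent_low vk); have [uk|/ltW ku] := leP u kap.
    by rewrite (bent_low uk); exact: W_sub.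
  rewrite (bent_high ku); have := W_sub k0 v0.
  have : slope v * (u - kap) <= r * (u - kap) by rewrite ler_wpM2r ?subr_ge0.
  lra.
rewrite (bent_high kv); have [uk|/ltW ku] := leP u kap.
  by rewrite (bent_low uk); have := W_lip u0 uk; lra.
by rewrite (bent_high ku); lra.
Qed.

Lemma bent_ge0 kap z : 0 <= kap -> 0 <= z -> 0 <= bent kap z.
Proof.
move=> k0 z0; apply: addr_ge0.
  by apply: W_ge0 => //; rewrite le_min z0.
by rewrite mulr_ge0 ?(ltW r_gt0)// le_max lexx orbT.
Qed.

(** Lowering the bend by [e] costs at most [r * e]; raising it above the barrier costs nothing, as
    [slope <= r]. *)
Lemma bent_le kap z e : 0 <= kap -> 0 <= e -> barrier - e <= kap -> 0 <= z ->
  bent kap z <= Wf z + r * e.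
Proof.
move=> k0 e0 Bk z0.
have /andP[B0 BD] := barrier_itv D_gt0 r_gt0 h_cont h_incr h_0 y_large.
have re : 0 <= r * e by rewrite mulr_ge0// ltW.
have [zk|/ltW kz] := leP z kap.
  rewrite (bent_low zk); have [zB|/ltW Bz] := leP z barrier.
    by rewrite Wf_low// lerDl.
  by rewrite Wf_high//; have := W_lip B0 Bz; lra.
rewrite (bent_high kz); have [zB|/ltW Bz] := leP z barrier.
  rewrite Wf_low//; have := W_mono k0 kz.
  have : r * (z - kap) <= r * e by rewrite ler_pM2l//; lra.
  lra.
rewrite Wf_high//; have [kB|/ltW Bk'] := leP kap barrier.
  have := W_mono k0 kB.
  have : r * (barrier - kap) <= r * e by rewrite ler_pM2l//; lra.
  lra.
by have := W_lip B0 Bk'; lra.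
Qed.

(** [G] cancels the capped cost below [kap] and equals [- hs] above it. What can remain is the
    excess of [h] over the threshold, which the level keeps within the allowance. *)
Lemma conjugate_bent kap z e t : 0 < e -> 0 <= z -> z <= level e t ->
  hc z + G (bent_slope kap z) <= allowance e t.
Proof.
move=> e0 z0 zl; have [l0 lD lE] := level_spec t e0.
have hz : hc z <= hs + allowance e t.
  apply: le_trans (h_level_le t e0); rewrite hc_id//; last exact: le_trans lD.
  by apply: (h_le h_incr).
have a0 := ltW (allowance_gt0 t e0).
rewrite /bent_slope; case: (leP z kap) => _; last by move: hz; rewrite /reflection_threshold; lra.
have -> : G (slope z) = - capped D r c1 c2 y h z by exact: conjugate_slope.
rewrite /capped; case: (leP (hc z) hs) => _; last by move: hz; lra.
by rewrite subrr.
Qed.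

(** * Verification along a fixed path *)

Section verification.
Variables (x e : R) (psi : cpath R * cpath R).
Hypotheses (x_ge0 : 0 <= x) (e_gt0 : 0 < e).
Local Notation f := (uncontrolled y x psi).
Local Notation b := (level e).
Local Notation zeta := (zeta_lim f b).
Local Notation rho := (rho_lim f b).

Let cf : continuous f := @uncontrolled_continuous _ y x psi.
Let cb : continuous b := @level_continuous e.
Let b_gt0 (t : R) : 0 <= t -> 0 < b t.
Proof. by move=> _; have [] := level_spec t e_gt0. Qed.
Let b_noninc (s t : R) : 0 <= s -> s <= t -> b t <= b s.
Proof. by move=> _; exact: level_noninc. Qed.

Definition state t := f t + zeta t - rho t.

Lemma state_itv t : 0 <= t -> 0 <= state t <= b t.
Proof. exact: reflection_itv. Qed.

Lemma state_modulus (g : R -> R) (T eta : R) : continuous g -> 0 <= T -> 0 < eta ->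
  exists2 d, 0 < d & forall s s', 0 <= s -> s <= T -> 0 <= s' -> s' <= T ->
    `|s - s'| < d -> `|g (state s) - g (state s')| < eta.
Proof.
move=> cg T0 eta0.
have [n [rE zE _]] := reflection_on cf cb b_gt0 b_noninc T0.
pose st t := f t + zeta_ f b n t - rho_ f b n t.
have cst : continuous (g \o st).
  move=> t; apply: continuous_comp; last exact: cg.
  apply: cvgB; last exact: rho_continuous.
  by apply: cvgD; [exact: cf|exact: zeta_continuous].
have [d d0 H] := uniform_modulus T cst eta0; exists d => // s s' s0 sT s'0 s'T ss'.
by have := H s s' s0 sT ss'; rewrite /st/= /state !rE// !zE.
Qed.

Section step.
Variables (T kap eta c s t : R).
Hypotheses (kap_gt0 : 0 < kap) (eta_lt : eta <= b T - kap) (eta_kap : eta <= kap).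
Hypotheses (slope_eta : slope eta <= c).
Hypotheses (s_ge0 : 0 <= s) (st : s <= t) (tT : t <= T).
Hypothesis near_state : forall u, s <= u -> u <= t -> `|state u - state t| < eta.
Local Notation p := (bent_slope kap (state t)).

(** If [rho] grows on the step, the state touches the level during it, hence ends above [kap], where
    the slope is exactly [r]. *)
Lemma rho_step : r * (rho t - rho s) = p * (rho t - rho s).
Proof.
have := rho_lim_mono cf cb b_gt0 b_noninc s_ge0 st; rewrite le_eqVlt.
case/predU1P => [->|/(rho_lim_grows cf cb b_gt0 b_noninc s_ge0 st)[u [su ut uE]]].
  by rewrite subrr !mulr0.
have := near_state su ut; rewrite {1}/state uE ltr_norml => /andP[_ Hu].
have bu : b T <= b u by apply: b_noninc; [exact: le_trans su|exact: le_trans tT].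
have kt : kap < state t.
  by move: (b u) (b T) (state t) bu Hu eta_lt => v w z; lra.
by rewrite /bent_slope leNgt kt.
Qed.

(** If [zeta] grows on the step, the state touches [0] during it, hence ends below [eta], where the
    slope is at most [c]. *)
Lemma zeta_step : p * (zeta t - zeta s) <= c * (zeta t - zeta s).
Proof.
have := zeta_lim_mono cf cb b_gt0 b_noninc s_ge0 st; rewrite le_eqVlt.
case/predU1P => [->|lt]; first by rewrite subrr !mulr0.
have [u [su ut uE]] := zeta_lim_grows cf cb b_gt0 b_noninc s_ge0 st lt.
have := near_state su ut; rewrite {1}/state uE ltr_norml => /andP[Hu _].
have tz : state t < eta by move: Hu; rewrite sub0r ltrN2.
rewrite ler_pM2r ?subr_gt0// /bent_slope (le_trans (ltW tz) eta_kap).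
by apply: le_trans slope_eta; apply: slope_le => //; exact: ltW.
Qed.

(** Each added term pays for one error: [a * t] for the oscillation of [h], [- e / (1 + t)] for the
    allowance, [c * zeta t] for the pushes at [0]. *)
Lemma step_gain a :
  (hc (state t) + a) * (t - s) + r * (rho t - rho s)
    - (p * (pushed y psi t - pushed y psi s) - G p * (t - s)) <=
  (a * t - e / (1 + t) + c * zeta t - bent kap (state t))
    - (a * s - e / (1 + s) + c * zeta s - bent kap (state s)).
Proof.
have t0 := le_trans s_ge0 st.
have /andP[st0 stb] := state_itv t0; have /andP[ss0 _] := state_itv s_ge0.
have H1 : (hc (state t) + G p) * (t - s) <= e / (1 + s) - e / (1 + t).
  apply: le_trans (allowance_telescope e_gt0 s_ge0 st).
  by rewrite ler_wpM2r ?subr_ge0// conjugate_bent.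
have H2 := bent_convex (ltW kap_gt0) ss0 st0.
have -> : pushed y psi t - pushed y psi s =
    (state t - state s) - (zeta t - zeta s) + (rho t - rho s).
  by rewrite /state /uncontrolled; ring.
have := rho_step; have := zeta_step.
have -> : c * zeta t = c * (zeta t - zeta s) + c * zeta s by ring.
have -> : a * t = a * (t - s) + a * s by ring.
move: (t - s) (state t - state s) (zeta t - zeta s) (rho t - rho s) H1 H2.
move: p (G p) (hc _) (bent _ _) (bent _ _) (c * zeta s) (a * s) (e / _) (e / _).
by move=> q u m B B' cz az E E' dt ds dz dr H1 H2; lra.
Qed.

End step.

Lemma running_cost_le (T a eta : R) (N : nat) (Z Rh : control R) :
  (forall t, 0 <= t -> Z t = zeta t) -> (forall t, 0 <= t -> Rh t = rho t) ->
  0 <= a -> 0 < eta -> N%:R * eta = T ->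
  (forall s t, 0 <= s -> s <= T -> 0 <= t -> t <= T -> `|s - t| <= eta ->
     hc (state s) <= hc (state t) + a) ->
  (\int[mu]_(t in `[0%R, T]) (h (dynamics y x psi Z Rh t))%:E <=
   (\sum_(0 <= k < N) (hc (state (k.+1%:R * eta)) + a) * eta)%:E)%E.
Proof.
move=> ZE RE a0 eta0 NT osc.
have T0 : 0 <= T by rewrite -NT mulr_ge0// ltW.
pose v k := hc (state (k.+1%:R * eta)) + a.
have hc0 z : 0 <= hc z by exact: hc_ge0.
have v0 k : 0 <= v k by rewrite addr_ge0.
have plinE : plin eta N v T = \sum_(0 <= k < N) v k * eta.
  rewrite /plin [LHS]big_nat_cond [RHS]big_nat_cond.
  apply: eq_bigr => k /andP[/andP[_ kN] _].
  rewrite (clip_ge eta0)// -NT -mulrBl ler_peMl ?(ltW eta0)//.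
  by rewrite -natrB ?(ltnW kN)// ler1n subn_gt0.
rewrite -plinE -(step_integral N eta0 T0 v0).
have dynE t : 0 <= t -> dynamics y x psi Z Rh t = state t.
  by move=> t0; rewrite dynamicsE ZE// RE.
have hE t : 0 <= t -> h (state t) = hc (state t).
  move=> t0; have /andP[s0 sb] := state_itv t0; have [_ bD _] := level_spec t e_gt0.
  by rewrite hc_id// (le_trans sb).
apply: (@ge0_integral_ae_le _ _ _ mu _ [set 0]) => //.
- exact: lebesgue_measure_set1.
- apply/measurable_EFinP; exact: step_measurable.
- by move=> t; rewrite /= in_itv/= => /andP[t0 _]; rewrite dynE// hE// lee_fin.
- by move=> t _; rewrite lee_fin step_ge0.
- move=> t; rewrite /= in_itv/= => /andP[t0 tT] tn0.
  have t_gt0 : 0 < t by rewrite lt_neqAle t0 andbT eq_sym; apply/eqP.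
  rewrite dynE// hE// lee_fin.
  have tN : t <= N%:R * eta by rewrite NT.
  have [k kN kt] := grid_find t_gt0 tN.
  rewrite (step_in eta0 _ kN kt) /v; move/andP: kt => [kt tk].
  apply: osc => //; first by rewrite mulr_ge0// ltW.
    by rewrite -NT grid_le.
  rewrite ler_norml; move: kt tk; rewrite mulrSr mulrDl mul1r => ? ?; apply/andP; split; lra.
Qed.

Let f0 : f 0 = x.
Proof. by rewrite /uncontrolled pushed0 addr0. Qed.

Let zeta0 : zeta 0 = 0.
Proof. by have [] := reflection0 cf cb b_gt0 b_noninc; rewrite f0. Qed.

(** The initial jump ends no lower than the barrier, so it runs along the part of [Wf] of slope [r]
    and is paid for exactly. *)
Lemma initial_cost : r * rho 0 + Wf (state 0) <= Wf x.
Proof.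
have r0 : rho 0 = Num.max (x - b 0) 0.
  by have [] := reflection0 cf cb b_gt0 b_noninc; rewrite f0.
have -> : state 0 = x - Num.max (x - b 0) 0 by rewrite /state zeta0 r0 f0; ring.
rewrite r0; have [xb|/ltW bx] := leP x (b 0).
  by rewrite (max_idPr _) ?subr_le0// mulr0 add0r subr0.
have Bb := barrier_le_level 0 e_gt0.
rewrite (max_idPl _) ?subr_ge0// subKr !Wf_high//; [lra|exact: le_trans bx].
Qed.

(** The error collects [r * eps] from moving the bend, [T * eps] from the oscillation of [h] and
    [eps] from the pushes at [0]. *)
Lemma reflecting_cost_le (T eps : R) (Z Rh : control R) : 0 < T -> 0 < eps ->
  (forall t, 0 <= t -> Z t = zeta t) -> (forall t, 0 <= t -> Rh t = rho t) ->
  (cost r c1 c2 y h x T psi Z Rh <= (Wf x + e + (r + T + 1) * eps)%:E)%E.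
Proof.
move=> T_gt0 eps0 ZE RE; have T0 := ltW T_gt0.
have bT := b_gt0 T0.
have BbT : barrier <= b T := barrier_le_level T e_gt0.
(* The bend must be positive and strictly below [b T], the lowest level on [[0, T]], even if the
   barrier is [0] or equals the level. *)
pose kap := Num.max (barrier - eps) (b T / 2).
have kap0 : 0 < kap by rewrite lt_max divr_gt0// orbT.
have kapB : barrier - eps <= kap by rewrite le_max lexx.
have kapT : kap < b T by rewrite gt_max; apply/andP; split; lra.
have z_mono s t := @zeta_lim_mono _ f b cf cb b_gt0 b_noninc s t.
have zT : 0 <= zeta T by rewrite -zeta0 z_mono.
(* For the given path [zeta T] is a fixed number, so a small slope near [0] lets all pushes there
   raise the potential by at most [eps]. *)
pose c := eps / (zeta T + 1).
have c0 : 0 < c by rewrite divr_gt0// ltr_wpDl.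
have cz : c * zeta T <= eps.
  by rewrite /c mulrAC ler_pdivrMr ?ltr_wpDl// ler_wpM2l ?(ltW eps0)// lerDl.
have [eta [eta0 eta_lt eta_kap slope_eta]] : exists eta,
    [/\ 0 < eta, eta <= b T - kap, eta <= kap & slope eta <= c].
  have : slope z @[z --> 0] --> slope 0 by exact: slope_continuous.
  move=> /cvgrPdist_lt/(_ _ c0)[w /= w0 Hw].
  pose m := Num.min (w / 2) (Num.min (b T - kap) kap).
  have m0 : 0 < m by rewrite !lt_min kap0 divr_gt0// subr_gt0 kapT.
  exists m; split => //.
  - by rewrite !ge_min lexx !orbT.
  - by rewrite !ge_min lexx !orbT.
  have mw : m <= w / 2 by rewrite ge_min lexx.
  have Hm : `|slope 0 - slope m| < c.
    by apply: Hw; rewrite /= sub0r normrN gtr0_norm//; lra.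
  have slope00 : slope 0 = 0 by exact: slope0.
  rewrite slope00 sub0r normrN in Hm.
  exact/ltW/(le_lt_trans (ler_norm _) Hm).
have [d1 d10 Hd1] := state_modulus (fun z => @cvg_id _ (nbhs z)) T0 eta0.
have hc_cont : continuous hc by exact: hc_continuous.
have [d2 d20 Hd2] := state_modulus hc_cont T0 eps0.
have [N N0 Nd] : exists2 N : nat, (0 < N)%N & T / N%:R < Num.min d1 d2.
  have d0 : 0 < Num.min d1 d2 by rewrite lt_min d10.
  exists (Num.bound (T / Num.min d1 d2)).+1 => //.
  rewrite ltr_pdivrMr ?ltr0n// mulrC -ltr_pdivrMr//.
  apply: lt_trans (archi_boundP _) _; first by rewrite divr_ge0// ltW.
  by rewrite ltr_nat.
pose d := T / N%:R.
have d0 : 0 < d by rewrite divr_gt0// ltr0n.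
have NdT : N%:R * d = T by rewrite /d mulrC divfK// pnatr_eq0 -lt0n.
have [dd1 dd2] : d < d1 /\ d < d2 by move: Nd; rewrite lt_min => /andP[].
have grid_itv k : (k <= N)%N -> 0 <= k%:R * d /\ k%:R * d <= T.
  by move=> kN; rewrite mulr_ge0 ?(ltW d0)// -NdT grid_le.
pose p k := bent_slope kap (state (k.+1%:R * d)).
pose Phi t := eps * t - e / (1 + t) + c * zeta t - bent kap (state t).
have E : ((\sum_(0 <= k < N) (p k * (pushed y psi (k.+1%:R * d) - pushed y psi (k%:R * d))
    - G (p k) * (k.+1%:R * d - k%:R * d)))%:E <= energy c1 c2 T psi)%E.
  apply: (@energy_ge _ c1 c2 y c1_gt0 c2_gt0 T psi (fun k => k%:R * d)) => //.
    by rewrite mul0r.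
  by move=> k _; rewrite grid_le.
have I : (\int[mu]_(t in `[0%R, T]) (h (dynamics y x psi Z Rh t))%:E <=
    (\sum_(0 <= k < N) (hc (state (k.+1%:R * d)) + eps) * d)%:E)%E.
  apply: running_cost_le => //; first exact: ltW.
  move=> s t s0 sT t0 tT std.
  by have := Hd2 s t s0 sT t0 tT (le_lt_trans std dd2); rewrite ltr_norml => /andP[_]; lra.
have S : \sum_(0 <= k < N) (hc (state (k.+1%:R * d)) + eps) * d + r * (rho T - rho 0)
    - \sum_(0 <= k < N) (p k * (pushed y psi (k.+1%:R * d) - pushed y psi (k%:R * d))
      - G (p k) * (k.+1%:R * d - k%:R * d)) <= Phi T - Phi 0.
  have tele (g : R -> R) : g T - g 0 = \sum_(0 <= k < N) (g (k.+1%:R * d) - g (k%:R * d)).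
    by rewrite (telescope_sumr (fun k => g (k%:R * d)))// NdT mul0r.
  rewrite !tele mulr_sumr -big_split -sumrB /= big_nat_cond [leRHS]big_nat_cond.
  apply: ler_sum => k /andP[/andP[_ kN] _].
  have [s0 _] := grid_itv k (ltnW kN); have [t0 tT] := grid_itv k.+1 kN.
  have sd : k.+1%:R * d = k%:R * d + d by rewrite mulrSr mulrDl mul1r.
  have st : k%:R * d <= k.+1%:R * d by rewrite sd lerDl ltW.
  have -> : (hc (state (k.+1%:R * d)) + eps) * d =
      (hc (state (k.+1%:R * d)) + eps) * (k.+1%:R * d - k%:R * d).
    by rewrite sd (addrC (k%:R * d)) addrK.
  apply: (@step_gain T kap eta c _ _ kap0 eta_lt eta_kap slope_eta s0 st tT _ eps) => u su ut.
  apply: Hd1 => //; [exact: le_trans su|exact: le_trans tT|].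
  by rewrite ler0_norm ?subr_le0//; lra.
have /andP[s0 _] := state_itv (lexx 0); have /andP[s0' _] := state_itv T0.
have Bd := bent_le (ltW kap0) (ltW eps0) kapB s0.
have P0 := bent_ge0 (ltW kap0) s0'.
have Wx := initial_cost.
rewrite /cost RE//.
apply: le_trans (leeB (leeD I (lexx (r * rho T)%:E)) E) _.
rewrite -!(EFinD, EFinB, EFinN) lee_fin.
have eT : 0 <= e / (1 + T) by rewrite divr_ge0 ?(ltW e_gt0)// addr_ge0.
move: S; rewrite /Phi zeta0 addr0 divr1 !mulr0.
set S1 := \sum_(0 <= k < N) _ * d; set S2 := \sum_(0 <= k < N) _; lra.
Qed.

(** [eps] may depend on the path and the horizon and is sent to [0]; [e] is built into the strategy
    and stays. The horizon [0] admits no grid of positive mesh and is treated apart. *)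
Lemma reflecting_cost_limit_le (T : R) (Z Rh : control R) : 0 <= T ->
  (forall t, 0 <= t -> Z t = zeta t) -> (forall t, 0 <= t -> Rh t = rho t) ->
  (cost r c1 c2 y h x T psi Z Rh <= (Wf x)%:E + e%:E)%E.
Proof.
move=> + ZE RE; rewrite le_eqVlt => /predU1P[<-|T0]; last first.
  apply/lee_addgt0Pr => a a0; have rT : 0 < r + T + 1 by rewrite !addr_gt0.
  apply: le_trans (reflecting_cost_le T0 (divr_gt0 a0 rT) ZE RE) _.
  by rewrite mulrC divfK ?gt_eqF// !EFinD.
have I : (\int[mu]_(t in `[0%R, 0%R]) (h (dynamics y x psi Z Rh t))%:E <= 0%:E)%E.
  have := @running_cost_le 0 0 1 0 Z Rh ZE RE (lexx _) ltr01 (mul0r _).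
  rewrite big_nil; apply => s t s0 s1 t0 t1 _.
  have -> : s = t by apply/eqP; rewrite eq_le (le_trans s1)//= (le_trans t1).
  by rewrite addr0.
have E : (0%:E <= energy c1 c2 0 psi)%E.
  have := @energy_ge _ c1 c2 y c1_gt0 c2_gt0 0 psi (fun=> 0) (fun=> 0) 0.
  by rewrite big_nil; apply.
rewrite /cost RE//; apply: le_trans (leeB (leeD I (lexx (r * rho 0)%:E)) E) _.
rewrite -!(EFinD, EFinB, EFinN) lee_fin oppr0 add0r addr0.
have /andP[s0 _] := state_itv (lexx 0).
have /andP[B0 _] := barrier_itv D_gt0 r_gt0 h_cont h_incr h_0 y_large.
have Wf_ge0 : 0 <= Wf (state 0) by exact: (bent_ge0 B0 s0).
rewrite -[leLHS]addr0; apply: lerD (ltW e_gt0).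
by apply: le_trans initial_cost; rewrite lerDl.
Qed.

End verification.
End barrier_curve.

Theorem proposition3p1 (R : realType) (D r c1 c2 y : R) (h : R -> R)
    (D_gt0 : 0 < D) (r_gt0 : 0 < r) (c1_gt0 : 0 < c1) (c2_gt0 : 0 < c2)
    (h_cont : {within `[0, D], continuous h})
    (h_incr : {in `[0, D] &, {homo h : u v / u < v}})
    (h_0 : h 0 = 0)
    (y_large : r / (4 * (c1^-1 + c2^-1)^-1) <= - y) :
  forall x : R, 0 <= x <= D ->
    game_value D r c1 c2 y h x = hit_value D r c1 c2 y h x.
Proof.
move=> x xI; apply/eqP; rewrite eq_le; apply/andP; split; last first.
  exact: hit_value_le_game_value.
have Wh := Wf_le_hit_value D_gt0 r_gt0 c1_gt0 c2_gt0 h_cont h_incr h_0 y_large xI.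
apply: le_trans Wh; move: xI => /andP[x0 xD].
apply/lee_addgt0Pr => e e0.
have lev t := @level_spec R D r c1 c2 y h D_gt0 r_gt0 h_cont h_incr h_0 y_large e t e0.
have cb : continuous (level D r c1 c2 y h e) by exact: level_continuous.
have b_itv t : 0 <= t -> 0 < level D r c1 c2 y h e t <= D.
  by move=> _; have [-> ->] := lev t.
have b_noninc s t : 0 <= s -> s <= t -> level D r c1 c2 y h e t <= level D r c1 c2 y h e s.
  by move=> _; apply: level_noninc.
apply: (@le_trans _ _ (ereal_sup
      [set cost r c1 c2 y h x p.2 p.1 (reflecting y x0 cb b_itv b_noninc p.1).1
         (reflecting y x0 cb b_itv b_noninc p.1).2 |
         p in [set p : (cpath R * cpath R) * R | 0 <= p.2]])).
  apply: ereal_inf_lbound; exists (reflecting y x0 cb b_itv b_noninc) => //.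
  exact: reflecting_admissible.
apply: ge_ereal_sup => _ [[psi T] /= T0 <-].
apply: reflecting_cost_limit_le => //; [by move=> t; exact: reflecting1E|].
by move=> t; exact: reflecting2E.
Qed.
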